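(* Let $k\ge1$ and let $\Theta$ be the cyclic Nakayama algebra given by the Kupisch series $(2,3)^k=(2,3,2,3,\ldots,2,3)$. Then the defect invariant reverse of $\Theta$ is given by the Kupisch series $(3,4,4)^k=(3,4,4,3,4,4,\ldots,3,4,4)$.
   Context: A cyclic Nakayama algebra is $\mathbb{K}Q/I$ over a field $\mathbb{K}$, $Q$ an oriented cycle, $I$ admissible. Simples are labelled so that $S_{i+1}\cong\tau S_i$ (cyclically, $\tau$ the Auslander--Reiten translate); $P_i=P(S_i)$ has composition factors $S_i,S_{i+1},\dots$ from top to socle; the Kupisch series is $(\ell(P_1),\ell(P_2),\dots)$, which determines the algebra up to cyclic permutation of the series. An exponent $k$ means that the block is repeated $k$ times. For a cyclic Nakayama algebra $\Lambda$, let $\mathcal{S}(\Lambda)$ be a complete set of representatives of isomorphism classes of socles of indecomposable projective $\Lambda$-modules; the syzygy filtered algebra is $\boldsymbol\varepsilon(\Lambda):=\operatorname{End}_\Lambda\big(\bigoplus_{S\in\mathcal{S}(\Lambda)}P(\tau S)\big)$. The defect $\operatorname{def}\Lambda$ is the number of isomorphism classes of indecomposable injective non-projective modules. The defect invariant reverse of $\Theta$ is the cyclic Nakayama algebra $\Lambda$ with $\boldsymbol\varepsilon(\Lambda)\cong\Theta$ and $\operatorname{def}\Lambda=\operatorname{def}\Theta$. *)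

(* Defs.v *)
From HB Require Import structures.
From mathcomp Require Import all_boot all_order all_algebra all_field.

Set Implicit Arguments.
Unset Strict Implicit.
Unset Printing Implicit Defensive.
Set Warnings "-redundant-canonical-projection".

Import GRing.Theory.
Local Open Scope ring_scope.

(* The oriented cycle with n.+1 vertices (a loop when n = 0) has vertex set
   'I_n.+1 and one arrow i -> ordS i for every i, so a path is determined by its
   starting vertex i and its length l. An element of the path algebra is encoded
   by f, where (f i)`_l is the coefficient of the path of length l starting
   at i; paths are composed from left to right. *)
Definition cycle_path_algebra (K : fieldType) (n : nat) : Type :=
  {ffun 'I_n.+1 -> {poly K}}.

Section CyclePathAlgebra.
Variables (K : fieldType) (n : nat).
Local Notation KQ := (cycle_path_algebra K n).

HB.instance Definition _ := GRing.Lmodule.copy KQ {ffun 'I_n.+1 -> {poly K}}.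

Implicit Types (f g h : KQ) (p q : {poly K}) (i : 'I_n.+1).

(* The component at i of a product with right factor g, the left factor having
   component p at i. *)
Definition cpath_mul_at i g p : {poly K} :=
  \sum_(l < size p) p`_l *: ('X^l * g (iter l (@ordS _) i)).

Definition cpath_mul f g : KQ := [ffun i => cpath_mul_at i g (f i)].

Definition cpath_one : KQ := [ffun=> 1].

Lemma cpath_mul_atE m i p g : (size p <= m)%N ->
  cpath_mul_at i g p = \sum_(l < m) p`_l *: ('X^l * g (iter l (@ordS _) i)).
Proof.
move=> lepm; rewrite /cpath_mul_at.
rewrite -!(big_mkord xpredT (fun l => p`_l *: ('X^l * g (iter l (@ordS _) i)))).
rewrite [RHS](big_cat_nat _ lepm) //=.
rewrite [X in _ = _ + X]big_nat_cond [X in _ = _ + X]big1 ?addr0 // => l.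
by rewrite andbT => /andP[le_pl _]; rewrite nth_default // scale0r.
Qed.

Lemma cpath_mul_atP i g c p q :
  cpath_mul_at i g (c *: p + q) = c *: cpath_mul_at i g p + cpath_mul_at i g q.
Proof.
pose m := maxn (size (c *: p + q)%R) (maxn (size p) (size q)).
rewrite !(@cpath_mul_atE m) /m ?leq_max ?leqnn ?orbT //.
rewrite scaler_sumr -big_split; apply: eq_bigr => l _ /=.
by rewrite coefD coefZ scalerDl scalerA.
Qed.

HB.instance Definition _ i g :=
  GRing.isLinear.Build K {poly K} {poly K} _ (cpath_mul_at i g)
    (cpath_mul_atP i g).

Lemma cpath_mul_at_Xn i l q g :
  cpath_mul_at i g ('X^l * q) =
  'X^l * cpath_mul_at (iter l (@ordS _) i) g q.
Proof.
rewrite (@cpath_mul_atE (l + size q)); last first.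
  by rewrite (leq_trans (size_polyMleq _ _)) // size_polyXn.
rewrite big_split_ord /= big1 ?add0r => [|j _]; last first.
  by rewrite coefXnM ltn_ord scale0r.
rewrite /cpath_mul_at mulr_sumr; apply: eq_bigr => j _.
rewrite coefXnM ltnNge leq_addr /= addKn addnC iterD exprD.
by rewrite -scalerAr mulrA ['X^j * 'X^l]mulrC.
Qed.

Lemma cpath_mulA : associative cpath_mul.
Proof.
move=> f g h; apply/ffunP=> i; rewrite !ffunE.
rewrite [X in _ = cpath_mul_at i h X]/cpath_mul_at.
rewrite [RHS](linear_sum (cpath_mul_at i h)).
apply: eq_bigr => l _.
by rewrite (linearZ_LR (cpath_mul_at i h)) /= cpath_mul_at_Xn ffunE.
Qed.

Lemma cpath_mul1l : left_id cpath_one cpath_mul.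
Proof.
move=> f; apply/ffunP=> i; rewrite !ffunE /cpath_mul_at size_poly1.
by rewrite big_ord1 coef1 expr0 mul1r scale1r.
Qed.

Lemma cpath_mul1r : right_id cpath_one cpath_mul.
Proof.
move=> f; apply/ffunP=> i; rewrite !ffunE /cpath_mul_at.
rewrite -[RHS]coefK poly_def; apply: eq_bigr => l _.
by rewrite ffunE mulr1.
Qed.

Lemma cpath_mulDl : left_distributive cpath_mul +%R.
Proof.
move=> f g h; apply/ffunP=> i; rewrite !ffunE.
exact: (linearD (cpath_mul_at i h)).
Qed.

Lemma cpath_mulDr : right_distributive cpath_mul +%R.
Proof.
move=> f g h; apply/ffunP=> i; rewrite !ffunE -big_split.
by apply: eq_bigr => l _; rewrite ffunE mulrDr scalerDr.
Qed.

Lemma cpath_one_neq0 : cpath_one != 0.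
Proof.
by apply/eqP => /ffunP/(_ ord0)/eqP; rewrite !ffunE oner_eq0.
Qed.

HB.instance Definition _ := GRing.Zmodule_isNzRing.Build KQ
  cpath_mulA cpath_mul1l cpath_mul1r cpath_mulDl cpath_mulDr cpath_one_neq0.

Lemma cpath_scaleAl (c : K) f g : c *: (f * g) = (c *: f) * g.
Proof.
apply/ffunP=> i; rewrite !ffunE.
by rewrite -(linearZ_LR (cpath_mul_at i g)).
Qed.

HB.instance Definition _ := GRing.Lmodule_isLalgebra.Build K KQ cpath_scaleAl.

Lemma cpath_scaleAr (c : K) f g : c *: (f * g) = f * (c *: g).
Proof.
apply/ffunP=> i; rewrite !ffunE scaler_sumr; apply: eq_bigr => l _.
by rewrite ffunE -scalerAr !scalerA mulrC.
Qed.

HB.instance Definition _ := GRing.Lalgebra_isAlgebra.Build K KQ cpath_scaleAr.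

(* Membership in the m-th power of the arrow ideal, which is spanned by the
   paths of length at least m. *)
Definition arrow_ideal_pow (m : nat) (f : KQ) : Prop :=
  forall i l, (l < m)%N -> (f i)`_l = 0.

End CyclePathAlgebra.

(* A is isomorphic to KQ / I with I = ker pi admissible. *)
Definition cyclic_nakayama (K : fieldType) (A : falgType K) : Prop :=
  exists (n : nat) (pi : {lrmorphism cycle_path_algebra K n -> A}),
    [/\ forall a : A, exists f, pi f = a,
        forall f, pi f = 0 -> arrow_ideal_pow 2 f
      & exists2 m, (2 <= m)%N & forall f, arrow_ideal_pow m f -> pi f = 0].

(* Right A-modules: ract M a is the map x |-> x a. *)
Record rmodule (K : fieldType) (A : falgType K) := RModule {
  rsort :> vectType K;
  ract : {linear A -> 'End(rsort)};
  ract1 : ract 1 = \1%VF;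
  ractM : forall a b, ract (a * b) = (ract b \o ract a)%VF
}.

(* Left A-modules: lact M a is the map x |-> a x. *)
Record lmodule (K : fieldType) (A : falgType K) := LModule {
  lsort :> vectType K;
  lact : {linear A -> 'End(lsort)};
  lact1 : lact 1 = \1%VF;
  lactM : forall a b, lact (a * b) = (lact a \o lact b)%VF
}.

Section Regular.
Variables (K : fieldType) (A : falgType K).

Lemma regular_act1 : amulr (1 : A) = \1%VF.
Proof. by apply/lfunP=> x; rewrite !lfunE /= mulr1. Qed.

Lemma regular_actM (a b : A) : amulr (a * b) = (amulr b \o amulr a)%VF.
Proof. by apply/lfunP=> x; rewrite comp_lfunE !lfunE /= mulrA. Qed.

Definition regular_rmodule : rmodule A :=
  @RModule K A A (@amulr K A) regular_act1 regular_actM.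

End Regular.

Section Dual.
Variables (K : fieldType) (A : falgType K) (T : lmodule A).
Local Notation DT := 'Hom(T, K^o).

Definition dual_act_fun (a : A) (xi : DT) : DT := (xi \o lact T a)%VF.

Lemma dual_act_fun_linear a : linear (dual_act_fun a).
Proof.
by move=> c xi zeta; rewrite /dual_act_fun comp_lfunDl comp_lfunZl.
Qed.

HB.instance Definition _ a :=
  GRing.isLinear.Build K DT DT _ (dual_act_fun a) (dual_act_fun_linear a).

Definition dual_act (a : A) : 'End(DT) := linfun (dual_act_fun a).

Lemma dual_act_linear : linear dual_act.
Proof.
move=> c a b; apply/lfunP=> xi; rewrite add_lfunE scale_lfunE !lfunE /=.
by rewrite /dual_act_fun linearP /= comp_lfunDr comp_lfunZr.
Qed.

HB.instance Definition _ :=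
  GRing.isLinear.Build K A 'End(DT) _ dual_act dual_act_linear.

Lemma dual_act1 : dual_act 1 = \1%VF.
Proof.
by apply/lfunP=> xi; rewrite !lfunE /= /dual_act_fun lact1 comp_lfun1r.
Qed.

Lemma dual_actM a b : dual_act (a * b) = (dual_act b \o dual_act a)%VF.
Proof.
apply/lfunP=> xi; rewrite comp_lfunE !lfunE /= /dual_act_fun lactM.
by rewrite comp_lfunA.
Qed.

(* The K-dual Hom_K(T, K), with (xi a)(t) = xi (a t). *)
Definition dual_rmodule : rmodule A :=
  @RModule K A DT dual_act dual_act1 dual_actM.

End Dual.

Section Modules.
Variables (K : fieldType) (A : falgType K).
Implicit Types (M N P S : rmodule A).

Definition is_hom M N (f : 'Hom(M, N)) : Prop :=
  forall a, (f \o ract M a = ract N a \o f)%VF.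

Definition isomorphic M N : Prop :=
  exists f : 'Hom(M, N), [/\ is_hom f, lker f = 0%VS & limg f = fullv].

Definition submodule M (U : {vspace M}) : Prop :=
  forall a, (ract M a @: U <= U)%VS.

Definition simple_submodule M (U : {vspace M}) : Prop :=
  [/\ submodule U, U <> 0%VS
    & forall W, submodule W -> (W <= U)%VS -> W = 0%VS \/ W = U].

Definition simple M : Prop := simple_submodule (fullv : {vspace M}).

Definition indecomposable M : Prop :=
  (fullv : {vspace M}) <> 0%VS /\
  forall U W : {vspace M}, submodule U -> submodule W ->
    (U + W)%VS = fullv -> (U :&: W)%VS = 0%VS -> U = 0%VS \/ W = 0%VS.

Definition projective P : Prop :=
  forall M N (g : 'Hom(M, N)) (f : 'Hom(P, N)),
    is_hom g -> limg g = fullv -> is_hom f ->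
    exists2 h : 'Hom(P, M), is_hom h & (g \o h)%VF = f.

Definition injective_module P : Prop :=
  forall M N (g : 'Hom(M, N)) (f : 'Hom(M, P)),
    is_hom g -> lker g = 0%VS -> is_hom f ->
    exists2 h : 'Hom(N, P), is_hom h & (h \o g)%VF = f.

(* U is the sum of all simple submodules of M. *)
Definition is_socle M (U : {vspace M}) : Prop :=
  (forall W, simple_submodule W -> (W <= U)%VS) /\
  (forall U' : {vspace M},
    (forall W, simple_submodule W -> (W <= U')%VS) -> (U <= U')%VS).

Definition composition_length M (l : nat) : Prop :=
  exists U : nat -> {vspace M},
    [/\ U 0%N = 0%VS, U l = fullv, forall i, (i <= l)%N -> submodule (U i)
      & forall i, (i < l)%N -> [/\ (U i <= U i.+1)%VS, U i <> U i.+1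
          & forall W, submodule W -> (U i <= W <= U i.+1)%VS ->
              W = U i \/ W = U i.+1]].

Definition superfluous M (U : {vspace M}) : Prop :=
  forall W, submodule W -> (U + W)%VS = fullv -> W = fullv.

Definition is_projective_cover P M (f : 'Hom(P, M)) : Prop :=
  [/\ projective P, is_hom f, limg f = fullv & superfluous (lker f)].

Definition is_minimal_presentation P1 P0 M
    (p : 'Hom(P1, P0)) (q : 'Hom(P0, M)) : Prop :=
  [/\ is_projective_cover q, projective P1, is_hom p, limg p = lker q
    & superfluous (lker p)].

(* T is the cokernel Tr M of Hom_A(p, A) : Hom_A(P0, A) -> Hom_A(P1, A) for a
   minimal projective presentation P1 -p-> P0 -> M -> 0, where A acts on
   Hom_A(P1, A) by (a h)(x) = a h(x). Only the values of r on Hom_A(P1, A), a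
   subspace of Hom_K(P1, A), are relevant. *)
Definition is_transpose M (T : lmodule A) : Prop :=
  exists P1 P0 (p : 'Hom(P1, P0)) (q : 'Hom(P0, M)),
    is_minimal_presentation p q /\
    exists r : 'Hom('Hom(P1, regular_rmodule A), T),
      [/\ forall (h : 'Hom(P1, regular_rmodule A)) (a : A), is_hom h ->
            r (amull a \o h)%VF = lact T a (r h),
          forall t, exists2 h : 'Hom(P1, regular_rmodule A), is_hom h & r h = t
        & forall h : 'Hom(P1, regular_rmodule A), is_hom h ->
            (r h = 0 <->
             exists2 g : 'Hom(P0, regular_rmodule A),
               is_hom g & h = (g \o p)%VF)].

(* N is isomorphic to the Auslander-Reiten translate tau M = D Tr M. *)
Definition is_AR_translate M N : Prop :=
  exists2 T, is_transpose M T & isomorphic N (dual_rmodule T).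

Definition complete_representatives (C : rmodule A -> Prop) (m : nat)
    (X : 'I_m -> rmodule A) : Prop :=
  [/\ forall i, C (X i), forall i j, isomorphic (X i) (X j) -> i = j
    & forall M, C M -> exists i, isomorphic M (X i)].

Definition is_direct_sum (m : nat) (X : 'I_m -> rmodule A) M : Prop :=
  exists iota : forall i, 'Hom(X i, M),
    (forall i, is_hom (iota i)) /\
    forall v : M, exists x : (forall i, X i), v = \sum_i iota i (x i) /\
      forall y : (forall i, X i), v = \sum_i iota i (y i) ->
        forall i, y i = x i.

Definition is_endomorphism_algebra M (B : falgType K) : Prop :=
  exists phi : {linear B -> 'End(M)},
    [/\ phi 1 = \1%VF, forall a b, phi (a * b) = (phi a \o phi b)%VF,
        injective phi & forall f : 'End(M), is_hom f <-> exists b, phi b = f].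

(* The simples S are labelled so that S (i + 1) = tau (S i) cyclically, and c
   lists the lengths of their projective covers. As any simple may be labelled
   first, this relation is invariant under rotation of c. *)
Definition kupisch_series (c : seq nat) : Prop :=
  exists2 S : 'I_(size c) -> rmodule A,
    complete_representatives simple S &
    forall i, is_AR_translate (S i) (S (ordS i)) /\
      exists P (f : 'Hom(P, S i)),
        is_projective_cover f /\ composition_length P (nth 0%N c i).

(* S is isomorphic to the socle of some indecomposable projective P. *)
Definition projective_socle S : Prop :=
  exists P (f : 'Hom(S, P)),
    [/\ indecomposable P, projective P, is_hom f, lker f = 0%VS
      & is_socle (limg f)].

Definition is_syzygy_filtered_algebra (B : falgType K) : Prop :=
  exists m (S tauS P : 'I_m -> rmodule A) M,
    [/\ complete_representatives projective_socle S,
        forall i, is_AR_translate (S i) (tauS i),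
        forall i, exists f : 'Hom(P i, tauS i), is_projective_cover f,
        is_direct_sum P M
      & is_endomorphism_algebra M B].

Definition defect (d : nat) : Prop :=
  exists X : 'I_d -> rmodule A, complete_representatives
    (fun M => [/\ indecomposable M, injective_module M & ~ projective M]) X.

End Modules.

Arguments kupisch_series {K} A c.
Arguments is_syzygy_filtered_algebra {K} A B.
Arguments defect {K} A d.

Definition defect_invariant_reverse (K : fieldType)
    (Theta Lambda : falgType K) : Prop :=
  [/\ cyclic_nakayama Lambda, is_syzygy_filtered_algebra Lambda Theta
    & exists2 d, defect Lambda d & defect Theta d].

(* Main.v *)
Require Import Defs.
From HB Require Import structures.
From mathcomp Require Import all_boot all_order all_algebra all_field.
From mathcomp Require Import zify.
From Stdlib Require Import ClassicalEpsilon FunctionalExtensionality.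

(** For the lengths c of the indecomposable projectives of a cyclic Nakayama
    algebra, indexed by the integers modulo the number N of simples, put
    f i = i + c i; f is nondecreasing. The socle of P_i is S_(f i - 1), so the
    syzygy filtered algebra is the corner algebra eAe of the idempotent e
    supported on the image of f (the base), and its function f is the
    restriction of f to the base. The injective hull of S_j is projective iff
    j + 1 lies in the base, so the defect is N minus the size of the base. When
    the syzygy filtered algebra is given by (2,3)^k, the restricted f takes
    precisely the even-numbered base vertices as values, hence each odd-numbered
    one has a preimage outside the base. As the defects agree, there are only k
    vertices outside the base, and monotonicity of f then leaves (3,4,4)^k as
    the single possibility.

    A cyclic Nakayama algebra is handled through its basis of nonzero paths;
    projective covers and indecomposable projectives are recognized as the
    modules freely generated by an element u with u = u e_i. *)

Set Implicit Arguments.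
Unset Strict Implicit.
Unset Printing Implicit Defensive.

(** * Modules *)

Import GRing.Theory.
Local Open Scope ring_scope.

(** The definitions speak of arbitrary modules, projective covers and D Tr, so the main labour is to
    turn them into statements about paths. Two facts carry this: the algebra e_i A e_i is local with
    residue field K, the residue map being the character [chi i]; and nonzero paths have bounded
    length, so a longest path with a given property exists. A [path_basis] records only when a path
    vanishes; linear independence of the nonzero paths follows, which is why an admissible ideal on
    a cycle is automatically spanned by paths. Two algebras with path bases for the same N and c are
    isomorphic. This gives the direction from (3,4,4)^k back to Theta: the corner is matched with
    Theta path by path. Existence needs a concrete algebra, a truncated path algebra. The number of
    simples comes from the defects: for (2,3)^k the base consists of the k even vertices out of 2k,
    so N - 2k = k. Vertices are natural numbers read modulo N, so that values of f can be compared
    by size. *)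

Lemma fun_choice (S : Type) (T : S -> Type) (R : forall x, T x -> Prop) :
  (forall x, exists y, R x y) -> exists f : forall x, T x, forall x, R x (f x).
Proof.
move=> RP; exists (fun x => proj1_sig (constructive_indefinite_description _ (RP x))).
by move=> x; case: (constructive_indefinite_description _ (RP x)).
Qed.

Lemma linfun_exists (K : fieldType) (U V : vectType K) (f : U -> V) :
  linear f -> exists g : 'Hom(U, V), g =1 f.
Proof.
move=> fP; pose fM := GRing.isLinear.Build _ _ _ _ f fP.
pose fL : {linear _ -> _} := HB.pack f fM.
by exists (linfun fL) => u; rewrite lfunE.
Qed.

Section ModuleBasics.
Variables (K : fieldType) (A : falgType K).
Implicit Types (M N P Q : rmodule A) (a b e : A).

Definition app M (v : M) a : M := ract M a v.
Local Notation "v · a" := (app v a) (at level 40, left associativity).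

Lemma app1 M (v : M) : v · 1 = v.
Proof. by rewrite /app ract1 id_lfunE. Qed.

Lemma appM M (v : M) a b : v · (a * b) = v · a · b.
Proof. by rewrite /app ractM comp_lfunE. Qed.

Lemma appDr M (v : M) a b : v · (a + b) = v · a + v · b.
Proof. by rewrite /app linearD add_lfunE. Qed.

Lemma appBr M (v : M) a b : v · (a - b) = v · a - v · b.
Proof. by rewrite /app linearB add_lfunE opp_lfunE. Qed.

Lemma appZr M (v : M) k a : v · (k *: a) = k *: (v · a).
Proof. by rewrite /app linearZ scale_lfunE. Qed.

Lemma app0r M (v : M) : v · 0 = 0.
Proof. by rewrite /app linear0 zero_lfunE. Qed.

Lemma app_sumr M (v : M) I (r : seq I) (P : pred I) (F : I -> A) :
  v · (\sum_(i <- r | P i) F i) = \sum_(i <- r | P i) v · F i.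
Proof. by rewrite /app linear_sum sum_lfunE. Qed.

Lemma appDl M (v w : M) a : (v + w) · a = v · a + w · a.
Proof. exact: linearD. Qed.

Lemma appBl M (v w : M) a : (v - w) · a = v · a - w · a.
Proof. exact: linearB. Qed.

Lemma appZl M k (v : M) a : (k *: v) · a = k *: (v · a).
Proof. exact: linearZ. Qed.

Lemma app0l M a : (0 : M) · a = 0.
Proof. exact: linear0. Qed.

Lemma app_suml M a I (r : seq I) (P : pred I) (F : I -> M) :
  (\sum_(i <- r | P i) F i) · a = \sum_(i <- r | P i) F i · a.
Proof. exact: linear_sum. Qed.

Lemma app_linear M (v : M) : linear (app v).
Proof. by move=> k a b; rewrite appDr appZr. Qed.

HB.instance Definition _ M (v : M) :=
  GRing.isLinear.Build K A M _ (app v) (app_linear v).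

Definition gen M (v : M) : 'Hom(A, M) := linfun (app v).

Lemma genE M (v : M) a : gen v a = v · a.
Proof. by rewrite lfunE. Qed.

Definition cyc M (v : M) : {vspace M} := limg (gen v).

Lemma cycP M (v w : M) : reflect (exists a, w = v · a) (w \in cyc v).
Proof.
apply: (iffP memv_imgP) => [[a _ ->]|[a ->]].
  by exists a; rewrite genE.
by exists a; rewrite ?memvf ?genE.
Qed.

Lemma cyc_app M (v : M) a : v · a \in cyc v.
Proof. by apply/cycP; exists a. Qed.

Lemma cyc_id M (v : M) : v \in cyc v.
Proof. by rewrite -{1}[v]app1 cyc_app. Qed.

Lemma is_homP M N (f : 'Hom(M, N)) :
  is_hom f <-> forall v a, f (v · a) = f v · a.
Proof.
split=> [fh v a|fh a]; first by have /lfunP/(_ v) := fh a; rewrite !comp_lfunE.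
by apply/lfunP=> v; rewrite !comp_lfunE; apply: fh.
Qed.

Lemma hom_app M N (f : 'Hom(M, N)) : is_hom f ->
  forall v a, f (v · a) = f v · a.
Proof. by move/is_homP. Qed.

Lemma submoduleP M (U : {vspace M}) :
  submodule U <-> forall v a, v \in U -> v · a \in U.
Proof.
split=> [Us v a vU|Us a].
  by apply: (subvP (Us a)); apply: memv_img.
by apply/subvP=> _ /memv_imgP[v vU ->]; apply: Us.
Qed.

Lemma submodule_app M (U : {vspace M}) : submodule U ->
  forall v a, v \in U -> v · a \in U.
Proof. by move/submoduleP. Qed.

Lemma cyc_submodule M (v : M) : submodule (cyc v).
Proof.
by apply/submoduleP=> w b /cycP[a ->]; rewrite -appM cyc_app.
Qed.

Lemma cyc_sub M (v : M) (U : {vspace M}) :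
  submodule U -> v \in U -> (cyc v <= U)%VS.
Proof.
by move=> Us vU; apply/subvP=> _ /cycP[a ->]; apply: submodule_app.
Qed.

Lemma lker_submodule M N (f : 'Hom(M, N)) : is_hom f -> submodule (lker f).
Proof.
move=> fh; apply/submoduleP=> v a; rewrite !memv_ker hom_app // => /eqP->.
by rewrite app0l.
Qed.

Lemma limg_submodule M N (f : 'Hom(M, N)) : is_hom f -> submodule (limg f).
Proof.
move=> fh; apply/submoduleP=> _ a /memv_imgP[v _ ->].
by rewrite -hom_app // memv_img ?memvf.
Qed.

Lemma limgP M N (f : 'Hom(M, N)) : limg f = fullv -> forall w, exists v, f v = w.
Proof.
move=> fs w; have /memv_imgP[v _ ->]: w \in limg f by rewrite fs memvf.
by exists v.
Qed.

Lemma limg_full M N (f : 'Hom(M, N)) :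
  (forall w, exists v, f v = w) -> limg f = fullv.
Proof.
move=> fs; apply/vspaceP=> w; rewrite memvf; have [v <-] := fs w.
by rewrite memv_img ?memvf.
Qed.

Lemma hom_comp M N P (f : 'Hom(M, N)) (g : 'Hom(N, P)) :
  is_hom f -> is_hom g -> is_hom (g \o f)%VF.
Proof.
by move=> fh gh; apply/is_homP=> v a; rewrite !comp_lfunE !hom_app.
Qed.

Lemma hom_id M : is_hom (\1%VF : 'End(M)).
Proof. by apply/is_homP=> v a; rewrite !id_lfunE. Qed.

Lemma isomorphicP M N : isomorphic M N <->
  exists (f : 'Hom(M, N)) (g : 'Hom(N, M)),
    [/\ is_hom f, is_hom g, cancel f g & cancel g f].
Proof.
split=> [[f [fh /eqP f0 fs]]|[f [g [fh gh fK gK]]]]; last first.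
  exists f; split=> //; first by apply/eqP/lker0P; apply: can_inj fK.
  by apply: limg_full => w; exists (g w).
have fK := lker0_lfunK f0.
have gK : cancel f^-1%VF f by move=> w; apply: limg_lfunVK; rewrite fs memvf.
exists f, f^-1%VF; split=> //; apply/is_homP=> v a.
by rewrite -{1}[v]gK -hom_app // fK.
Qed.

Lemma iso_sym M N : isomorphic M N -> isomorphic N M.
Proof.
by move=> /isomorphicP[f [g [? ? ? ?]]]; apply/isomorphicP; exists g, f.
Qed.

Lemma iso_refl M : isomorphic M M.
Proof.
apply/isomorphicP; exists \1%VF, \1%VF.
by split; try exact: hom_id; move=> v; rewrite !id_lfunE.
Qed.

Lemma iso_trans M N P : isomorphic M N -> isomorphic N P -> isomorphic M P.
Proof.
move=> /isomorphicP[f [g [fh gh fK gK]]] /isomorphicP[f' [g' [fh' gh' fK' gK']]].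
apply/isomorphicP; exists (f' \o f)%VF, (g \o g')%VF.
by split; try exact: hom_comp; move=> v; rewrite !comp_lfunE ?fK' ?fK ?gK ?gK'.
Qed.

Lemma iso_dim M N : isomorphic M N -> \dim {:M} = \dim {:N}.
Proof.
case=> f [_ f0 <-]; rewrite limg_dim_eq // f0.
by rewrite capv0.
Qed.

Lemma iso_projective M N : isomorphic M N -> projective M -> projective N.
Proof.
move=> /isomorphicP[f [g [fh gh fK gK]]] Mp X Y p q ph ps qh.
have [h hh hE] := Mp X Y p (q \o f)%VF ph ps (hom_comp fh qh).
exists (h \o g)%VF; first exact: hom_comp.
apply/lfunP=> v; have /lfunP/(_ (g v)) := hE.
by rewrite !comp_lfunE gK.
Qed.

Lemma iso_injective M N :
  isomorphic M N -> injective_module M -> injective_module N.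
Proof.
move=> /isomorphicP[f [g [fh gh fK gK]]] Mp X Y p q ph ps qh.
have [h hh hE] := Mp X Y p (g \o q)%VF ph ps (hom_comp qh gh).
exists (f \o h)%VF; first exact: hom_comp.
apply/lfunP=> v; have /lfunP/(_ v) := hE.
by rewrite !comp_lfunE => ->; rewrite gK.
Qed.

Lemma img_submodule M N (f : 'Hom(M, N)) (U : {vspace M}) :
  is_hom f -> submodule U -> submodule (f @: U)%VS.
Proof.
move=> fh Us; apply/submoduleP=> _ a /memv_imgP[v vU ->].
by rewrite -hom_app // memv_img ?submodule_app.
Qed.

Lemma vspace0P (V : vectType K) (U : {vspace V}) :
  (forall v, v \in U -> v = 0) -> U = 0%VS.
Proof.
move=> U0; apply/eqP; rewrite -subv0; apply/subvP=> v /U0->; exact: mem0v.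
Qed.

Lemma iso_indecomposable M N :
  isomorphic M N -> indecomposable M -> indecomposable N.
Proof.
move=> MN; have := iso_dim MN; move/isomorphicP: MN.
move=> [f [g [fh gh fK gK]]] dMN [M0 Mi]; split=> [/(congr1 (fun V => \dim V))|].
  by rewrite dimv0 -dMN => /eqP; rewrite dimv_eq0 => /eqP.
move=> U W Us Ws UW1 UW0.
have g0 (V : {vspace N}) : (g @: V)%VS = 0%VS -> V = 0%VS.
  move=> V0; apply: vspace0P => v vV; rewrite -[v]gK.
  have : g v \in (g @: V)%VS by rewrite memv_img.
  by rewrite V0 memv0 => /eqP->; rewrite linear0.
case: (Mi (g @: U)%VS (g @: W)%VS).
- exact: img_submodule.
- exact: img_submodule.
- rewrite -limgD UW1; apply: limg_full => v; exists (f v); exact: fK.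
- apply: vspace0P => v; rewrite memv_cap => /andP[/memv_imgP[u uU ->]].
  case/memv_imgP=> w wW /(can_inj gK) uw; subst w.
  have : u \in (U :&: W)%VS by rewrite memv_cap uU.
  by rewrite UW0 memv0 => /eqP->; rewrite linear0.
- by move/g0; left.
- by move/g0; right.
Qed.

(** Every nonzero submodule contains z, so two of them never meet in zero. Used for projectives and
    for injective hulls. *)
Lemma essential_indecomposable M (z : M) : z != 0 ->
  (forall w, w != 0 -> exists a, w · a = z) -> indecomposable M.
Proof.
move=> z0 zess; split=> [M0|U W Us Ws _ UW0].
  by have := memvf z; rewrite M0 memv0 (negbTE z0).
have zin (V : {vspace M}) : submodule V -> V <> 0%VS -> z \in V.
  move=> Vs /eqP; rewrite -vpick0 => /zess[a <-].
  by rewrite submodule_app ?memv_pick.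
have [->|/eqP U0] := eqVneq U 0%VS; first by left.
have [->|/eqP W0] := eqVneq W 0%VS; first by right.
have : z \in (U :&: W)%VS by rewrite memv_cap !zin.
by rewrite UW0 memv0 (negbTE z0).
Qed.

Section SubModule.
Variables (M : rmodule A) (U : {vspace M}) (Us : submodule U).

Definition sub_act_fun a (u : subvs_of U) : subvs_of U :=
  vsproj U (vsval u · a).

Lemma sub_act_funE a u : vsval (sub_act_fun a u) = vsval u · a.
Proof. by rewrite vsprojK // submodule_app // subvsP. Qed.

Lemma sub_act_fun_linear a : linear (sub_act_fun a).
Proof.
by move=> c u v; apply: subvs_inj; rewrite linearP /= !sub_act_funE linearP appDl appZl.
Qed.

HB.instance Definition _ a :=
  GRing.isLinear.Build K _ _ _ (sub_act_fun a) (sub_act_fun_linear a).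

Definition sub_act a : 'End(subvs_of U) := linfun (sub_act_fun a).

Lemma sub_act_linear : linear sub_act.
Proof.
move=> c a b; apply/lfunP=> u; rewrite add_lfunE scale_lfunE !lfunE /=.
by apply: subvs_inj; rewrite linearP /= !sub_act_funE appDr appZr.
Qed.

HB.instance Definition _ :=
  GRing.isLinear.Build K A 'End(subvs_of U) _ sub_act sub_act_linear.

Lemma sub_act1 : sub_act 1 = \1%VF.
Proof.
by apply/lfunP=> u; apply: subvs_inj; rewrite !lfunE /= sub_act_funE app1.
Qed.

Lemma sub_actM a b : sub_act (a * b) = (sub_act b \o sub_act a)%VF.
Proof.
apply/lfunP=> u; apply: subvs_inj; rewrite comp_lfunE !lfunE /= !sub_act_funE.
by rewrite appM.
Qed.

Definition sub_rmodule : rmodule A :=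
  @RModule K A (subvs_of U) sub_act sub_act1 sub_actM.

Lemma sub_appE (u : sub_rmodule) a : vsval (u · a) = vsval u · a.
Proof. by rewrite /app /= lfunE /= sub_act_funE. Qed.

Lemma sub_corestrict N (h : 'Hom(N, M)) : is_hom h ->
  (forall v, h v \in U) ->
  exists2 h' : 'Hom(N, sub_rmodule), is_hom h' & forall v, vsval (h' v) = h v.
Proof.
move=> hh hU; pose h' : 'Hom(N, sub_rmodule) := (linfun (vsproj U) \o h)%VF.
have h'E v : vsval (h' v) = h v by rewrite comp_lfunE lfunE /= vsprojK.
exists h' => //; apply/is_homP=> v a; apply: subvs_inj.
by rewrite sub_appE !h'E hom_app.
Qed.

Lemma sub_inclusion :
  exists2 f : 'Hom(sub_rmodule, M), is_hom f & forall v, f v = vsval v.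
Proof.
exists (linfun (@vsval _ _ U)) => [|v]; last by rewrite lfunE.
by apply/is_homP=> v a; rewrite !lfunE /= sub_appE.
Qed.

End SubModule.

Lemma regular_appE (a b : regular_rmodule A) : a · (b : A) = (a : A) * b.
Proof. by rewrite /app /= lfunE. Qed.

Lemma gen_hom M (v : M) : is_hom (gen v : 'Hom(regular_rmodule A, M)).
Proof. by apply/is_homP=> a b; rewrite regular_appE !genE appM. Qed.

(** P is the projective module eA with generator u. *)
Definition free_on P e (u : P) : Prop :=
  [/\ u · e = u, forall w, exists a, w = u · a
    & forall a, u · a = 0 -> e * a = 0].

(** Sending u·a to v·a is well defined: u·a = u·a' gives e a = e a', and v = v·e. The partial
    inverse of [gen u] chooses a linearly. *)
Lemma free_hom P e (u : P) M (v : M) : free_on e u -> v · e = v ->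
  exists2 h : 'Hom(P, M), is_hom h & h u = v.
Proof.
move=> [ue us u0] ve; pose h : 'Hom(P, M) := (gen v \o (gen u)^-1)%VF.
have hE a : h (u · a) = v · a.
  rewrite comp_lfunE genE; set a' := (gen u)^-1%VF _.
  have E : u · a' = u · a.
    by rewrite -(genE u a') limg_lfunVK // cyc_app.
  have : e * (a' - a) = 0 by apply: u0; rewrite appBr E subrr.
  rewrite mulrBr => /eqP; rewrite subr_eq0 => /eqP E'.
  by rewrite -ve -appM E' appM.
exists h; last by rewrite -{1}[u]app1 hE app1.
by apply/is_homP=> w b; have [a ->] := us w; rewrite -appM !hE appM.
Qed.

Lemma free_hom_ext P e (u : P) M (f g : 'Hom(P, M)) : free_on e u ->
  is_hom f -> is_hom g -> f u = g u -> f = g.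
Proof.
move=> [ue us u0] fh gh fg; apply/lfunP=> w; have [a ->] := us w.
by rewrite !hom_app // fg.
Qed.

Lemma free_projective P e (u : P) : e * e = e -> free_on e u -> projective P.
Proof.
move=> ee uF M N g f gh gs fh; have [v0 gv0] := limgP gs (f u).
(* The preimage [v0] of f u need not be fixed by e; [v0 · e] is, and it still maps to f u. *)
have [|h hh hu] := @free_hom P e u M (v0 · e) uF; first by rewrite -appM ee.
exists h => //; apply: (free_hom_ext uF) => //; first exact: hom_comp.
by rewrite comp_lfunE hu hom_app // gv0 -hom_app //; case: uF => ->.
Qed.

Definition proj_module e : rmodule A :=
  sub_rmodule (cyc_submodule (e : regular_rmodule A)).

Lemma proj_module_free e : e * e = e ->
  exists u : proj_module e, vsval u = e /\ free_on e u.
Proof.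
move=> ee; exists (vsproj _ e); rewrite vsprojK ?cyc_id //; split=> //.
split.
- by apply: subvs_inj; rewrite sub_appE vsprojK ?cyc_id // regular_appE.
- move=> w; have /cycP[a wE] := subvsP w; exists a.
  by apply: subvs_inj; rewrite sub_appE vsprojK ?cyc_id.
- move=> a /(congr1 vsval); rewrite sub_appE vsprojK ?cyc_id //.
  by rewrite regular_appE.
Qed.

End ModuleBasics.

(** * Path bases *)

Local Notation "v · a" := (app v a) (at level 40, left associativity).

(** x i l is the path of length l starting at the vertex i mod N, which vanishes
    exactly when l >= c i; U is an algebra with unit e, possibly a corner of A. *)
Record path_basis (K : fieldType) (A : falgType K) (U : {vspace A}) (e : A)
    (N : nat) (c : nat -> nat) (x : nat -> nat -> A) : Prop := PathBasis {
  pb_gt0 : (0 < N)%N;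
  pb_len_gt0 : forall i, (0 < c i)%N;
  pb_period : forall i l, x (i + N)%N l = x i l;
  pb_mul : forall i l j m, x i l * x j m =
    if (i + l == j %[mod N])%N then x i (l + m)%N else 0;
  pb_eq0 : forall i l, (x i l == 0) = (c i <= l)%N;
  pb_one : \sum_(i < N) x i 0%N = e;
  pb_in : forall i l, x i l \in U;
  pb_span : forall a, a \in U -> exists k : nat -> nat -> K,
    a = \sum_(i < N) \sum_(l < c i) k i l *: x i l }.

Lemma eqmod_addl (i j m N : nat) : i = j %[mod N] -> i + m = j + m %[mod N].
Proof. by move=> E; rewrite -modnDml E modnDml. Qed.

Section PathBasisTheory.
Variables (K : fieldType) (A : falgType K) (U : {vspace A}) (e : A).
Variables (N : nat) (c : nat -> nat) (x : nat -> nat -> A).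
Hypothesis B : path_basis U e N c x.

Lemma path_mod i j l : i = j %[mod N] -> x i l = x j l.
Proof.
have D q k : x (k + q * N)%N l = x k l.
  elim: q k => [|q IH] k; first by rewrite mul0n addn0.
  by rewrite mulSn addnA IH (pb_period B).
by move=> E; rewrite (divn_eq i N) (divn_eq j N) E ![(_ * N + _)%N]addnC !D.
Qed.

Lemma path_len_mod i j : i = j %[mod N] -> c i = c j.
Proof.
move=> E; apply/eqP; rewrite eqn_leq.
by rewrite -!(pb_eq0 B) -(path_mod (c i) E) (path_mod (c j) E) !(pb_eq0 B) !leqnn.
Qed.

Lemma path_ge i l : (c i <= l)%N -> x i l = 0.
Proof. by rewrite -(pb_eq0 B) => /eqP. Qed.

Lemma path_neq0 i l : (l < c i)%N -> x i l != 0.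
Proof. by rewrite (pb_eq0 B) -ltnNge. Qed.

Lemma pathM i l m : x i l * x (i + l) m = x i (l + m).
Proof. by rewrite (pb_mul B) eqxx. Qed.

Lemma pathMeq i l j m : i + l = j %[mod N] -> x i l * x j m = x i (l + m).
Proof. by move=> E; rewrite (pb_mul B) E eqxx. Qed.

Lemma path_idem i : x i 0%N * x i 0%N = x i 0%N.
Proof. by rewrite pathMeq ?addn0. Qed.

Lemma path_idl i l : x i 0%N * x i l = x i l.
Proof. by rewrite pathMeq ?addn0 ?add0n. Qed.

Lemma path_idr i l : x i l * x (i + l) 0%N = x i l.
Proof. by rewrite pathM addn0. Qed.

(** An arrow put in front of the vanishing path of length [c i.+1] from i+1 gives zero. This is the
    monotonicity of i + c i. *)
Lemma path_len_step i : (c i <= (c i.+1).+1)%N.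
Proof. by rewrite -(pb_eq0 B) -(add1n (c _)) -pathM addn1 (path_ge (leqnn _)) mulr0. Qed.

(** Multiplication by the path of length [c i - l.+1] from i + l sends [x i l] to the last nonzero
    path and kills the longer ones; the shorter ones have coefficient zero by induction. *)
Lemma path_row_free i (k : nat -> K) : \sum_(l < c i) k l *: x i l = 0 ->
  forall l, (l < c i)%N -> k l = 0.
Proof.
move=> S0 l; elim/ltn_ind: l => l IH lc.
have /eqP : (\sum_(m < c i) k m *: x i m) * x (i + l) (c i - l.+1)%N = 0.
  by rewrite S0 mul0r.
rewrite mulr_suml (bigD1 (Ordinal lc)) //= big1 ?addr0 => [|m].
  rewrite -scalerAl pathM scaler_eq0 => /orP[/eqP//|].
  rewrite (pb_eq0 B); lia.
rewrite -val_eqE /= => ml; have [lt|ge] := ltnP m l.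
  by rewrite IH ?scale0r ?mul0r.
rewrite -scalerAl (pb_mul B); case: ifP => _; last by rewrite scaler0.
by rewrite path_ge ?scaler0 //; lia.
Qed.

Lemma path_mul_sum j (k : nat -> nat -> K) : (j < N)%N ->
  x j 0%N * (\sum_(i < N) \sum_(l < c i) k i l *: x i l) =
  \sum_(l < c j) k j l *: x j l.
Proof.
move=> jN; rewrite mulr_sumr (bigD1 (Ordinal jN)) //= [X in _ + X]big1 ?addr0 => [|i].
  by rewrite mulr_sumr; apply: eq_bigr => l _; rewrite -scalerAr path_idl.
rewrite -val_eqE /= => ij; rewrite mulr_sumr big1 // => l _.
rewrite -scalerAr (pb_mul B) addn0 !modn_small // eq_sym.
by rewrite (negbTE ij) scaler0.
Qed.

Lemma path_free (k : nat -> nat -> K) :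
  \sum_(i < N) \sum_(l < c i) k i l *: x i l = 0 ->
  forall i l, (i < N)%N -> (l < c i)%N -> k i l = 0.
Proof.
move=> S0 i l iN; apply: path_row_free.
by rewrite -path_mul_sum // S0 mulr0.
Qed.

End PathBasisTheory.

(** * Coordinates along paths and the characters of the vertices *)

Section Coordinates.
Variables (K : fieldType) (A : falgType K).
Variables (N : nat) (c : nat -> nat) (x : nat -> nat -> A).
Hypothesis B : path_basis fullv 1 N c x.

(** The coefficient in a of the path of length l from i. A path basis only asserts that an expansion
    exists, hence the [epsilon]; prescribing zero from [c i] on makes the choice unique, so linear
    in a and periodic in i for every l. *)
Definition pcoef i (a : A) : nat -> K :=
  epsilon (inhabits (fun=> 0)) (fun k : nat -> K => [/\ x i 0%N * a = \sum_(l < c i) k l *: x i l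
    & forall l, (c i <= l)%N -> k l = 0]).

Lemma pcoefP i a : [/\ x i 0%N * a = \sum_(l < c i) pcoef i a l *: x i l
    & forall l, (c i <= l)%N -> pcoef i a l = 0].
Proof.
apply: (epsilon_spec (inhabits (fun=> 0)) (fun k : nat -> K =>
  [/\ x i 0%N * a = \sum_(l < c i) k l *: x i l
    & forall l, (c i <= l)%N -> k l = 0])).
have N0 := pb_gt0 B.
have [k ->] := pb_span B (memvf a).
exists (fun l => if (l < c i)%N then k (i %% N)%N l else 0); split=> [|l].
  have E : (i %% N)%N = i %[mod N] by rewrite modn_mod.
  rewrite -(path_mod B 0 E) (path_mul_sum B) ?ltn_mod // (path_len_mod B E).
  by apply: eq_bigr => l _; rewrite ltn_ord (path_mod B _ E).
by case: ltnP.
Qed.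

Lemma pcoefE i a : x i 0%N * a = \sum_(l < c i) pcoef i a l *: x i l.
Proof. by case: (pcoefP i a). Qed.

Lemma pcoef_ge i a l : (c i <= l)%N -> pcoef i a l = 0.
Proof. by case: (pcoefP i a) => _; apply. Qed.

Lemma pcoef_uniq i a (k : nat -> K) l : (l < c i)%N ->
  x i 0%N * a = \sum_(l < c i) k l *: x i l -> pcoef i a l = k l.
Proof.
move=> lc E; apply/eqP; rewrite -subr_eq0; apply/eqP.
apply: (path_row_free B (k := fun l => pcoef i a l - k l)) lc.
under eq_bigr do rewrite scalerBl.
by rewrite sumrB -E -pcoefE subrr.
Qed.

Definition pcoef_fun i l a : K^o := pcoef i a l.

Lemma pcoef_linear i l : linear (pcoef_fun i l).
Proof.
move=> s a b; rewrite /pcoef_fun; have [lc|lc] := ltnP l (c i); last first.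
  by rewrite !pcoef_ge // scaler0 addr0.
apply: (pcoef_uniq (k := fun l => s *: (pcoef i a l : K^o) + pcoef i b l)) => //.
rewrite mulrDr -scalerAr !pcoefE scaler_sumr -big_split /=.
by apply: eq_bigr => m _; rewrite scalerDl scalerA.
Qed.

HB.instance Definition _ i l :=
  GRing.isLinear.Build K A K^o _ (pcoef_fun i l) (pcoef_linear i l).

Lemma pcoefD i a b l : pcoef i (a + b) l = pcoef i a l + pcoef i b l.
Proof. exact: (linearD (pcoef_fun i l)). Qed.

Lemma pcoefB i a b l : pcoef i (a - b) l = pcoef i a l - pcoef i b l.
Proof. exact: (linearB (pcoef_fun i l)). Qed.

Lemma pcoefZ i s a l : pcoef i (s *: a) l = s * pcoef i a l.
Proof. exact: (linearZ_LR (pcoef_fun i l)). Qed.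

Lemma pcoef0 i l : pcoef i 0 l = 0.
Proof. exact: (linear0 (pcoef_fun i l)). Qed.

Lemma pcoef_sum i l I (r : seq I) (P : pred I) (F : I -> A) :
  pcoef i (\sum_(j <- r | P j) F j) l = \sum_(j <- r | P j) pcoef i (F j) l.
Proof. exact: (linear_sum (pcoef_fun i l)). Qed.

Lemma pcoef_mod i j a l : i = j %[mod N] -> pcoef i a l = pcoef j a l.
Proof.
move=> E; have C := path_len_mod B E.
have [lc|lc] := ltnP l (c i); last by rewrite !pcoef_ge // -C.
apply: pcoef_uniq => //; rewrite (path_mod B 0 E) pcoefE -C.
by apply: eq_bigr => m _; rewrite (path_mod B m E).
Qed.

Lemma pcoef_idl i a l : pcoef i (x i 0%N * a) l = pcoef i a l.
Proof.
have [lc|lc] := ltnP l (c i); last by rewrite !pcoef_ge.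
by apply: pcoef_uniq => //; rewrite mulrA (path_idem B) pcoefE.
Qed.

Lemma pcoef_path i j l m : (l < c i)%N ->
  pcoef i (x j m) l = ((i == j %[mod N]) && (l == m))%:R.
Proof.
move=> lc; apply: (pcoef_uniq (k := fun l => ((i == j %[mod N])%N && (l == m))%:R)) => //.
rewrite (pb_mul B) addn0 add0n; case: eqP => /= E; last first.
  by rewrite big1 // => t _; rewrite scale0r.
have [mc|mc] := ltnP m (c i).
  rewrite (bigD1 (Ordinal mc)) //= eqxx scale1r big1 ?addr0 // => t.
  by rewrite -val_eqE /= => /negbTE->; rewrite scale0r.
rewrite (path_ge B) // big1 // => t _.
have /negbTE-> : t != m :> nat by have := ltn_ord t; lia.
by rewrite scale0r.
Qed.

Lemma pcoef_idr i j a l : pcoef i (a * x j 0%N) l =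
  if (i + l == j %[mod N])%N then pcoef i a l else 0.
Proof.
have [lc|lc] := ltnP l (c i); last by rewrite !pcoef_ge // if_same.
apply: (pcoef_uniq (k := fun l => if (i + l == j %[mod N])%N then pcoef i a l else 0)) => //.
rewrite mulrA pcoefE mulr_suml; apply: eq_bigr => m _.
rewrite -scalerAl (pb_mul B) addn0.
by case: ifP; rewrite ?scaler0 ?scale0r.
Qed.

Lemma path_mull i l a :
  x i l * a = \sum_(m < c (i + l)) pcoef (i + l) a m *: x i (l + m)%N.
Proof.
rewrite -{1}(path_idr B i l) -mulrA pcoefE mulr_sumr.
by apply: eq_bigr => m _; rewrite -scalerAr (pathM B).
Qed.

Lemma path_sum a : a = \sum_(i < N) x i 0%N * a.
Proof. by rewrite -mulr_suml (pb_one B) mul1r. Qed.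

Lemma path_expand a : a = \sum_(i < N) \sum_(l < c i) pcoef i a l *: x i l.
Proof. by rewrite {1}[a]path_sum; apply: eq_bigr => i _; rewrite pcoefE. Qed.

Lemma linear_path_ext (V : vectType K) (f g : 'Hom(A, V)) :
  (forall i l, f (x i l) = g (x i l)) -> f = g.
Proof.
move=> E; apply/lfunP => a; rewrite [a]path_expand !linear_sum.
by apply: eq_bigr => i _; rewrite !linear_sum; apply: eq_bigr => l _; rewrite !linearZ /= E.
Qed.

(** The character of A attached to the vertex i. *)
Definition chi i a : K := pcoef i a 0.

(** The submodules generated by ever longer paths filter e_i A, and A acts on the l-th layer through
    the character of the end vertex i + l. *)
Lemma path_mull_lead i l a :
  exists b, x i l * a = chi (i + l) a *: x i l + x i l.+1 * b.
Proof.
rewrite path_mull; have := pb_len_gt0 B (i + l).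
case: (c (i + l)) (fun m => @pcoef_ge (i + l)%N a m) => // C _ _.
rewrite big_ord_recl /= addn0.
exists (\sum_(m < C) pcoef (i + l) a m.+1 *: x (i + l).+1 m).
congr (_ + _); rewrite mulr_sumr; apply: eq_bigr => m _.
by rewrite -scalerAr (pathMeq B) ?addnS // add0n.
Qed.

Lemma chi_path i j m : chi i (x j m) = ((i == j %[mod N]) && (m == 0%N))%:R.
Proof. by rewrite /chi pcoef_path ?(pb_len_gt0 B) // [0%N == m]eq_sym. Qed.

Lemma chi_path1 i : chi i (x i 0%N) = 1.
Proof. by rewrite chi_path eqxx. Qed.

Lemma chi_pathS_mul i l b : chi i (x i l.+1 * b) = 0.
Proof.
rewrite /chi path_mull pcoef_sum big1 // => m _.
by rewrite pcoefZ pcoef_path ?(pb_len_gt0 B) // andbF mulr0.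
Qed.

Lemma chi_left i a :  exists b, x i 0%N * a = chi i a *: x i 0%N + x i 1 * b.
Proof. by have [b] := path_mull_lead i 0 a; rewrite addn0 => E; exists b. Qed.

Lemma chi_idl i a : chi i (x i 0%N * a) = chi i a.
Proof. exact: pcoef_idl. Qed.

Lemma chiZ i k a : chi i (k *: a) = k * chi i a.
Proof. exact: pcoefZ. Qed.

Lemma chiD i a b : chi i (a + b) = chi i a + chi i b.
Proof. exact: pcoefD. Qed.

Lemma chiB i a b : chi i (a - b) = chi i a - chi i b.
Proof. exact: pcoefB. Qed.

Lemma chi_mod i j a : i = j %[mod N] -> chi i a = chi j a.
Proof. exact: pcoef_mod. Qed.

Lemma chiM i a b : chi i (a * b) = chi i a * chi i b.
Proof.
rewrite -chi_idl mulrA; have [a' ->] := chi_left i a.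
by rewrite mulrDl chiD -scalerAl chiZ chi_idl -mulrA chi_pathS_mul addr0.
Qed.

Lemma chi1 i : chi i 1 = 1.
Proof. by rewrite -chi_idl mulr1 chi_path1. Qed.

Lemma chi_linear i : linear (chi i : A -> K^o).
Proof. exact: pcoef_linear. Qed.

HB.instance Definition _ i :=
  GRing.isLinear.Build K A K^o _ (chi i : A -> K^o) (chi_linear i).

Lemma chi_eq0_left i a : chi i a = 0 -> exists b, x i 0%N * a = x i 1 * b.
Proof.
by move=> a0; have [b E] := chi_left i a; exists b; rewrite E a0 scale0r add0r.
Qed.

(** Every nontrivial path ending at i+1 has the arrow from i as its last arrow. Mirror image of
    [chi_eq0_left]. *)
Lemma chi_eq0_right i a : chi i.+1 a = 0 ->
  exists b, a * x i.+1 0%N = b * x i 1.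
Proof.
move=> a0; suff /memv_imgP[b _] : a * x i.+1 0%N \in limg (amulr (x i 1)).
  by rewrite lfunE /= => E; exists b.
rewrite [a]path_expand mulr_suml; apply: memv_suml => j _.
rewrite mulr_suml; apply: memv_suml => l _.
rewrite -scalerAl; case: l => -[|l] /= lc; rewrite (pb_mul B).
  rewrite addn0; case: eqP => [E|_]; last by rewrite scaler0 mem0v.
  by have := chi_mod a E; rewrite a0 /chi => ->; rewrite scale0r mem0v.
case: eqP => [E|_]; last by rewrite scaler0 mem0v.
rewrite memvZ // addn0; apply/memv_imgP; exists (x j l); first exact: memvf.
rewrite lfunE /= (pathMeq B) ?addn1 //.
by apply/eqP; rewrite -(eqn_modDr 1) -addnA !addn1; apply/eqP.
Qed.

(** Prolong the shortest path occurring in e_i a to length [(c i).-1]; the other paths that occur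
    become too long. So the last nonzero path from i spans an essential socle of e_i A. *)
Lemma path_socle i a : x i 0%N * a != 0 ->
  exists b k, k != 0 /\ x i 0%N * a * b = k *: x i (c i).-1.
Proof.
move=> a0; have E : exists l, pcoef i a l != 0.
  apply: NNPP => n; case/eqP: a0; rewrite pcoefE big1 // => l _.
  have [->|z] := eqVneq (pcoef i a l) 0; first by rewrite scale0r.
  by case: n; exists l.
case: (ex_minnP E) => l l0 lmin; have lc : (l < c i)%N.
  by rewrite ltnNge; apply: contra l0 => /pcoef_ge->.
exists (x (i + l) (c i - l.+1)%N), (pcoef i a l); split=> //.
rewrite pcoefE mulr_suml (bigD1 (Ordinal lc)) //= big1 ?addr0 => [|m].
  by rewrite -scalerAl (pathM B); congr (_ *: x _ _); lia.
rewrite -val_eqE /= => ml; have [lt|ge] := ltnP m l.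
  have := contraNN (lmin m); rewrite -ltnNge => /(_ lt).
  by rewrite negbK => /eqP->; rewrite scale0r mul0r.
rewrite -scalerAl (pb_mul B); case: ifP => _; last by rewrite scaler0.
by rewrite (path_ge B) ?scaler0 //; lia.
Qed.

Lemma path_last_mul i a :
  x i (c i).-1 * a = chi (i + (c i).-1) a *: x i (c i).-1.
Proof.
have [b ->] := path_mull_lead i (c i).-1 a.
by rewrite (@path_ge _ _ _ _ _ _ _ B i _.+1) ?mul0r ?addr0 //; lia.
Qed.

Lemma path_mul_last i z :
  x i 0%N * z * x i (c i).-1 = chi i z *: x i (c i).-1.
Proof.
have C := pb_len_gt0 B i.
rewrite pcoefE mulr_suml (bigD1 (Ordinal C)) //= big1 ?addr0 => [|l].
  by rewrite -scalerAl (path_idl B).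
rewrite -val_eqE /= => l0; rewrite -scalerAl (pb_mul B).
by case: ifP => _; rewrite ?(path_ge B) ?scaler0 //; lia.
Qed.

(** By [path_socle] a nonzero e_i a can be carried to the last nonzero path, where left
    multiplication by e_i y is the nonzero scalar [chi i y]. *)
Lemma path_local_inj i y a :
  chi i y != 0 -> x i 0%N * y * x i 0%N * a = 0 -> x i 0%N * a = 0.
Proof.
move=> y0 ya; apply/eqP/negPn/negP => /path_socle[b [k [k0 E]]].
have /eqP: x i 0%N * y * (x i 0%N * a * b) = 0 by rewrite !mulrA ya mul0r.
rewrite E -scalerAr path_mul_last !scaler_eq0 (negbTE k0) (negbTE y0) /=.
by apply/negP/(path_neq0 B); have := pb_len_gt0 B i; lia.
Qed.

(** Locality of e_i A e_i in usable form: an injective endomorphism of a finite-dimensional space is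
    bijective. *)
Lemma path_local_unit i y :
  chi i y != 0 -> exists d, x i 0%N * y * d = x i 0%N.
Proof.
move=> y0; set e := x i 0%N; have ee : e * e = e := path_idem B i.
(* The summand 1 - e makes the multiplication injective on all of A and not merely on eA. *)
pose f := amull (e * y * e + (1 - e)).
have /eqP f0 : lker f = 0%VS.
  apply: vspace0P => a; rewrite memv_ker lfunE /= => /eqP fa.
  have /path_local_inj : e * y * e * a = 0.
    have : e * ((e * y * e + (1 - e)) * a) = 0 by rewrite fa mulr0.
    by rewrite mulrDl mulrDr !mulrA mulrBr mulr1 !ee subrr mul0r addr0.
  move=> /(_ y0) ea; move: fa.
  by rewrite mulrDl mulrBl mul1r -(mulrA _ e a) [e * a]ea mulr0 add0r subr0.
exists (e * f^-1%VF 1); have := lker0_lfunVK f0 1; rewrite lfunE /= => E.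
have {}E := congr1 (fun z => e * z) E; rewrite mulr1 in E.
rewrite -{3}E !mulrA; congr (_ * _).
by rewrite mulrDr !mulrA mulrBr mulr1 ee subrr addr0.
Qed.

End Coordinates.

(** * Simple modules and projective covers *)

Lemma form_exists (K : fieldType) (V : vectType K) (v : V) :
  v != 0 -> exists f : 'Hom(V, K^o), f v = 1.
Proof.
move=> v0; have lin : linear (fun k : K^o => k *: v).
  by move=> s k l; rewrite scalerDl scalerA.
have [g gE] := linfun_exists lin.
have /lker0_lfunK gK : lker g == 0%VS.
  apply/lker0P => k l; rewrite !gE => /eqP.
  by rewrite -subr_eq0 -scalerBl scaler_eq0 (negbTE v0) orbF subr_eq0 => /eqP.
by exists g^-1%VF; rewrite -[v]scale1r -gE gK.
Qed.

Lemma form_extend (K : fieldType) (V W : vectType K) (g : 'Hom(V, W))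
    (f : 'Hom(V, K^o)) : lker g = 0%VS ->
  exists h : 'Hom(W, K^o), forall v, h (g v) = f v.
Proof.
move=> /eqP/lker0_lfunK gK; exists (f \o g^-1)%VF => v.
by rewrite comp_lfunE gK.
Qed.

Section ModulesOverPathBasis.
Variables (K : fieldType) (A : falgType K).
Variables (N : nat) (c : nat -> nat) (x : nat -> nat -> A).
Hypothesis B : path_basis fullv 1 N c x.
Implicit Types (M P : rmodule A).

Local Notation chi := (chi c x).

Let N0 : (0 < N)%N := pb_gt0 B.

(** Nonzero paths are no longer than the sum of the c i over one period. Choosing a longest path
    replaces the nilpotency of the radical in the arguments below. *)
Lemma longest_path (Q : nat -> nat -> bool) :
  (exists i l, Q i l) ->
  (forall i j l, i = j %[mod N] -> Q i l = Q j l) ->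
  (forall i l, Q i l -> (l < c i)%N) ->
  exists i l, Q i l /\ forall j m, (l < m)%N -> ~~ Q j m.
Proof.
move=> [i0 [l0 Q0]] Qmod Qlen.
pose T l := [exists i : 'I_N, Q i l].
have QT i l : Q i l -> T l.
  move=> Ql; apply/existsP; exists (Ordinal (ltn_pmod i N0)).
  by rewrite (Qmod _ i) //= modn_mod.
have T0 : exists l, T l by exists l0; apply: QT Q0.
have Tle l : T l -> (l <= \sum_(i < N) c i)%N.
  by case/existsP=> i /Qlen li; rewrite (bigD1 i) //=; lia.
case: (ex_maxnP T0 Tle) => l /existsP[i Qi] lmax.
exists i, l; split=> // j m lm; apply/negP => /QT/lmax; lia.
Qed.

(** Take a longest path p with w·p outside U. Every prolongation of p sends w into U, so modulo U
    the vector w·p spans the simple module at the end vertex of p. *)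
Lemma sub_top M (U : {vspace M}) (w : M) : submodule U -> w \notin U ->
  exists i v, [/\ v \in cyc w, v \notin U, v · x i 0%N = v
    & forall a, v · a - chi i a *: v \in U].
Proof.
move=> Us wU; pose Q i l := w · x i l \notin U.
have [|||j [l [Ql lmax]]] := @longest_path Q.
- apply: NNPP => n; case/negP: wU; rewrite -[w]app1 -(pb_one B) app_sumr.
  apply: memv_suml => i _; apply/negPn/negP => Qi; apply: n.
  by exists i, 0%N.
- by move=> i j l E; rewrite /Q (path_mod B _ E).
- move=> i l; rewrite ltnNge /Q; apply: contra => /(path_ge B)->.
  by rewrite app0r mem0v.
exists (j + l)%N, (w · x j l); split=> //; first exact: cyc_app.
  by rewrite -appM (path_idr B).
move=> a; rewrite -appM; have [b ->] := path_mull_lead B j l a.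
rewrite appDr appZr addrC addKr appM submodule_app //.
by have := lmax j l.+1 (ltnSn _); rewrite negbK.
Qed.

(** Dual to [sub_top]: f is a nonzero map from P to a simple module, obtained from a form f0 by
    composing it with a longest path p for which f0(v·p) does not vanish identically in v. *)
Lemma form_top P : {:P}%VS <> 0%VS ->
  exists i (f : 'Hom(P, K^o)), f != 0 /\
    forall v a, f (v · a) = chi i a * f v.
Proof.
move=> /eqP; rewrite -vpick0; set v0 := vpick _ => /form_exists[f0 f0v].
pose Q i l := (f0 \o ract P (x i l))%VF != 0.
have QE i l : ~~ Q i l -> forall v, f0 (v · x i l) = 0.
  by rewrite negbK => /eqP/lfunP E v; have := E v; rewrite comp_lfunE zero_lfunE.
have [|||j [l [Ql lmax]]] := @longest_path Q.
- apply: NNPP => n; have : f0 (v0 · 1) = 0.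
    rewrite -(pb_one B) app_sumr linear_sum big1 // => i _; apply: QE.
    by apply/negP => Qi; apply: n; exists i, 0%N.
  by rewrite app1 f0v => /eqP; rewrite oner_eq0.
- by move=> i j l E; rewrite /Q (path_mod B _ E).
- move=> i l; rewrite ltnNge /Q; apply: contra => /(path_ge B)->.
  by rewrite linear0 comp_lfun0r.
exists j, (f0 \o ract P (x j l))%VF; split=> // v a.
rewrite !comp_lfunE -![ract _ _ _]/(_ · _).
(* The vertex before j, written so that it also makes sense for j = 0. *)
have Ej : j = (j + N).-1.+1 %[mod N] by rewrite prednK ?modnDr //; lia.
have [b Eb] : exists b, (a - chi j a *: x j 0%N) * x j 0%N = b * x (j + N).-1 1.
  rewrite {2}(path_mod B 0 Ej); apply: (chi_eq0_right B).
  by rewrite -(chi_mod B _ Ej) (chiB B) (chiZ B) (chi_path1 B) mulr1 subrr.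
(* The last summand involves the path prolonged at its start, of length l+1, on which f0 vanishes by
   maximality. *)
have -> : v · a · x j l = chi j a *: (v · x j l) + v · b · x (j + N).-1 l.+1.
  rewrite -!appM -appZr -appDr -(path_idl B j l) mulrA.
  move: Eb; rewrite mulrBl => /eqP; rewrite subr_eq => /eqP->.
  rewrite -scalerAl (path_idem B) addrC mulrDl -scalerAl -mulrA.
  rewrite (pathMeq B) ?add1n // -?(path_idl B j l) //.
  by rewrite addn1 Ej.
by rewrite linearD linearZ /= (QE _ _ (lmax _ _ (ltnSn l))) addr0.
Qed.

(** M is the simple module S_i: the residue field at every vertex is K, so simples are
    one-dimensional and known by their character. *)
Definition simple_at M i : Prop :=
  \dim {:M} = 1%N /\ forall v a, v · a = chi i a *: (v : M).

Lemma simple_at_mod M i j : i = j %[mod N] -> simple_at M i -> simple_at M j.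
Proof. by move=> E [d h]; split=> // v a; rewrite h (chi_mod B _ E). Qed.

Lemma dim1_span (V : vectType K) (v : V) : v != 0 -> \dim {:V} = 1%N ->
  forall w, exists k, w = k *: v.
Proof.
move=> v0 d w; apply/vlineP; suff /eqP-> : <[v]>%VS == fullv by exact: memvf.
by rewrite eqEdim subvf dim_vline v0 d.
Qed.

Lemma dim1_pick (V : vectType K) : \dim {:V} = 1%N -> exists v : V, v != 0.
Proof.
move=> d; exists (vpick {:V}); rewrite vpick0; apply/eqP => E.
by have := congr1 (fun U => \dim U) E; rewrite d dimv0.
Qed.

Lemma simple_at_inj M i j : simple_at M i -> simple_at M j -> i = j %[mod N].
Proof.
move=> [d h] [_ h']; have [v v0] := dim1_pick d.
have := h v (x i 0%N); rewrite h' (chi_path1 B) scale1r (chi_path B) andbT.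
case: eqP => [->|_] // /eqP; rewrite scale0r eq_sym.
by rewrite (negbTE v0).
Qed.

Lemma simple_at_iso M P i : isomorphic M P -> simple_at M i -> simple_at P i.
Proof.
move=> MP [d h]; split; first by rewrite -(iso_dim MP).
have /isomorphicP[f [g [fh gh fK gK]]] := MP.
by move=> v a; rewrite -[v]gK -hom_app // h linearZ.
Qed.

Lemma simple_at_isomorphic M P i :
  simple_at M i -> simple_at P i -> isomorphic M P.
Proof.
move=> [d h] [d' h']; have [v v0] := dim1_pick d; have [w w0] := dim1_pick d'.
have [f fv] := form_exists v0; have [g gw] := form_exists w0.
have fE u : u = f u *: v.
  by have [k ->] := dim1_span v0 d u; rewrite linearZ /= fv [_ *: 1]mulr1.
have gE u : u = g u *: w.
  by have [k ->] := dim1_span w0 d' u; rewrite linearZ /= gw [_ *: 1]mulr1.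
have lin1 : linear (fun u => f u *: w).
  by move=> s u u'; rewrite linearP scalerDl scalerA.
have lin2 : linear (fun u => g u *: v).
  by move=> s u u'; rewrite linearP scalerDl scalerA.
have [p pE] := linfun_exists lin1; have [q qE] := linfun_exists lin2.
apply/isomorphicP; exists p, q; split.
- by apply/is_homP => u a; rewrite h h' linearZ.
- by apply/is_homP => u a; rewrite h h' linearZ.
- by move=> u; rewrite pE linearZ /= qE gw scale1r -fE.
- by move=> u; rewrite qE linearZ /= pE fv scale1r -gE.
Qed.

Lemma simpleP M : simple M <-> exists i, simple_at M i.
Proof.
split=> [[_ M0 Mmin]|[i [d h]]]; last first.
  split.
  - by apply/submoduleP => v a _; exact: memvf.
  - by move/(congr1 (fun V => \dim V)); rewrite d dimv0.
  move=> W _ _; have [->|W0] := eqVneq W 0%VS; [by left|right].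
  by apply/eqP; rewrite eqEdim subvf d lt0n dimv_eq0.
have S0 : submodule (0%VS : {vspace M}).
  by apply/submoduleP => v a; rewrite !memv0 => /eqP->; rewrite app0l.
move/eqP: M0; rewrite -vpick0 -memv0 => /(sub_top S0)[i [v [_ v0 vi vchi]]].
have {}vchi a : v · a = chi i a *: v.
  by apply/eqP; rewrite -subr_eq0 -memv0.
exists i; have vE : <[v]>%VS = fullv.
  case: (Mmin <[v]>%VS); rewrite ?subvf //.
    apply/submoduleP => _ a /vlineP[k ->]; rewrite appZl vchi.
    by rewrite !memvZ ?memv_line.
  by move=> /eqP; rewrite -subv0 -memvE (negbTE v0).
split; first by rewrite -vE dim_vline -memv0 v0.
move=> w a; have /vlineP[k ->] : w \in <[v]>%VS by rewrite vE memvf.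
by rewrite appZl vchi !scalerA mulrC.
Qed.

(** The vector v of [sub_top] makes U + Kv a submodule strictly above U, so it equals W. Composition
    length is therefore dimension. *)
Lemma composition_step M (U W : {vspace M}) :
  submodule U -> submodule W -> (U <= W)%VS -> U <> W ->
  (forall X, submodule X -> (U <= X <= W)%VS -> X = U \/ X = W) ->
  \dim W = (\dim U).+1.
Proof.
move=> Us Ws UW nUW max; have : ~~ (W <= U)%VS.
  by apply: contra_notN nUW => WU; apply/eqP; rewrite eqEsubv UW.
case/subvPn=> w wW /(sub_top Us)[i [v [vw vU _ vchi]]].
have vW : v \in W by apply: (subvP (cyc_sub Ws wW)).
have Xs : submodule (U + <[v]>)%VS.
  apply/submoduleP => _ a /memv_addP[u uU [_ /vlineP[k ->] ->]].
  rewrite appDl appZl -[v · a](subrK (chi i a *: v)) scalerDr addrA.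
  by rewrite memv_add ?memvD ?memvZ ?submodule_app ?memv_line.
have [|XU|<-] := max _ Xs; first by rewrite addvSl subv_add UW -memvE.
  by case/negP: vU; rewrite -XU memvE addvSr.
rewrite dimv_disjoint_sum ?dim_vline.
  suff -> : v != 0 by rewrite addn1.
  by apply: contraNneq vU => ->; exact: mem0v.
apply: vspace0P => u; rewrite memv_cap => /andP[uU /vlineP[k E]].
have [k0|k0] := eqVneq k 0; first by rewrite E k0 scale0r.
by case/negP: vU; rewrite -[v](scalerK k0) -E memvZ.
Qed.

Lemma composition_length_dim M l : composition_length M l -> l = \dim {:M}.
Proof.
case=> U [U0 <- Us Umax]; suff : forall i, (i <= l)%N -> \dim (U i) = i by move->.
elim=> [|i IH] il; first by rewrite U0 dimv0.
have [UU Une Um] := Umax i il.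
by rewrite (composition_step _ _ UU Une Um) ?IH //; [lia|apply: Us; lia|exact: Us].
Qed.

(** Otherwise b would be invertible at i and v could be recovered from v·b. *)
Lemma app_local M i (v : M) b : v · x i 0%N = v -> v != 0 -> v · b = 0 ->
  chi i b = 0.
Proof.
move=> vi v0 vb; apply/eqP/negPn/negP => /(path_local_unit B)[d E].
by case/eqP: v0; rewrite -vi -E !appM vi vb app0l.
Qed.

Lemma projective_cover_free P M (f : 'Hom(P, M)) i (v : M) :
  projective P -> is_hom f -> superfluous (lker f) -> limg f = cyc v ->
  v · x i 0%N = v -> v != 0 ->
  exists2 u, free_on (x i 0%N) u & f u = v.
Proof.
move=> Pp fh fs fE vi v0.
have /memv_imgP[u0 _ u0v] : v \in limg f by rewrite fE cyc_id.
pose u := u0 · x i 0%N; have fu : f u = v by rewrite /u hom_app // -u0v vi.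
have ui : u · x i 0%N = u by rewrite /u -appM (path_idem B).
have us : cyc u = fullv.
  apply: fs; first exact: cyc_submodule.
  apply/vspaceP => w; rewrite memvf.
  have /cycP[a wE] : f w \in cyc v by rewrite -fE memv_img ?memvf.
  rewrite -(subrK (u · a) w) memv_add ?cyc_app //.
  by rewrite memv_ker linearB /= hom_app // fu wE subrr.
exists u => //.
have [s sh sE] := Pp _ _ _ _ (gen_hom u) us (hom_id P).
have {}sE w : u · s w = w.
  by have /lfunP/(_ w) := sE; rewrite comp_lfunE genE id_lfunE.
split=> //; first by move=> w; exists (s w).
move=> a ua; pose y : A := s u.
have yi : y * x i 0%N = y by rewrite -regular_appE -hom_app // ui.
have ya : y * a = 0 by rewrite -regular_appE -hom_app // ua linear0.
have u0' : u != 0 by apply: contraNneq v0 => E; rewrite -fu E linear0.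
(* As u·y = u, the element y has character 1 at i and acts injectively on e_i A; so u·a = 0 gives y
   a = 0, hence e_i a = 0. *)
have : chi i (1 - y) = 0 by apply: (app_local ui u0'); rewrite appBr app1 sE subrr.
rewrite (chiB B) (chi1 B) => /eqP; rewrite subr_eq0 => /eqP y1.
apply: (path_local_inj B (y := y)); first by rewrite -y1 oner_eq0.
by rewrite -(mulrA _ y) yi -mulrA ya mulr0.
Qed.

End ModulesOverPathBasis.

(** * Projective modules *)

Section SimpleModule.
Variables (K : fieldType) (A : falgType K).
Variables (N : nat) (c : nat -> nat) (x : nat -> nat -> A).
Hypothesis B : path_basis fullv 1 N c x.
Variable i : nat.

Lemma char_act_linear :
  linear (fun a => chi c x i a *: \1%VF : 'End(K^o)).
Proof. by move=> s a b; rewrite (chiD B) (chiZ B) scalerDl scalerA. Qed.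

Definition char_act (a : A) : 'End(K^o) := chi c x i a *: \1%VF.

HB.instance Definition _ :=
  GRing.isLinear.Build K A 'End(K^o) _ char_act char_act_linear.

Lemma char_act1 : char_act 1 = \1%VF.
Proof. by rewrite /char_act (chi1 B) scale1r. Qed.

Lemma char_actM a b : char_act (a * b) = (char_act b \o char_act a)%VF.
Proof.
by rewrite /char_act (chiM B) -comp_lfunZr -comp_lfunZl scalerA comp_lfun1l.
Qed.

Lemma char_actM_rev a b : char_act (a * b) = (char_act a \o char_act b)%VF.
Proof.
rewrite /char_act (chiM B) -comp_lfunZr -comp_lfunZl scalerA comp_lfun1l.
by rewrite mulrC.
Qed.

Definition simple_module : rmodule A :=
  @RModule K A K^o char_act char_act1 char_actM.

Definition left_simple_module : lmodule A :=
  @LModule K A K^o char_act char_act1 char_actM_rev.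

Lemma simple_module_at : simple_at c x simple_module i.
Proof.
split; first by rewrite dimvf.
by move=> v a; rewrite /app /= /char_act scale_lfunE id_lfunE.
Qed.

End SimpleModule.

Section FreeModules.
Variables (K : fieldType) (A : falgType K).
Variables (N : nat) (c : nat -> nat) (x : nat -> nat -> A).
Hypothesis B : path_basis fullv 1 N c x.
Implicit Types (M P : rmodule A).

Local Notation chi := (chi c x).
Local Notation simple_at := (simple_at c x).

(** A simple quotient S_i of P lifts to h : P -> A. Followed by left multiplication by e_i it takes
    the value e_i, so P splits into its kernel and a copy of e_i A; indecomposability removes the
    kernel. *)
Lemma indecomposable_projective_free P : indecomposable P -> projective P ->
  exists i u, free_on (x i 0%N) (u : P).
Proof.
move=> [P0 Pi] Pp; have [i [f [f0 fE]]] := form_top B P0.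
pose S := simple_module B i.
have [_ Sact] := simple_module_at B i; rewrite -/S in Sact.
have chiS a : (1 : S) · a = chi i a by rewrite Sact [_ *: _]mulr1.
have [h hh hE] : exists2 h : 'Hom(P, regular_rmodule A), is_hom h
    & ((gen (1 : S) : 'Hom(regular_rmodule A, S)) \o h)%VF = f.
  apply: Pp; first exact: gen_hom.
    apply: limg_full => w; exists (w *: 1).
    by rewrite genE appZr chiS (chi1 B) [_ *: _]mulr1.
  by apply/is_homP => v a; rewrite fE Sact.
have {}hE w : chi i (h w) = f w.
  by move/lfunP/(_ w): hE; rewrite comp_lfunE genE chiS.
have [u fu0] : exists u, f u != 0.
  apply: NNPP => n; case/eqP: f0; apply/lfunP => u; rewrite zero_lfunE.
  by apply/eqP/negPn/negP => fu; apply: n; exists u.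
have [d ud] : exists d, x i 0%N * h u * d = x i 0%N.
  by apply: (path_local_unit B); rewrite hE.
pose u' := u · d · x i 0%N.
pose g : 'Hom(P, regular_rmodule A) := (amull (x i 0%N) \o h)%VF.
have gE w : g w = x i 0%N * h w by rewrite comp_lfunE lfunE.
clearbody g; have gh : is_hom g.
  by apply/is_homP => w a; rewrite !gE hom_app // !regular_appE mulrA.
have gu' : g u' = x i 0%N.
  by rewrite gE /u' !hom_app // !regular_appE !mulrA ud (path_idem B).
have u'i : u' · x i 0%N = u' by rewrite /u' -appM (path_idem B).
have u'0 : u' != 0.
  apply: contraTneq isT => E; have := path_neq0 B (pb_len_gt0 B i).
  by rewrite -gu' E linear0 eqxx.
have dec w : w - u' · g w \in lker g.
  rewrite memv_ker linearB /= (hom_app gh) gu' regular_appE gE.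
  by rewrite mulrA (path_idem B) subrr.
have cap0 : (lker g :&: cyc u' = 0)%VS.
  apply: vspace0P => w; rewrite memv_cap memv_ker => /andP[/eqP gw /cycP[a wE]].
  move: gw; rewrite wE hom_app // gu' regular_appE => E.
  by rewrite -u'i -appM E app0r.
have sum1 : (lker g + cyc u' = fullv)%VS.
  apply/vspaceP => w; rewrite memvf -(subrK (u' · g w) w).
  by rewrite memv_add ?cyc_app.
have [g0|c0] := Pi _ _ (lker_submodule gh) (cyc_submodule u') sum1 cap0; last first.
  by have := cyc_id u'; rewrite c0 memv0 (negbTE u'0).
exists i, u'; split=> // [w|a ua].
  by exists (g w); apply/eqP; rewrite -subr_eq0 -memv0 -g0.
by rewrite -regular_appE -gu' -hom_app // ua linear0.
Qed.

Section OneGenerator.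
Variables (P : rmodule A) (i : nat) (u : P).
Hypothesis uF : free_on (x i 0%N) u.

Let ui : u · x i 0%N = u. Proof. by case: uF. Qed.
Let us w : exists a, w = u · a. Proof. by case: uF. Qed.
Let u0 a : u · a = 0 -> x i 0%N * a = 0. Proof. by case: uF => _ _; apply. Qed.

Lemma free_app_eq0 l : (u · x i l == 0) = (c i <= l)%N.
Proof.
rewrite -(pb_eq0 B); apply/eqP/eqP => [/u0|->]; last exact: app0r.
by rewrite (path_idl B).
Qed.

Definition socle_gen : P := u · x i (c i).-1.

Lemma socle_gen_neq0 : socle_gen != 0.
Proof. by rewrite free_app_eq0; have := pb_len_gt0 B i; lia. Qed.

Lemma free_essential w : w != 0 -> exists a, w · a = socle_gen.
Proof.
have [a ->] := us w => ua0; have a0 : x i 0%N * a != 0.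
  by apply: contraNneq ua0 => E; rewrite -ui -appM E app0r.
have [b [k [k0 E]]] := path_socle B a0.
exists (k^-1 *: b); rewrite appZr; have -> : u · a · b = u · (x i 0%N * a * b).
  by rewrite !appM ui.
by rewrite E appZr scalerA mulVf ?scale1r.
Qed.

Lemma socle_gen_app a : socle_gen · a = chi (i + (c i).-1) a *: socle_gen.
Proof. by rewrite /socle_gen -appM (path_last_mul B) appZr. Qed.

Lemma free_indecomposable : indecomposable P.
Proof. exact: essential_indecomposable socle_gen_neq0 free_essential. Qed.

Lemma socle_gen_line : cyc socle_gen = <[socle_gen]>%VS.
Proof.
apply/eqP; rewrite eqEsubv -memvE cyc_id andbT; apply/subvP => _ /cycP[a ->].
by rewrite socle_gen_app memvZ ?memv_line.
Qed.

Lemma socle_line_simple : simple_submodule <[socle_gen]>%VS.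
Proof.
split.
- rewrite -socle_gen_line; exact: cyc_submodule.
- by apply/eqP; rewrite -dimv_eq0 dim_vline socle_gen_neq0.
move=> W Ws WE; have [->|W0] := eqVneq W 0%VS; [by left|right].
apply/eqP; rewrite eqEsubv WE -memvE.
rewrite -vpick0 in W0; have [a <-] := free_essential W0.
by rewrite submodule_app ?memv_pick.
Qed.

Lemma simple_submodule_socle (W : {vspace P}) :
  simple_submodule W -> W = <[socle_gen]>%VS.
Proof.
move=> [Ws /eqP W0 Wmin]; rewrite -vpick0 in W0.
have [a E] := free_essential W0.
have sW : (<[socle_gen]> <= W)%VS by rewrite -memvE -E submodule_app ?memv_pick.
have [Ls /eqP L0 _] := socle_line_simple.
by case: (Wmin _ Ls sW) => // E0; rewrite E0 eqxx in L0.
Qed.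

Lemma free_is_socle (U : {vspace P}) :
  is_socle U <-> U = <[socle_gen]>%VS.
Proof.
split=> [[ub lub]|->].
  apply/eqP; rewrite eqEsubv ub ?andbT; last exact: socle_line_simple.
  by apply: lub => W /simple_submodule_socle->.
split=> [W /simple_submodule_socle->//|U']; apply; exact: socle_line_simple.
Qed.

(** If u = u·b + w with u·b in the kernel, then b has character zero at i, so 1 - b is invertible
    there and w = u·(1 - b) generates P. *)
Lemma free_superfluous M (q : 'Hom(P, M)) :
  is_hom q -> q u != 0 -> superfluous (lker q).
Proof.
move=> qh qu0 W Ws sumW.
have /memv_addP[z zk [w wW E]] : u \in (lker q + W)%VS by rewrite sumW memvf.
have [b zE] := us z.
have wE : w = u · (1 - b) by rewrite appBr app1 -zE E addrC addKr.
have b0 : chi i b = 0.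
  apply: (app_local B (v := q u)) => //; first by rewrite -hom_app // ui.
  by rewrite -hom_app // -zE; apply/eqP; rewrite -memv_ker.
have [d dE] : exists d, x i 0%N * (1 - b) * d = x i 0%N.
  by apply: (path_local_unit B); rewrite (chiB B) (chi1 B) b0 subr0 oner_eq0.
have uW : u \in W.
  by rewrite -ui -dE !appM ui -wE submodule_app.
apply/vspaceP => v; rewrite memvf; have [a ->] := us v; exact: submodule_app.
Qed.

Lemma free_composition_length : composition_length P (c i).
Proof.
pose V l := cyc (u · x i l).
have VS l : (l < c i)%N -> (V l <= V l.+1 + <[u · x i l]>)%VS.
  move=> lc; apply/subvP => _ /cycP[a ->]; rewrite -appM.
  have [b ->] := path_mull_lead B i l a; rewrite appDr addrC memv_add //.
    by rewrite appM cyc_app.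
  by rewrite appZr memvZ ?memv_line.
have Vsub l : (V l.+1 <= V l)%VS.
  apply: cyc_sub; first exact: cyc_submodule.
  by rewrite -addn1 -(pathM B) appM cyc_app.
have Vs l : submodule (V l) by exact: cyc_submodule.
(* The submodule generated by a path shrinks as the path grows, so the ascending series is indexed
   by the complementary length. *)
exists (fun t => V (c i - t)%N); split=> [||t _|t tc] //.
- rewrite subn0 /V (path_ge B (leqnn _)) app0r.
  by apply: vspace0P => _ /cycP[a ->]; rewrite app0l.
- rewrite subnn /V ui; apply/vspaceP => w; rewrite memvf.
  by have [a ->] := us w; exact: cyc_app.
have lc : (c i - t.+1 < c i)%N by lia.
have -> : (c i - t)%N = (c i - t.+1).+1 by lia.
move: (c i - t.+1)%N lc => l lc; split=> // [E|W Ws /andP[VW WV]].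
  have : u · x i l \in V l.+1 by rewrite E cyc_id.
  case/cycP=> a E'; have : u · (x i l - x i l.+1 * a) = 0.
    by rewrite appBr E' appM subrr.
  move/u0/(congr1 (fun y => pcoef c x i y l)).
  rewrite (pcoef_idl B) (pcoefB B) (pcoef_path B) // !eqxx /= (pcoef0 B).
  rewrite (path_mull B) (pcoef_sum B) big1 ?subr0.
    by move/eqP; rewrite oner_eq0.
  move=> m _; rewrite (pcoefZ B) (pcoef_path B) //.
  have /negbTE-> : l != (l.+1 + m)%N by lia.
  by rewrite andbF mulr0.
have [/subvP WVl|/subvPn[w wW wV]] := boolP (W <= V l.+1)%VS.
  by left; apply/eqP; rewrite eqEsubv VW andbT; apply/subvP.
right; apply/eqP; rewrite eqEsubv WV; apply: cyc_sub => //.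
have /memv_addP[y yV [_ /vlineP[k ->] E]] := subvP (VS _ lc) _ (subvP WV _ wW).
have k0 : k != 0 by apply: contraNneq wV => k0; rewrite E k0 scale0r addr0.
have -> : u · x i l = k^-1 *: (w - y) by rewrite E addrC addKr scalerA mulVf ?scale1r.
by rewrite memvZ // memvB // (subvP VW).
Qed.

End OneGenerator.

End FreeModules.

(** * Auslander-Reiten translates *)

Lemma hom_sub_scale (K : fieldType) (A : falgType K) (M P : rmodule A)
    (f g : 'Hom(M, P)) k : is_hom f -> is_hom g -> is_hom (f - k *: g).
Proof.
move=> fh gh; apply/is_homP => v a.
by rewrite !add_lfunE !opp_lfunE !scale_lfunE (hom_app fh) (hom_app gh) appBl appZl.
Qed.

Lemma dim1_line (K : fieldType) (V : vectType K) (v : V) :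
  v != 0 -> (forall w, exists k, w = k *: v) -> \dim {:V} = 1%N.
Proof.
move=> v0 vs; have -> : fullv = <[v]>%VS.
  by apply/vspaceP => w; rewrite memvf; apply/esym/vlineP; exact: vs.
by rewrite dim_vline v0.
Qed.

Section ARTranslate.
Variables (K : fieldType) (A : falgType K).
Variables (N : nat) (c : nat -> nat) (x : nat -> nat -> A).
Hypothesis B : path_basis fullv 1 N c x.
Implicit Types (M P : rmodule A).

Local Notation chi := (chi c x).
Local Notation simple_at := (simple_at c x).
Local Notation reg := (regular_rmodule A).

Definition left_simple_at (T : lmodule A) i : Prop :=
  \dim {:T} = 1%N /\ forall a t, lact T a t = chi i a *: (t : T).

Lemma simple_at_gen M i (v : M) : simple_at M i -> v != 0 ->
  v · x i 0%N = v /\ cyc v = fullv.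
Proof.
move=> [d h] v0; split; first by rewrite h (chi_path1 B) scale1r.
apply/vspaceP => w; rewrite memvf; have [k ->] := dim1_span v0 d w.
by rewrite memvZ ?cyc_id.
Qed.

Lemma simple_cover_free M i P (f : 'Hom(P, M)) :
  simple_at M i -> is_projective_cover f ->
  exists2 u, free_on (x i 0%N) u & f u != 0.
Proof.
move=> Mi [Pp fh fs fsup]; have [v v0] := dim1_pick Mi.1.
have [vi vs] := simple_at_gen Mi v0.
have [|u uF uv] := projective_cover_free B Pp fh fsup _ vi v0.
  by rewrite fs vs.
by exists u; rewrite // uv.
Qed.

Lemma free_simple_kernel M i P (q : 'Hom(P, M)) u :
  simple_at M i -> free_on (x i 0%N) u -> is_hom q -> q u != 0 ->
  lker q = cyc (u · x i 1).
Proof.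
move=> [d h] [ui us u0] qh qu; apply/vspaceP => y; rewrite memv_ker.
have [a ->] := us y; rewrite (hom_app qh) h scaler_eq0 (negbTE qu) orbF.
apply/eqP/cycP => [/(chi_eq0_left B)[b E]|[b E]].
  by exists b; rewrite -appM -E appM ui.
have : x i 0%N * (a - x i 1 * b) = 0 by apply: u0; rewrite appBr E appM subrr.
rewrite mulrBr mulrA (path_idl B) => /eqP; rewrite subr_eq0 => /eqP E'.
by rewrite -(chi_idl B) E' (chi_pathS_mul B).
Qed.

(** The minimal presentation is e_(i+1) A -> e_i A -> S_i, the first map being left multiplication
    by the arrow from i, which is nonzero as c i > 1. Hom(-, A) turns it into right multiplication A
    e_i -> A e_(i+1) by the arrow, whose cokernel is the left simple module at i+1. *)
Lemma transpose_simple M i T : simple_at M i -> (1 < c i)%N ->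
  is_transpose M T -> left_simple_at T i.+1.
Proof.
move=> Mi ci [P1 [P0 [p [q [[qcov P1p ph pq psup] [r [rlin rsurj rker]]]]]]].
have [_ qh _ _] := qcov.
have [u0 u0F qu0] := simple_cover_free Mi qcov.
rewrite (free_simple_kernel Mi u0F qh qu0) in pq.
set w0 := u0 · x i 1 in pq.
have w0i : w0 · x i.+1 0%N = w0 by rewrite /w0 -appM (pathMeq B) ?addn1.
have w00 : w0 != 0 by rewrite (free_app_eq0 B u0F) -ltnNge.
have [u1 u1F pu1] := projective_cover_free B P1p ph psup pq w0i w00.
pose e := x i.+1 0%N.
have [he heh heu] : exists2 h : 'Hom(P1, reg), is_hom h & h u1 = e.
  by apply: free_hom u1F _; rewrite regular_appE (path_idem B).
(* A homomorphism whose value at u1 has character zero factors through p by [chi_eq0_right], so r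
   sees only this character. *)
have rE (h : 'Hom(P1, reg)) : is_hom h -> r h = chi i.+1 (h u1) *: r he.
  move=> hh; set k := chi _ _; pose h' : 'Hom(P1, reg) := h - k *: he.
  have h'h : is_hom h' by exact: hom_sub_scale.
  suff: r h' = 0 by rewrite /h' linearB linearZ /= => /eqP; rewrite subr_eq0 => /eqP.
  apply/rker => //; have h'u : h' u1 = h' u1 * e.
    by rewrite -regular_appE -(hom_app h'h); case: u1F => ->.
  have [b Eb] : exists b, h' u1 * e = b * x i 1.
    apply: (chi_eq0_right B).
    rewrite /h' add_lfunE opp_lfunE scale_lfunE heu (chiB B) (chiZ B).
    by rewrite (chi_path1 B) mulr1 subrr.
  have [g gh gu] : exists2 g : 'Hom(P0, reg), is_hom g & g u0 = b * x i 0%N.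
    by apply: free_hom u0F _; rewrite regular_appE -mulrA (path_idem B).
  exists g => //; apply: (free_hom_ext u1F) => //; first exact: hom_comp.
  rewrite comp_lfunE pu1 /w0 (hom_app gh) gu regular_appE -mulrA (path_idl B).
  by rewrite h'u.
(* Homomorphisms factoring through p send u1 to a multiple of the arrow, of character zero, whereas
   [he] has character 1. *)
have t0 : r he != 0.
  apply/eqP => /rker-/(_ heh)[g gh E]; have /eqP := chi_path1 B i.+1.
  rewrite -/e -heu E comp_lfunE pu1 /w0 (hom_app gh) regular_appE (chiM B).
  by rewrite (chi_path B) andbF mulr0 eq_sym oner_eq0.
split; first apply: dim1_line t0 _.
  by move=> t; have [h hh <-] := rsurj t; exists (chi i.+1 (h u1)); exact: rE.
move=> a t; have [h hh <-] := rsurj t; rewrite -rlin //.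
have amh : is_hom (amull a \o h : 'Hom(P1, reg))%VF.
  by apply/is_homP => v b; rewrite !comp_lfunE (hom_app hh) !regular_appE !lfunE /= mulrA.
rewrite rE // [r h in RHS]rE // comp_lfunE lfunE /= (chiM B) scalerA.
by [].
Qed.

Lemma dual_simple T i : left_simple_at T i -> simple_at (dual_rmodule T) i.
Proof.
move=> [d h]; have [t t0] := dim1_pick d; have [f ft] := form_exists t0.
split.
  apply: (@dim1_line _ _ f).
    by apply: contra_eq_neq ft => ->; rewrite zero_lfunE eq_sym oner_eq0.
  move=> g; exists (g t); apply/lfunP => s; have [k ->] := dim1_span t0 d s.
  by rewrite scale_lfunE !linearZ /= ft; congr (_ *: _); rewrite [RHS]mulr1.
move=> g a; apply/lfunP => s; rewrite scale_lfunE /app /= !lfunE /=.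
by rewrite h linearZ.
Qed.

Lemma AR_translate_simple M P i : simple_at M i -> (1 < c i)%N ->
  is_AR_translate M P -> simple_at P i.+1.
Proof.
move=> Mi ci [T /(transpose_simple Mi ci)/dual_simple Ti PT].
exact: simple_at_iso (iso_sym PT) Ti.
Qed.

Lemma free_cover_simple M i P (u : P) : simple_at M i -> free_on (x i 0%N) u ->
  exists2 q : 'Hom(P, M), is_projective_cover q & q u != 0.
Proof.
move=> Mi uF.
have [v v0] := dim1_pick Mi.1; have [vi vs] := simple_at_gen Mi v0.
have [q qh qu] := free_hom uF vi; rewrite -qu in v0.
exists q => //; split=> //.
- exact: free_projective (path_idem B i) uF.
- apply: limg_full => w; have /cycP[a ->] : w \in cyc v by rewrite vs memvf.
  by exists (u · a); rewrite (hom_app qh) qu.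
- exact: (free_superfluous B uF qh v0).
Qed.

Lemma proj_cover_simple M i : simple_at M i ->
  exists P (u : P) (q : 'Hom(P, M)),
    [/\ free_on (x i 0%N) u, is_projective_cover q & q u != 0].
Proof.
move=> Mi; have [u [_ uF]] := proj_module_free (path_idem B i).
have [q qcov qu] := free_cover_simple Mi uF.
by exists (proj_module (x i 0%N)), u, q.
Qed.

Lemma simple_AR_translate M P i : simple_at M i -> simple_at P i.+1 ->
  (1 < c i)%N -> is_AR_translate M P.
Proof.
move=> Mi Pi ci; exists (left_simple_module B i.+1); last first.
  apply: simple_at_isomorphic Pi _; apply: dual_simple; split.
    by rewrite dimvf.
  by move=> a t; rewrite /= /char_act scale_lfunE id_lfunE.
have [P0 [u0 [q [u0F qcov qu0]]]] := proj_cover_simple Mi.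
have [_ qh _ _] := qcov.
have [u1 [_ u1F]] := proj_module_free (path_idem B i.+1).
set P1 := proj_module _ in u1 u1F.
have [u0i _ _] := u0F; have [u1i u1s _] := u1F.
set w0 := u0 · x i 1.
have w0i : w0 · x i.+1 0%N = w0 by rewrite /w0 -appM (pathMeq B) ?addn1.
have w00 : w0 != 0 by rewrite (free_app_eq0 B u0F) -ltnNge.
have [p ph pu1] := free_hom u1F w0i.
exists P1, P0, p, q; split.
  split=> //.
  - exact: free_projective (path_idem B i.+1) u1F.
  - rewrite (free_simple_kernel Mi u0F qh qu0); apply/vspaceP => y.
    apply/memv_imgP/cycP => [[z _ ->]|[a ->]].
      by have [a ->] := u1s z; exists a; rewrite (hom_app ph) pu1.
    by exists (u1 · a); rewrite ?memvf // (hom_app ph) pu1.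
  - by apply: (free_superfluous B u1F ph); rewrite pu1.
have [r rE] : exists r : 'Hom('Hom(P1, reg), K^o), forall h, r h = chi i.+1 (h u1).
  apply: linfun_exists => k f g.
  by rewrite add_lfunE scale_lfunE (chiD B) (chiZ B).
exists r; split.
- move=> h a hh; rewrite !rE comp_lfunE lfunE /= /char_act scale_lfunE id_lfunE.
  by rewrite (chiM B).
- move=> t; have [h hh hu] : exists2 h : 'Hom(P1, reg), is_hom h & h u1 = t *: x i.+1 0%N.
    by apply: free_hom u1F _; rewrite regular_appE -scalerAl (path_idem B).
  by exists h => //; rewrite rE hu (chiZ B) (chi_path1 B) mulr1.
move=> h hh; rewrite rE; split=> [h0|[g gh ->]]; last first.
  rewrite comp_lfunE pu1 (hom_app gh) regular_appE (chiM B) (chi_path B).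
  by rewrite andbF mulr0.
have [b Eb] := chi_eq0_right B h0.
have [g gh gu] : exists2 g : 'Hom(P0, reg), is_hom g & g u0 = b * x i 0%N.
  by apply: free_hom u0F _; rewrite regular_appE -mulrA (path_idem B).
exists g => //; apply: (free_hom_ext u1F) => //; first exact: hom_comp.
rewrite comp_lfunE pu1 /w0 (hom_app gh) gu regular_appE -mulrA (path_idl B) -Eb.
by rewrite -regular_appE -(hom_app hh) u1i.
Qed.

End ARTranslate.

(** * Kupisch series *)

(** Isomorphism classes parametrized by the integers modulo N. The instances are the simples, the
    simples labelled by their translates, and the injective hulls, so that representatives are
    counted and enumerated once for all. *)
Record labelling (K : fieldType) (A : falgType K) (N : nat)
    (t : rmodule A -> nat -> Prop) : Prop := Labelling {
  lab_mod : forall M i j, i = j %[mod N] -> t M i -> t M j;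
  lab_inj : forall M i j, t M i -> t M j -> i = j %[mod N];
  lab_iso : forall M P i, t M i -> t P i -> isomorphic M P;
  lab_trans : forall M P i, isomorphic M P -> t M i -> t P i;
  lab_ex : forall i, exists M, t M i }.

Section Representatives.
Variables (K : fieldType) (A : falgType K) (N : nat).
Variables (t : rmodule A -> nat -> Prop) (C : rmodule A -> Prop) (J : pred nat).
Hypothesis N0 : (0 < N)%N.
Hypothesis L : labelling N t.
Hypothesis CE : forall M, C M <-> exists2 i, J i & t M i.
Hypothesis J_mod : forall i j, i = j %[mod N] -> J i = J j.

Lemma representatives_labels m (X : 'I_m -> rmodule A) :
  complete_representatives C X -> exists s : 'I_m -> 'I_N,
    [/\ injective s, forall i, t (X i) (s i), forall i, J (s i)
      & forall j : 'I_N, J j -> exists i, s i = j].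
Proof.
move=> [CX Xinj Xsurj].
have [s sE] : exists s : 'I_m -> 'I_N, forall i, t (X i) (s i) /\ J (s i).
  apply: (@fun_choice _ _ (fun i (k : 'I_N) => t (X i) k /\ J k)) => i.
  have [k Jk tk] := proj1 (CE _) (CX i).
  have E : k = k %% N %[mod N] by rewrite modn_mod.
  exists (Ordinal (ltn_pmod k N0)); split; first exact: (lab_mod L) tk.
  by rewrite -(J_mod E).
exists s; split=> [i j sij|i|i|j Jj]; try by case: (sE i).
  by apply: Xinj; apply: (lab_iso L) (sE i).1 _; rewrite sij; exact: (sE j).1.
have [M Mj] := lab_ex L j; have [|i Mi] := Xsurj M; first by apply/CE; exists j.
exists i; apply: val_inj => /=.
have := lab_inj L (lab_trans L Mi Mj) (sE i).1.
by rewrite !modn_small ?ltn_ord.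
Qed.

Lemma labels_representatives m (b : nat -> nat) (X : 'I_m -> rmodule A) :
  (forall i, t (X i) (b i)) -> (forall i : 'I_m, J (b i)) ->
  (forall i j : 'I_m, b i = b j %[mod N] -> i = j) ->
  (forall j, J j -> exists i : 'I_m, b i = j %[mod N]) ->
  complete_representatives C X.
Proof.
move=> tX Jb binj bsurj; split=> [i|i j Xij|M /CE[j Jj Mj]].
- by apply/CE; exists (b i).
- by apply: binj; apply: (lab_inj L) (tX j); apply: (lab_trans L) Xij _.
have [i E] := bsurj j Jj; exists i.
exact: (lab_iso L) Mj (lab_mod L E (tX i)).
Qed.

Lemma representatives_card m (X : 'I_m -> rmodule A) :
  complete_representatives C X -> m = #|[pred j : 'I_N | J j]|.
Proof.
case/representatives_labels=> s [sinj _ Js ssurj].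
rewrite -[LHS]card_ord -(card_imset predT sinj); apply: eq_card => j.
rewrite inE; apply/imsetP/idP => [[i _ ->]|/ssurj[i <-]]; first exact: Js.
by exists i.
Qed.

End Representatives.

Section Kupisch.
Variables (K : fieldType) (A : falgType K).
Variables (N : nat) (c : nat -> nat) (x : nat -> nat -> A).
Hypothesis B : path_basis fullv 1 N c x.
Local Notation simple_at := (simple_at c x).

Lemma simple_labelling : labelling N simple_at.
Proof.
split.
- exact: simple_at_mod.
- exact: simple_at_inj.
- exact: simple_at_isomorphic.
- exact: simple_at_iso.
- by move=> i; exists (simple_module B i); exact: simple_module_at.
Qed.

Lemma simpleE (M : rmodule A) : simple M <-> exists2 i, predT i & simple_at M i.
Proof.
by split=> [/(simpleP B)[i Mi]|[i _ Mi]]; [exists i|apply/(simpleP B); exists i].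
Qed.

Lemma kupisch_exists d : (forall i, 1 < c i)%N -> size d = N ->
  (forall i, (i < N)%N -> nth 0%N d i = c i) -> kupisch_series A d.
Proof.
move=> c2 dN dE; exists (fun i => simple_module B i).
  apply: (@labels_representatives _ _ _ _ _ _ simple_labelling simpleE _ id).
  - by move=> i; exact: simple_module_at.
  - by [].
  - by move=> i j; rewrite -dN !modn_small // => /val_inj.
  - move=> j _; have jd : (j %% N < size d)%N by rewrite dN ltn_mod (pb_gt0 B).
    by exists (Ordinal jd); rewrite /= modn_mod.
move=> i; split.
  apply: (simple_AR_translate B (simple_module_at B i)) => //.
  apply: (simple_at_mod B) (simple_module_at B _); first by rewrite /= -[in RHS]modn_mod -dN modn_mod.
have [P [u [q [uF qcov _]]]] := proj_cover_simple B (simple_module_at B i).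
exists P, q; split=> //; rewrite dE -?dN //.
exact: (free_composition_length B uF).
Qed.

(** The translate raises the vertex by one, so the given simples sit at consecutive vertices; r is
    the vertex of the first, the rotation that a Kupisch series leaves free. *)
Lemma kupisch_extract d : all (ltn 1) d -> kupisch_series A d ->
  size d = N /\ exists r, forall i, (i < N)%N -> nth 0%N d i = c (r + i)%N.
Proof.
move=> d2 [S Srep Sd].
have [s [sinj sS _ ssurj]] := representatives_labels (pb_gt0 B)
  simple_labelling simpleE (fun _ _ _ => erefl) Srep.
have dN : size d = N.
  rewrite (representatives_card (pb_gt0 B) simple_labelling simpleE
    (fun _ _ _ => erefl) Srep).
  by rewrite -[RHS]card_ord; apply: eq_card.
have cE (i : 'I_(size d)) : nth 0%N d i = c (s i).
  have [_ [P [f [fcov fl]]]] := Sd i.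
  have [u uF _] := simple_cover_free B (sS i) fcov.
  rewrite (composition_length_dim B fl).
  by rewrite (composition_length_dim B (free_composition_length B uF)).
have sS1 (i : 'I_(size d)) : s (ordS i) = (s i).+1 %[mod N].
  apply: (simple_at_inj B (sS (ordS i))); apply: (AR_translate_simple B (sS i)).
    by rewrite -cE; apply: (allP d2); rewrite mem_nth.
  by case: (Sd i).
have d0 : (0 < size d)%N by rewrite dN (pb_gt0 B).
split=> //; exists (s (Ordinal d0)).
have sE i (id : (i < size d)%N) : s (Ordinal id) = s (Ordinal d0) + i %[mod N].
  elim: i id => [|i IH] id; first by rewrite addn0; congr (nat_of_ord (s _) %% _)%N; exact: val_inj.
  have il : (i < size d)%N by lia.
  have -> : Ordinal id = ordS (Ordinal il).
    by apply: val_inj; rewrite /= modn_small.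
  rewrite sS1 addnS -[(s _).+1]addn1 -[(_ + i).+1]addn1; exact: eqmod_addl (IH il).
move=> i; rewrite -{1}dN => id; rewrite (cE (Ordinal id)).
exact: (path_len_mod B).
Qed.

End Kupisch.

(** * The syzygy filtered algebra *)

(** T is isomorphic to the corner algebra eAe. *)
Definition corner_algebra (K : fieldType) (A : falgType K) (e : A)
    (T : falgType K) : Prop :=
  exists psi : 'Hom(T, A), [/\ psi 1 = e, forall a b, psi (a * b) = psi a * psi b,
    injective psi & forall a, (exists b, psi b = a) <-> e * a * e = a].

Section EndomorphismCorner.
Variables (K : fieldType) (A T : falgType K) (M : rmodule A) (e : A) (u : M).
Hypothesis ee : e * e = e.
Hypothesis uF : free_on e u.

Let ue : u · e = u. Proof. by case: uF. Qed.
Let us w : exists a, w = u · a. Proof. by case: uF. Qed.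
Let free_cancel a b : u · a = u · b -> e * a = e * b.
Proof.
move=> E; apply/eqP; rewrite -subr_eq0 -mulrBr; apply/eqP.
by case: uF => _ _; apply; rewrite appBr E subrr.
Qed.

(** An endomorphism is determined by the image of u, which is fixed by e and so is u·a for a unique
    a in eAe. Evaluation at u identifies End(eA) with eAe. *)
Lemma free_endo_algebra_corner : is_endomorphism_algebra M T -> corner_algebra e T.
Proof.
case=> phi [phi1 phiM phi_inj phi_surj].
have lin : linear (fun b => e * (gen u)^-1%VF (phi b u)).
  move=> k a b; rewrite linearP add_lfunE scale_lfunE linearP.
  by rewrite mulrDr -scalerAr.
have phih b : is_hom (phi b) by apply/phi_surj; exists b.
have [psi psiE] := linfun_exists lin.
have psil b : e * psi b = psi b by rewrite psiE mulrA ee.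
have upsi b : u · psi b = phi b u.
  rewrite psiE appM ue -genE limg_lfunVK //.
  by have [a ->] := us (phi b u); exact: cyc_app.
have psir b : psi b * e = psi b.
  rewrite -psil -mulrA; apply: free_cancel.
  by rewrite appM upsi -(hom_app (phih b)) ue.
have psi_uniq b a : phi b u = u · a -> psi b = e * a.
  by rewrite -upsi -psil => /free_cancel; rewrite mulrA ee.
exists psi; split.
- by rewrite -[e in RHS]mulr1; apply: psi_uniq; rewrite phi1 id_lfunE app1.
- move=> a b; have -> : psi a * psi b = e * (psi a * psi b) by rewrite mulrA psil.
  apply: psi_uniq.
  by rewrite phiM comp_lfunE -upsi (hom_app (phih a)) -upsi appM.
- move=> a b E; apply: phi_inj; apply: (free_hom_ext uF) => //.
  by rewrite -!upsi E.
move=> a; split=> [[b <-]|ae]; first by rewrite psil psir.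
have [f fh fu] : exists2 f : 'End(M), is_hom f & f u = u · a.
  by apply: (free_hom uF); rewrite -ae -!appM -!mulrA ee.
have [b bf] := (proj1 (phi_surj f)) fh; exists b.
by rewrite (psi_uniq b a) ?bf // -ae !mulrA ee.
Qed.

Lemma corner_free_endo_algebra : corner_algebra e T -> is_endomorphism_algebra M T.
Proof.
case=> psi [psi1 psiM psi_inj psi_im].
have psie b : e * psi b * e = psi b by apply/psi_im; exists b.
have psil b : e * psi b = psi b by rewrite -psie !mulrA ee.
have psir b : psi b * e = psi b by rewrite -psie -!mulrA ee.
have [phi phiP] : exists phi : T -> 'End(M),
    forall b, is_hom (phi b) /\ phi b u = u · psi b.
  apply: (@fun_choice _ _ (fun b (f : 'End(M)) => is_hom f /\ f u = u · psi b)) => b.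
  have [|f fh fu] := @free_hom _ _ M e u M (u · psi b) uF; last by exists f.
  by rewrite -appM psir.
have phih b := (phiP b).1; have phiu b := (phiP b).2.
have lin : linear phi.
  move=> k a b; apply: (free_hom_ext uF) => //.
    apply/is_homP => v d; rewrite !add_lfunE !scale_lfunE.
    by rewrite (hom_app (phih a)) (hom_app (phih b)) appDl appZl.
  by rewrite add_lfunE scale_lfunE !phiu linearP appDr appZr.
pose phiM := GRing.isLinear.Build _ _ _ _ phi lin.
pose phiL : {linear _ -> _} := HB.pack phi phiM.
exists phiL; split.
- apply: (free_hom_ext uF) => //; first exact: hom_id.
  by rewrite phiu psi1 id_lfunE.
- move=> a b; apply: (free_hom_ext uF) => //; first exact: hom_comp.
  by rewrite comp_lfunE !phiu psiM (hom_app (phih a)) phiu appM.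
- move=> a b /(congr1 (fun f : 'End(M) => f u)); rewrite !phiu => /free_cancel.
  by rewrite !psil => /psi_inj.
move=> f; split=> [fh|[b <-]]; last exact: phih.
have [a fa] := us (f u); have [b bE] : exists b, psi b = e * a * e.
  by apply/psi_im; rewrite !mulrA ee -!mulrA ee.
exists b; apply: (free_hom_ext uF) => //=.
by rewrite phiu bE !appM ue -fa -(hom_app fh) ue.
Qed.

End EndomorphismCorner.

Section SyzygyFiltered.
Variables (K : fieldType) (A : falgType K).
Variables (N : nat) (c : nat -> nat) (x : nat -> nat -> A).
Hypothesis B : path_basis fullv 1 N c x.
Hypothesis c2 : forall i, (1 < c i)%N.
Local Notation simple_at := (simple_at c x).

(** The vertices of tau S, for S the socle of an indecomposable projective. *)
Definition base : pred nat := fun b => [exists i : 'I_N, i + c i == b %[mod N]]%N.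

Lemma baseP b : reflect (exists i, (i + c i = b %[mod N])%N) (base b).
Proof.
apply: (iffP existsP) => [[i /eqP E]|[i E]]; first by exists i.
have Ei : (i %% N = i %[mod N])%N by rewrite modn_mod.
exists (Ordinal (ltn_pmod i (pb_gt0 B))); rewrite /= -E.
by rewrite (path_len_mod B Ei); apply/eqP; exact: eqmod_addl.
Qed.

Lemma base_mod i j : i = j %[mod N] -> base i = base j.
Proof. by move=> E; rewrite /base E. Qed.

(** S is labelled by the vertex of its translate: [b + N.-1] is b - 1 modulo N. With this shift the
    socle of P_i has label i + c i. *)
Definition socle_label (S : rmodule A) b := simple_at S (b + N.-1)%N.

Lemma pred_addN b : (b + N.-1).+1 = b %[mod N].
Proof. by rewrite -addnS prednK ?(pb_gt0 B) // modnDr. Qed.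

Lemma socle_labelling : labelling N socle_label.
Proof.
have L := simple_labelling B; split=> [M i j E|M i j Mi Mj|M P i|M P i|i].
- by apply: (lab_mod L); exact: eqmod_addl.
- have /(eqmod_addl 1) := lab_inj L Mi Mj.
  by rewrite !addn1 !pred_addN.
- exact: (lab_iso L).
- exact: (lab_trans L).
- exact: (lab_ex L).
Qed.

Lemma projective_socleE S : projective_socle S <-> exists2 b, base b & socle_label S b.
Proof.
split=> [[P [f [Pi Pp fh f0 fsoc]]]|[b /baseP[i E] Sb]].
  have [i [u uF]] := indecomposable_projective_free B Pi Pp.
  have {}fsoc := (proj1 (free_is_socle B uF _)) fsoc.
  exists (i + c i)%N; first by apply/baseP; exists i.
  apply: (simple_at_mod B (i := i + (c i).-1)).
    have C := pb_len_gt0 B i; have N0 := pb_gt0 B.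
    have -> : (i + c i + N.-1 = i + (c i).-1 + N)%N by lia.
    by rewrite modnDr.
  have dS : \dim {:S} = 1%N.
    by rewrite -(limg_dim_eq (f := f)) ?f0 ?capv0 // fsoc dim_vline (socle_gen_neq0 B uF).
  split=> // v a; move/eqP/lker0P: f0; apply; rewrite (hom_app fh) linearZ /=.
  have /vlineP[k ->] : f v \in <[socle_gen c x i u]>%VS by rewrite -fsoc memv_img ?memvf.
  by rewrite appZl (socle_gen_app B) !scalerA mulrC.
have [u [_ uF]] := proj_module_free (path_idem B i).
set P := proj_module _ in u uF; set z := socle_gen c x i u.
have [v v0] := dim1_pick Sb.1; have [vi _] := simple_at_gen B Sb v0.
have [g gv] := form_exists v0.
have vE w : w = g w *: v.
  by have [k ->] := dim1_span v0 Sb.1 w; rewrite linearZ /= gv [_ *: 1]mulr1.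
have lin : linear (fun w => g w *: z).
  by move=> s w w'; rewrite linearP scalerDl scalerA.
have [f fE] := linfun_exists lin.
have z0 : z != 0 := socle_gen_neq0 B uF.
have cE a : chi c x (b + N.-1) a = chi c x (i + (c i).-1) a.
  apply: (chi_mod B); have C := pb_len_gt0 B i.
  apply/eqP; rewrite -(eqn_modDr 1) !addn1 pred_addN -E.
  by apply/eqP; congr (_ %% _)%N; lia.
exists P, f; split.
- exact: (free_indecomposable B uF).
- exact: (free_projective (path_idem B i) uF).
- apply/is_homP => w a; rewrite !fE appZl (socle_gen_app B) Sb.2 linearZ /=.
  by rewrite -cE scalerA mulrC.
- apply: vspace0P => w; rewrite memv_ker fE scaler_eq0 (negbTE z0) orbF => /eqP gw.
  by rewrite [w]vE gw scale0r.
apply/(free_is_socle B uF)/vspaceP => w; apply/memv_imgP/vlineP.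
  by case=> w' _ ->; exists (g w'); rewrite fE.
by case=> k ->; exists (k *: v); rewrite ?memvf // fE linearZ /= gv [_ *: 1]mulr1.
Qed.

Definition base_idem : A := \sum_(b < N | base b) x b 0%N.

Lemma path_base_idem i l :
  x i l * base_idem = if base (i + l)%N then x i l else 0.
Proof.
rewrite mulr_sumr (eq_bigr (fun b : 'I_N =>
    if (b == (i + l) %% N :> nat)%N then x i l else 0)); last first.
  move=> b _; rewrite (pb_mul B) [(b %% N)%N]modn_small // eq_sym addn0.
  by [].
rewrite -big_mkcondr /=; have lN := ltn_pmod (i + l) (pb_gt0 B).
have bE : base (i + l)%N = base ((i + l) %% N)%N by apply: base_mod; rewrite modn_mod.
case: ifP => Bil.
  by rewrite (big_pred1 (Ordinal lN)) // => b; rewrite /= -val_eqE /= andb_idl // => /eqP->; rewrite -bE.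
by rewrite big_pred0 // => b; apply/negP => /andP[Bb /eqP E]; rewrite bE -E Bb in Bil.
Qed.

Lemma base_idem_path i l :
  base_idem * x i l = if base i then x i l else 0.
Proof.
rewrite mulr_suml (eq_bigr (fun b : 'I_N =>
    if (b == i %% N :> nat)%N then x i l else 0)); last first.
  move=> b _; rewrite (pb_mul B) addn0 [(b %% N)%N]modn_small //.
  case: eqP => // E; rewrite add0n; apply: (path_mod B).
  by rewrite E modn_mod.
rewrite -big_mkcondr /=; have lN := ltn_pmod i (pb_gt0 B).
have bE : base i = base (i %% N)%N by apply: base_mod; rewrite modn_mod.
case: ifP => Bil.
  by rewrite (big_pred1 (Ordinal lN)) // => b; rewrite /= -val_eqE /= andb_idl // => /eqP->; rewrite -bE.
by rewrite big_pred0 // => b; apply/negP => /andP[Bb /eqP E]; rewrite bE -E Bb in Bil.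
Qed.

Lemma base_idem_idem : base_idem * base_idem = base_idem.
Proof.
by rewrite {1}/base_idem mulr_suml; apply: eq_bigr => b Bb; rewrite path_base_idem addn0 Bb.
Qed.

Lemma base_idem_labels m (s : 'I_m -> 'I_N) : injective s ->
  (forall i, base (s i)) -> (forall j : 'I_N, base j -> exists i, s i = j) ->
  base_idem = \sum_i x (s i) 0%N.
Proof.
move=> sinj Js ssurj; rewrite /base_idem.
rewrite (eq_bigl (fun b => b \in [set s i | i : 'I_m])) => [|b].
  by rewrite big_imset //= => i j _ _; exact: sinj.
by apply/idP/imsetP => [/ssurj[i <-]|[i _ ->]//]; exists i.
Qed.

(** The sum of the generators is a free generator for the sum of their idempotents; orthogonality of
    the idempotents separates the components. *)
Lemma direct_sum_free m (s : 'I_m -> 'I_N) (P : 'I_m -> rmodule A)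
    (u : forall i, P i) M : injective s ->
  (forall i, base (s i)) -> (forall j : 'I_N, base j -> exists i, s i = j) ->
  (forall i, free_on (x (s i) 0%N) (u i)) -> is_direct_sum P M ->
  exists w : M, free_on base_idem w.
Proof.
move=> sinj Js ssurj uF [iota [ih isum]].
have ui i : u i · x (s i) 0%N = u i by case: (uF i).
have eE := base_idem_labels sinj Js ssurj.
have ue i : u i · base_idem = u i.
  by rewrite -ui -appM path_base_idem addn0 Js.
exists (\sum_i iota i (u i)); split.
- rewrite app_suml; apply: eq_bigr => i _.
  by rewrite -(hom_app (ih i)) ue.
- move=> v; have [y [-> _]] := isum v.
  have [a aE] : exists a : 'I_m -> A, forall i, y i = u i · a i.
    by apply: (@fun_choice _ _ (fun i a => y i = u i · a)) => i; case: (uF i).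
  (* Prefixing each coefficient by its own idempotent keeps it from acting on the other
     generators. *)
  exists (\sum_i x (s i) 0%N * a i); rewrite app_suml; apply: eq_bigr => i _.
  rewrite -(hom_app (ih i)) aE; congr (iota i _).
  rewrite -[in RHS]ui -appM mulr_sumr (bigD1 i) //= mulrA (path_idem B).
  rewrite big1 ?addr0 ?appM ?ui // => j ji.
  rewrite mulrA (pb_mul B) addn0 !modn_small //.
  rewrite (inj_eq val_inj) (inj_eq sinj) eq_sym (negbTE ji) mul0r.
  by [].
move=> a ua; rewrite eE mulr_suml big1 // => i _.
have [z [_ zuniq]] := isum 0.
suff : u i · a = 0 by case: (uF i) => _ _; apply.
transitivity (z i).
  apply: (zuniq (fun i => u i · a)).
  rewrite -[LHS]ua app_suml; apply: eq_bigr => j _.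
  by rewrite (hom_app (ih j)).
rewrite -(zuniq (fun i => 0 : P i)) // big1 // => j _; exact: linear0.
Qed.

Lemma base_idem_direct_sum m (s : 'I_m -> 'I_N) : injective s ->
  (forall i, base (s i)) -> (forall j : 'I_N, base j -> exists i, s i = j) ->
  is_direct_sum (fun i => proj_module (x (s i) 0%N)) (proj_module base_idem).
Proof.
move=> sinj Js ssurj; have eE := base_idem_labels sinj Js ssurj.
have [iota iotaP] : exists iota : forall i,
    'Hom(proj_module (x (s i) 0%N), proj_module base_idem),
    forall i, is_hom (iota i) /\ forall v, vsval (iota i v) = vsval v.
  apply: (@fun_choice _ _ (fun i (f : 'Hom(proj_module (x (s i) 0%N), proj_module base_idem)) =>
    is_hom f /\ forall v, vsval (f v) = vsval v)) => i.
  have [g gh gE] := sub_inclusion (cyc_submodule (x (s i) 0%N : regular_rmodule A)).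
  have [|h hh hE] := sub_corestrict (cyc_submodule (base_idem : regular_rmodule A)) gh.
    move=> v; rewrite gE; have /cycP[a ->] := subvsP v.
    rewrite regular_appE; apply/cycP; exists (x (s i) 0%N * a).
    by rewrite regular_appE mulrA base_idem_path Js.
  by exists h; split=> // v; rewrite hE gE.
exists iota; split=> [i|v]; first by case: (iotaP i).
have ex i : x (s i) 0%N * vsval v \in cyc (x (s i) 0%N : regular_rmodule A).
  by apply/cycP; exists (vsval v); rewrite regular_appE.
exists (fun i => Subvs (ex i)); split=> [|y vE i].
  apply: subvs_inj; rewrite linear_sum /=.
  rewrite (eq_bigr (fun i => x (s i) 0%N * vsval v)) => [|i _].
    rewrite -mulr_suml -eE; have /cycP[a ->] := subvsP v.
    by rewrite regular_appE mulrA base_idem_idem.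
  by rewrite (iotaP i).2.
apply: subvs_inj; rewrite /= vE linear_sum /= mulr_sumr (bigD1 i) //= big1 ?addr0.
  rewrite (iotaP i).2; have /cycP[a ->] := subvsP (y i).
  by rewrite regular_appE mulrA (path_idem B).
move=> j ji; rewrite (iotaP j).2; have /cycP[a ->] := subvsP (y j).
rewrite regular_appE mulrA (pb_mul B) addn0 !modn_small //.
by rewrite (inj_eq val_inj) (inj_eq sinj) eq_sym (negbTE ji) mul0r.
Qed.

Lemma syzygy_corner T : is_syzygy_filtered_algebra A T <-> corner_algebra base_idem T.
Proof.
split=> [[m [S [tauS [P [M [Srep tauE Pcov Msum Mend]]]]]]|Tcorner].
  have [s [sinj sS Js ssurj]] := representatives_labels (pb_gt0 B)
    socle_labelling projective_socleE base_mod Srep.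
  have [u uF] : exists u : forall i, P i, forall i, free_on (x (s i) 0%N) (u i).
    apply: (@fun_choice _ _ (fun i (u : P i) => free_on (x (s i) 0%N) u)) => i.
    have tS := AR_translate_simple B (sS i) (c2 _) (tauE i).
    have [f fcov] := Pcov i.
    have [u uF _] := simple_cover_free B tS fcov; exists u.
    by rewrite -(path_mod B 0 (pred_addN (s i))).
  have [w wF] := direct_sum_free sinj Js ssurj uF Msum.
  exact: free_endo_algebra_corner base_idem_idem wF Mend.
pose s (i : 'I_#|[pred b : 'I_N | base b]|) : 'I_N := enum_val i.
have sinj : injective s by exact: enum_val_inj.
have Js i : base (s i) by exact: (enum_valP i).
have ssurj (j : 'I_N) : base j -> exists i, s i = j.
  by move=> Bj; exists (enum_rank_in (A := [pred b : 'I_N | base b]) Bj j); rewrite /s enum_rankK_in.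
have [w [_ wF]] := proj_module_free base_idem_idem.
exists _, (fun i => simple_module B (s i + N.-1)), (fun i => simple_module B (s i)),
  (fun i => proj_module (x (s i) 0%N)), (proj_module base_idem); split.
(* The labels must be a function on all naturals; its default value 0 outside the index range is
   never consulted. *)
- apply: (@labels_representatives _ _ _ _ _ _ socle_labelling projective_socleE
    _ (fun i => if insub i is Some i' then s i' else 0%N)).
  + by move=> i; rewrite valK; exact: simple_module_at.
  + by move=> i; rewrite valK; exact: Js.
  + move=> i j; rewrite !valK !modn_small ?ltn_ord // => /val_inj; exact: sinj.
  + move=> j Bj; have Bj' : base (Ordinal (ltn_pmod j (pb_gt0 B))).
      by rewrite (base_mod (j := j)) //= modn_mod.
    by have [i E] := ssurj _ Bj'; exists i; rewrite valK E /= modn_mod.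
- move=> i; apply: (simple_AR_translate B (simple_module_at B _)) => //.
  apply: (simple_at_mod B) (simple_module_at B _); exact/esym/pred_addN.
- move=> i; have [u [_ uF]] := proj_module_free (path_idem B (s i)).
  have [q qcov _] := free_cover_simple B (simple_module_at B (s i)) uF.
  by exists q.
- exact: base_idem_direct_sum.
- exact: corner_free_endo_algebra base_idem_idem wF Tcorner.
Qed.

End SyzygyFiltered.

(** * The defect *)

Section InjectiveModules.
Variables (K : fieldType) (A : falgType K).

Lemma left_regular_actM (a b : A) : amull (a * b) = (amull a \o amull b)%VF.
Proof. by apply/lfunP => v; rewrite comp_lfunE !lfunE /= mulrA. Qed.

Definition left_regular : lmodule A :=
  @LModule K A A (@amull K A) (amull1 A) left_regular_actM.

Definition coregular : rmodule A := dual_rmodule left_regular.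

Lemma dual_appE (T : lmodule A) (f : dual_rmodule T) a (t : T) :
  ((f · a : dual_rmodule T) : 'Hom(T, K^o)) t = (f : 'Hom(T, K^o)) (lact T a t).
Proof. by rewrite /app /= !lfunE. Qed.

Lemma coregular_appE (f : coregular) (a b : A) :
  ((f · a : coregular) : 'Hom(A, K^o)) b = (f : 'Hom(A, K^o)) (a * b).
Proof. by apply: etrans (@dual_appE left_regular f a b) _; rewrite /= lfunE. Qed.

Section Idempotent.
Variable e : A.
Hypothesis ee : e * e = e.

Definition precomp_amulr (f : 'Hom(A, K^o)) : 'Hom(A, K^o) := (f \o amulr e)%VF.

Lemma precomp_amulr_linear : linear precomp_amulr.
Proof. by move=> k f g; rewrite /precomp_amulr comp_lfunDl comp_lfunZl. Qed.

HB.instance Definition _ :=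
  GRing.isLinear.Build K _ _ _ precomp_amulr precomp_amulr_linear.

(** Forms on A invariant under right multiplication by e correspond to forms on Ae by restriction;
    [precomp_amulr] projects onto them. *)
Definition injective_forms : {vspace coregular} := limg (linfun precomp_amulr).

Lemma injective_formsP (f : 'Hom(A, K^o)) :
  reflect (forall a, f (a * e) = f a) (f \in injective_forms).
Proof.
apply: (iffP memv_imgP) => [[g _ ->] a|fe].
  by rewrite lfunE /= !comp_lfunE !lfunE /= -mulrA ee.
exists f; first exact: memvf.
by apply/lfunP => a; rewrite lfunE /= comp_lfunE lfunE /= fe.
Qed.

Lemma injective_forms_submodule : submodule injective_forms.
Proof.
apply/submoduleP => f a /injective_formsP fe; apply/injective_formsP => b.
by rewrite !coregular_appE mulrA fe.
Qed.

(** The K-dual of the left module Ae. *)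
Definition inj_module : rmodule A := sub_rmodule injective_forms_submodule.

Definition inj_form (w : inj_module) : 'Hom(A, K^o) := vsval w.

Lemma inj_formP w a : inj_form w (a * e) = inj_form w a.
Proof. by have /injective_formsP := subvsP w; apply. Qed.

Lemma inj_form_app w a b : inj_form (w · a) b = inj_form w (a * b).
Proof. by rewrite /inj_form sub_appE coregular_appE. Qed.

Lemma inj_form_inj v w : inj_form v =1 inj_form w -> v = w.
Proof. by move=> E; apply: subvs_inj; apply/lfunP. Qed.

Lemma inj_form_ex (f : 'Hom(A, K^o)) : (forall a, f (a * e) = f a) ->
  exists w, inj_form w = f.
Proof. by move/injective_formsP => fe; exists (Subvs fe). Qed.

Lemma inj_formD k v w a : inj_form (k *: v + w) a = k * inj_form v a + inj_form w a.
Proof. by rewrite /inj_form linearP add_lfunE scale_lfunE. Qed.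

Lemma inj_form0 a : inj_form 0 a = 0.
Proof. by rewrite /inj_form linear0 zero_lfunE. Qed.

(** A homomorphism f into the dual of Ae is determined by the form v |-> f(v)(1). It thus suffices
    to extend this form linearly from X to Y; the extension h1 sends y to the form a |->
    h1(y·ae). *)
Lemma inj_module_injective : injective_module inj_module.
Proof.
move=> X Y g f gh g0 fh.
have lin1 : linear (fun v => inj_form (f v) 1 : K^o).
  by move=> k v w; rewrite linearP inj_formD.
have [f1 f1E] := linfun_exists lin1; have [h1 h1E] := form_extend f1 g0.
have [h0 h0E] : exists h0 : Y -> inj_module,
    forall y a, inj_form (h0 y) a = h1 (y · (a * e)).
  apply: (@fun_choice _ _ (fun y (w : inj_module) =>
    forall a, inj_form w a = h1 (y · (a * e)))) => y.
  have lin2 : linear (fun a => h1 (y · (a * e))).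
    by move=> k a b; rewrite mulrDl -scalerAl appDr appZr linearP.
  have [p pE] := linfun_exists lin2.
  have [|w wE] := @inj_form_ex p; last by exists w => a; rewrite wE pE.
  by move=> a; rewrite !pE -mulrA ee.
have lin3 : linear h0.
  move=> k y z; apply: inj_form_inj => a.
  by rewrite inj_formD !h0E appDl appZl linearP.
have [h hE] := linfun_exists lin3; exists h.
  apply/is_homP => y b; apply: inj_form_inj => a.
  by rewrite hE h0E inj_form_app hE h0E -appM mulrA.
apply/lfunP => v; rewrite comp_lfunE; apply: inj_form_inj => a.
rewrite hE h0E -(hom_app gh) h1E f1E (hom_app fh) inj_form_app mulr1.
exact: inj_formP.
Qed.

End Idempotent.

End InjectiveModules.

(** * Injective hulls of the simples *)

Section InjectiveNakayama.
Variables (K : fieldType) (A : falgType K).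
Variables (N : nat) (c : nat -> nat) (x : nat -> nat -> A).
Hypothesis B : path_basis fullv 1 N c x.
Local Notation chi := (chi c x).

Definition inj_hull j : rmodule A := inj_module (path_idem B j).

Lemma inj_hull_mod i j : i = j %[mod N] -> isomorphic (inj_hull i) (inj_hull j).
Proof.
rewrite /inj_hull => E; move: (path_idem B i) (path_idem B j).
by rewrite (path_mod B 0 E) => e1 e2; rewrite (eq_irrelevance e1 e2); exact: iso_refl.
Qed.

(** The character [chi j] is itself a form invariant under e_j. *)
Lemma inj_hull_socle j : exists2 z : inj_hull j, z != 0 &
  (forall a, inj_form z a = chi j a).
Proof.
have [f fE] := linfun_exists (chi_linear B j).
have [|z zE] := @inj_form_ex _ _ _ (path_idem B j) f.
  by move=> a; rewrite !fE (chiM B) (chi_path1 B) mulr1.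
exists z => [|a]; last by rewrite zE fE.
apply: contra_neqN (oner_neq0 K) => /eqP z0; rewrite -(chi_path1 B j) -fE -zE z0.
by rewrite inj_form0.
Qed.

(** Let p be a longest path with w(p) nonzero. It ends at j by invariance under e_j, and w·p
    vanishes on all nontrivial paths from j, so it is w(p) times the character. *)
Lemma inj_hull_essential j (z w : inj_hull j) :
  (forall a, inj_form z a = chi j a) -> w != 0 -> exists a, w · a = z.
Proof.
move=> zE w0; pose Q i l := inj_form w (x i l) != 0.
have [|||i [l [Ql lmax]]] := @longest_path _ _ _ _ _ B Q.
- apply: NNPP => n; case/eqP: w0; apply: inj_form_inj => a; rewrite inj_form0.
  rewrite [a](path_expand B) linear_sum big1 // => i _; rewrite linear_sum big1 // => l _.
  rewrite linearZ /=; have [->|wx] := eqVneq (inj_form w (x i l)) 0; first exact: scaler0.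
  by case: n; exists i, l.
- by move=> i i' l E; rewrite /Q (path_mod B _ E).
- move=> i l; rewrite ltnNge /Q; apply: contra => /(path_ge B)->.
  by rewrite linear0.
have Eil : (i + l = j %[mod N])%N.
  apply: contraNeq Ql => ne; rewrite -inj_formP (pb_mul B) ifN ?linear0 //.
exists ((inj_form w (x i l))^-1 *: x i l); apply: inj_form_inj => a.
rewrite inj_form_app zE -(chi_mod B a Eil) -scalerAl linearZ /=.
rewrite (path_mull B) linear_sum.
have C := pb_len_gt0 B (i + l); rewrite (bigD1 (Ordinal C)) //= big1 ?addr0.
  by rewrite linearZ /= addn0 [_ *: _]mulrC -[_ *: _]/(_ * _) mulfK.
move=> m; rewrite -val_eqE /= => m0; rewrite linearZ /=.
have := lmax i (l + m)%N; rewrite negbK => /(_ ltac:(lia))/eqP->.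
exact: scaler0.
Qed.

Lemma inj_hull_indecomposable j : indecomposable (inj_hull j).
Proof.
have [z z0 zE] := inj_hull_socle j.
by apply: essential_indecomposable z0 _ => w; exact: inj_hull_essential.
Qed.

Lemma inj_hull_socle_app j (z : inj_hull j) a :
  (forall a, inj_form z a = chi j a) -> z · a = chi j a *: z.
Proof.
move=> zE; apply: inj_form_inj => b.
by rewrite inj_form_app -[_ *: z]addr0 inj_formD inj_form0 addr0 !zE (chiM B).
Qed.

(** I contains some S_j. Injectivity of I extends its inclusion to a map h from the hull, injective
    because S_j is essential there; injectivity of the hull splits h, and indecomposability of I
    makes it an isomorphism. *)
Lemma indecomposable_injective_hull I : indecomposable I -> injective_module I ->
  exists j, isomorphic I (inj_hull j).
Proof.
move=> [I0 Ii] Iinj.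
have S0 : submodule (0%VS : {vspace I}).
  by apply/submoduleP => v a; rewrite !memv0 => /eqP->; rewrite app0l.
move/eqP: (I0); rewrite -vpick0 -memv0 => /(sub_top B S0)[j [v [_ v0 vj vchi]]].
have {}vchi a : v · a = chi j a *: v.
  by apply/eqP; rewrite -subr_eq0 -memv0.
rewrite memv0 in v0; exists j.
have [z z0 zE] := inj_hull_socle j; have zchi a := inj_hull_socle_app a zE.
have [_ Sact] := simple_module_at B j; set S := simple_module B j in Sact.
have lin (M : rmodule A) (m : M) : exists f : 'Hom(S, M), forall k, f k = (k : K) *: m.
  by apply: (@linfun_exists K S M) => k l l'; rewrite scalerDl scalerA.
have linh (M : rmodule A) (m : M) (f : 'Hom(S, M)) : (forall k, f k = (k : K) *: m) ->
    (forall a, m · a = chi j a *: m) -> is_hom f.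
  move=> fE mchi; apply/is_homP => k a.
  by rewrite Sact !fE appZl mchi !scalerA mulrC.
have [f fE] := lin _ z; have [g gE] := lin _ v.
have fh := linh _ _ _ fE zchi; have gh := linh _ _ _ gE vchi.
have f0 : lker f = 0%VS.
  apply: vspace0P => k; rewrite memv_ker fE scaler_eq0 (negbTE z0) orbF.
  by move/eqP.
have [h hh hf] := Iinj _ _ f g fh f0 gh.
have hz : h z = v.
  move/lfunP/(_ 1): hf; rewrite comp_lfunE fE gE [_ *: z]scale1r => ->.
  by rewrite [_ *: v]scale1r.
have h0 : lker h = 0%VS.
  apply: vspace0P => w; rewrite memv_ker => hw; apply/eqP/negPn/negP => w0.
  have [a E] := inj_hull_essential zE w0.
  by case/eqP: v0; rewrite -hz -E (hom_app hh) (eqP hw) app0l.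
have [r rh rE] := inj_module_injective hh h0 (hom_id (inj_hull j)).
have {}rE w : r (h w) = w by move/lfunP/(_ w): rE; rewrite comp_lfunE id_lfunE.
have sum1 : (limg h + lker r = fullv)%VS.
  apply/vspaceP => w; rewrite memvf -(subrK (h (r w)) w) addrC memv_add //.
    by rewrite memv_img ?memvf.
  by rewrite memv_ker linearB /= rE subrr.
have cap0 : (limg h :&: lker r = 0)%VS.
  apply: vspace0P => w; rewrite memv_cap memv_ker => /andP[/memv_imgP[y _ ->]].
  by rewrite rE => /eqP->; rewrite linear0.
have [h1|r0] := Ii _ _ (limg_submodule hh) (lker_submodule rh) sum1 cap0.
  have : h z \in limg h by rewrite memv_img ?memvf.
  by rewrite h1 memv0 hz (negbTE v0).
exists r; split=> //; apply: limg_full => w; exists (h w); exact: rE.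
Qed.

Lemma inj_hull_inj i j : isomorphic (inj_hull i) (inj_hull j) -> i = j %[mod N].
Proof.
move=> /isomorphicP[f [g [fh gh fK gK]]].
have [z z0 zE] := inj_hull_socle i; have [y y0 yE] := inj_hull_socle j.
have fz0 : f z != 0 by apply: contraNneq z0 => E; rewrite -[z]fK E linear0.
have [a E] := inj_hull_essential yE fz0.
have : y · x i 0%N = y.
  rewrite -E -(hom_app fh) (inj_hull_socle_app _ zE) -(hom_app fh) appZl.
  by rewrite (inj_hull_socle_app _ zE) (chi_path1 B) scale1r.
rewrite (inj_hull_socle_app _ yE) (chi_path B) andbT.
case: eqP => [->//|_] /eqP; rewrite scale0r eq_sym.
by rewrite (negbTE y0).
Qed.

(** Among the projectives with socle S_j the longest one, e_i A, is the hull. Its generator inside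
    the dual of A e_j is the form taking the coefficient of the last nonzero path from i. *)
Lemma inj_hull_projective j : base N c j.+1 -> projective (inj_hull j).
Proof.
move=> /(baseP B)[i0 E0].
pose T l := [exists i : 'I_N, (i + c i == j.+1 %[mod N])%N && (c i == l)].
have TE i : (i + c i = j.+1 %[mod N])%N -> T (c i).
  move=> E; apply/existsP; exists (Ordinal (ltn_pmod i (pb_gt0 B))) => /=.
  have Ei : (i %% N = i %[mod N])%N by rewrite modn_mod.
  by rewrite (path_len_mod B Ei) eqxx andbT -E; apply/eqP; exact: eqmod_addl.
have [||l /existsP[i /andP[/eqP Ei /eqP ci]] lmax] := @ex_maxnP T (\sum_(i < N) c i).
- by exists (c i0); exact: TE.
- by move=> l /existsP[i /andP[_ /eqP<-]]; rewrite (bigD1 i) //=; lia.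
subst l; have C := pb_len_gt0 B i.
have Ej : (i + (c i).-1 = j %[mod N])%N.
  by apply/eqP; rewrite -(eqn_modDr 1) !addn1 -Ei; apply/eqP; congr (_ %% _)%N; move: C; clear; lia.
(* A nonzero path into j of length at least c i would end in a nonzero path of length c i from the
   vertex before i. By [path_len_step] that vertex has length c i + 1, so its projective has the
   same socle and is longer, against the choice of i. *)
have short m l : (m + l = j %[mod N])%N -> (c i <= l)%N -> x m l = 0.
  move=> Em cl; apply/eqP/negPn/negP => xml.
  pose m' := (m + (l - c i))%N.
  have Em' : m'.+1 = i %[mod N].
    apply/eqP; rewrite -(eqn_modDr (c i)) Ei -[j.+1]addn1 -(eqmod_addl 1 Em).
    by apply/eqP; congr (_ %% _)%N; rewrite /m'; move: cl; clear; lia.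
  have := lmax (c m'); have xm' : x m' (c i) != 0.
    apply: contraNneq xml => E; have -> : l = ((l - c i) + c i)%N by move: cl; clear; lia.
    by rewrite -(pathM B) E mulr0.
  rewrite (pb_eq0 B) -ltnNge in xm'.
  have := path_len_step B m'; rewrite (path_len_mod B Em') => le1 lm.
  suff : (c m' <= c i)%N by move: xm'; clear; lia.
  apply: lm; apply: TE; have -> : c m' = (c i).+1 by move: xm' le1; clear; lia.
  by rewrite addnS -addSn -Ei; exact: eqmod_addl.
have [f fE] := linfun_exists (pcoef_linear B i (c i).-1).
have [w wE] : exists w : inj_hull j, inj_form w = f.
  by apply: inj_form_ex => a; rewrite !fE /pcoef_fun (pcoef_idr B) Ej eqxx.
have {f fE}wE b : inj_form w b = pcoef c x i b (c i).-1 by rewrite wE fE.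
have Cl : ((c i).-1 < c i)%N by move: C; clear; lia.
apply: (free_projective (path_idem B i) (u := w)); split.
- apply: inj_form_inj => b.
  by rewrite inj_form_app !wE (pcoef_idl B).
(* The path of length l into j is completed to the last nonzero path from i by one of length c i - 1
   - l; the value of y on the former is the coefficient of the latter in a. *)
- move=> y; pose a := \sum_(l < c i)
    (inj_form y (x (i + ((c i).-1 - l)) l) : K) *: x i ((c i).-1 - l)%N.
  exists a; apply: inj_form_inj => b; rewrite inj_form_app.
  have lin : linear (fun b => inj_form w (a * b)).
    by move=> k b1 b2; rewrite mulrDr -scalerAr linearP.
  have [g gE] := linfun_exists lin.
  rewrite -gE; congr (fun_of_lfun _ b); apply: (linear_path_ext B) => m l.
  rewrite gE wE /a mulr_suml (pcoef_sum B).
  have [Em|Em] := eqVneq ((m + l) %% N)%N (j %% N)%N; last first.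
    rewrite -inj_formP (pb_mul B) addn0 (negbTE Em) linear0 big1 // => l' _.
    rewrite -scalerAl (pb_mul B); case: eqP => E; last by rewrite scaler0 (pcoef0 B).
    rewrite (pcoefZ B) (pcoef_path B) // eqxx /=; case: eqP => [E'|_]; last exact: mulr0.
    case/eqP: Em; rewrite -Ej -(eqmod_addl l E); congr (_ %% _)%N.
    by move: E'; clear; lia.
  have [cl|lc] := leqP (c i) l.
    rewrite (short _ _ Em cl) linear0 big1 // => l' _.
    by rewrite mulr0 (pcoef0 B).
  have Em' : (i + ((c i).-1 - l) = m %[mod N])%N.
    apply/eqP; rewrite -(eqn_modDr l) Em -Ej; apply/eqP; congr (_ %% _)%N; move: lc C; clear; lia.
  rewrite (bigD1 (Ordinal lc)) //= big1 ?addr0.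
    rewrite (path_mod B _ Em') -scalerAl (pb_mul B) Em' eqxx (pcoefZ B).
    have -> : ((c i).-1 - l + l)%N = (c i).-1 by move: lc C; clear; lia.
    by rewrite (pcoef_path B) // !eqxx mulr1.
  move=> l'; rewrite -val_eqE /= => ll'; rewrite -scalerAl (pb_mul B).
  case: eqP => E; last by rewrite scaler0 (pcoef0 B).
  rewrite (pcoefZ B) (pcoef_path B) // eqxx /=; case: eqP => [E'|_]; last exact: mulr0.
  move: ll' E' (ltn_ord l') lc C; clear; lia.
move=> a wa; apply/eqP/negPn/negP => /(path_socle B)[b [k [k0 E]]].
have : inj_form (w · a) b = k.
  rewrite inj_form_app wE -(pcoef_idl B) mulrA E (pcoefZ B) (pcoef_path B) //.
  by rewrite !eqxx mulr1.
by rewrite wa inj_form0 => k00; rewrite -k00 eqxx in k0.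
Qed.

Lemma inj_hull_projectiveE j : projective (inj_hull j) <-> base N c j.+1.
Proof.
split=> [Pp|]; last exact: inj_hull_projective.
have [i [u uF]] := indecomposable_projective_free B (inj_hull_indecomposable j) Pp.
apply/(baseP B); exists i.
have [z z0 zE] := inj_hull_socle j.
have [a E] := inj_hull_essential zE (socle_gen_neq0 B uF).
have : z · x (i + (c i).-1)%N 0%N = z.
  by rewrite -E !(socle_gen_app B) appZl (socle_gen_app B) (chi_path1 B) scale1r.
rewrite (inj_hull_socle_app _ zE) (chi_path B) andbT.
case: eqP => [Ej _|_ /eqP]; last by rewrite scale0r eq_sym (negbTE z0).
rewrite -addn1 (eqmod_addl 1 Ej); have := pb_len_gt0 B i => C.
by congr (_ %% _)%N; move: C; clear; lia.
Qed.

(** The hull of S_(b-1) gets label b, as in [socle_label], so that the projective hulls are those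
    with label in the base. *)
Definition inj_label M b := isomorphic M (inj_hull (b + N.-1)).

Lemma inj_labelling : labelling N inj_label.
Proof.
split=> [M i j E Mi|M i j Mi Mj|M P i Mi Pi|M P i MP Mi|i].
- by apply: iso_trans Mi (inj_hull_mod _); exact: eqmod_addl.
- have /inj_hull_inj/(eqmod_addl 1) := iso_trans (iso_sym Mi) Mj.
  by rewrite !addn1 !(pred_addN B).
- exact: iso_trans Mi (iso_sym Pi).
- exact: iso_trans (iso_sym MP) Mi.
- by exists (inj_hull (i + N.-1)); exact: iso_refl.
Qed.

Lemma inj_labelE M : [/\ indecomposable M, injective_module M & ~ projective M] <->
  exists2 b, predC (base N c) b & inj_label M b.
Proof.
split=> [[Mi Minj Mp]|[b Bb Mb]].
  have [j Mj] := indecomposable_injective_hull Mi Minj; exists j.+1.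
    by apply/negP => /inj_hull_projectiveE/(iso_projective (iso_sym Mj)).
  apply: iso_trans Mj (inj_hull_mod _).
  by rewrite addSn -addnS prednK ?(pb_gt0 B) // modnDr.
have Mb' := iso_sym Mb; split.
- exact: iso_indecomposable Mb' (inj_hull_indecomposable _).
- by apply: iso_injective Mb' _; exact: inj_module_injective.
move=> /(iso_projective Mb)/inj_hull_projectiveE.
by rewrite (base_mod c (pred_addN B b)) (negbTE Bb).
Qed.

Lemma predC_base_mod i j : i = j %[mod N] ->
  predC (base N c) i = predC (base N c) j.
Proof. by move=> E; rewrite /= (base_mod c E). Qed.

Lemma defect_card d : defect A d -> d = #|[pred b : 'I_N | ~~ base N c b]|.
Proof.
by case=> X /(representatives_card (pb_gt0 B) inj_labelling inj_labelE predC_base_mod).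
Qed.

Lemma card_defect : defect A #|[pred b : 'I_N | ~~ base N c b]|.
Proof.
pose s (i : 'I_#|[pred b : 'I_N | ~~ base N c b]|) : 'I_N := enum_val i.
have sinj : injective s by exact: enum_val_inj.
exists (fun i => inj_hull (s i + N.-1)).
apply: (@labels_representatives _ _ _ _ _ _ inj_labelling inj_labelE
    _ (fun i => if insub i is Some i' then s i' else 0%N)).
- by move=> i; rewrite valK; exact: iso_refl.
- by move=> i; rewrite valK /=; exact: (enum_valP i).
- by move=> i j; rewrite !valK !modn_small ?ltn_ord // => /val_inj; exact: sinj.
move=> j Bj; pose j' := Ordinal (ltn_pmod j (pb_gt0 B)).
have Ej : j' = j %[mod N] by rewrite /= modn_mod.
have Bj' : j' \in [pred b : 'I_N | ~~ base N c b] by rewrite inE (base_mod c Ej).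
exists (enum_rank_in Bj' j'); rewrite valK /s enum_rankK_in //.
Qed.

End InjectiveNakayama.

(** * Path algebras of cycles *)

Lemma sum_ord_trunc (V : nmodType) (F : nat -> V) (m M : nat) : (m <= M)%N ->
  (forall l, (m <= l)%N -> F l = 0) -> \sum_(l < M) F l = \sum_(l < m) F l.
Proof.
move=> mM F0; rewrite -!(big_mkord xpredT F) (big_cat_nat (n := m)) //=.
rewrite [X in _ + X]big_nat_cond [X in _ + X]big1 ?addr0 // => l.
by rewrite andbT => /andP[/F0].
Qed.

Section CyclePathCoefficients.
Variables (K : fieldType) (n : nat).
Local Notation KQ := (cycle_path_algebra K n).
Implicit Types (f g : KQ).

Lemma iter_ordS i l : iter l (@ordS n.+1) (inZp i) = inZp (i + l).
Proof.
elim: l => [|l IH]; first by rewrite addn0.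
rewrite iterS IH; apply: val_inj; rewrite /= -addn1 modnDml.
by congr (_ %% _)%N; lia.
Qed.

Lemma cpath_coefM f g i m :
  ((f * g) i)`_m =
  \sum_(l < m.+1) (f i)`_l * (g (iter l (@ordS n.+1) i))`_(m - l).
Proof.
have -> : (f * g) i = cpath_mul_at i g (f i) by rewrite ffunE.
rewrite (@cpath_mul_atE _ _ (maxn (size (f i)) m.+1)) ?leq_maxl //.
rewrite coef_sum; under eq_bigr do rewrite coefZ coefXnM.
rewrite (@sum_ord_trunc _ (fun l => (f i)`_l *
    (if (m < l)%N then 0 else (g (iter l (@ordS n.+1) i))`_(m - l))) m.+1).
- by apply: eq_bigr => l _; rewrite ltnNge -ltnS ltn_ord.
- exact: leq_maxr.
- by move=> l lm; rewrite lm mulr0.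
Qed.

Definition cpath i l : KQ :=
  [ffun j => if j == inZp i :> 'I_n.+1 then 'X^l else 0].

Lemma cpath_mod i j l : i = j %[mod n.+1] -> cpath i l = cpath j l.
Proof.
move=> E; have Z : inZp i = inZp j :> 'I_n.+1 by apply: val_inj.
by rewrite /cpath Z.
Qed.

Lemma cpathM i l j m : cpath i l * cpath j m =
  if (i + l == j %[mod n.+1])%N then cpath i (l + m)%N else 0.
Proof.
apply/ffunP => v; have -> : (cpath i l * cpath j m) v =
    cpath_mul_at v (cpath j m) (cpath i l v) by rewrite ffunE.
rewrite ffunE; case: eqP => [->|vi]; last first.
  rewrite [LHS](linear0 (cpath_mul_at v (cpath j m))).
  by case: ifP => _; rewrite ffunE //; case: eqP.
rewrite -['X^l]mulr1 cpath_mul_at_Xn iter_ordS.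
rewrite /cpath_mul_at size_poly1 big_ord1 coef1 expr0 mul1r scale1r /= ffunE.
have -> : (inZp (i + l) == inZp j :> 'I_n.+1) = (i + l == j %[mod n.+1])%N by [].
by case: ifP => _; rewrite ?mulr0 ffunE // eqxx exprD.
Qed.

Lemma cpath_sum1 : \sum_(i < n.+1) cpath i 0%N = 1.
Proof.
apply/ffunP => v; rewrite sum_ffunE [RHS]ffunE (bigD1 v) //= big1 ?addr0.
  by rewrite ffunE valZpK eqxx.
by move=> i iv; rewrite ffunE valZpK eq_sym (negbTE iv).
Qed.

Lemma cpath_expand f (M : nat) : (forall i, size (f i) <= M)%N ->
  f = \sum_(i < n.+1) \sum_(l < M) (f i)`_l *: cpath i l.
Proof.
move=> fM; apply/ffunP => v; rewrite sum_ffunE (bigD1 v) //= [X in _ + X]big1 ?addr0.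
  rewrite sum_ffunE; apply/polyP => m; rewrite coef_sum.
  have [mM|mM] := ltnP m M; last first.
    rewrite nth_default ?(leq_trans (fM v)) // big1 // => l _.
    rewrite !ffunE valZpK eqxx coefZ coefXn.
    have /negbTE-> : m != l by have := ltn_ord l; lia.
    exact: mulr0.
  rewrite (bigD1 (Ordinal mM)) //= big1 ?addr0.
    by rewrite !ffunE valZpK eqxx coefZ coefXn eqxx mulr1.
  move=> l; rewrite -val_eqE /= => lm; rewrite !ffunE valZpK eqxx coefZ coefXn.
  by rewrite eq_sym (negbTE lm) mulr0.
move=> i iv; rewrite sum_ffunE big1 // => l _.
by rewrite !ffunE valZpK eq_sym (negbTE iv) scaler0.
Qed.

Lemma quotient_path_basis (A : falgType K) (pi : {lrmorphism KQ -> A})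
    (c : nat -> nat) :
  (forall a, exists f, pi f = a) -> (forall i, 0 < c i)%N ->
  (forall i l, (pi (cpath i l) == 0) = (c i <= l)%N) ->
  path_basis fullv 1 n.+1 c (fun i l => pi (cpath i l)).
Proof.
move=> pis c0 cE; split=> //.
- by move=> i l; rewrite (@cpath_mod (i + n.+1) i) // modnDr.
- move=> i l j m; rewrite -rmorphM cpathM; case: ifP => // _.
  exact: rmorph0.
- by rewrite -rmorph_sum cpath_sum1 rmorph1.
- by move=> i l; exact: memvf.
move=> a _; have [f <-] := pis a; exists (fun i l => (f (inZp i))`_l).
pose M := \sum_(i < n.+1) (size (f i) + c i)%N.
have le1 (i : 'I_n.+1) : (size (f i) + c i <= M)%N by rewrite /M (bigD1 i) //= leq_addr.
rewrite {1}(@cpath_expand f M); last by move=> i; apply: leq_trans (le1 i); exact: leq_addr.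
rewrite linear_sum; apply: eq_bigr => i _; rewrite linear_sum valZpK.
rewrite (@sum_ord_trunc _ (fun l => pi ((f i)`_l *: cpath i l)) (c i)).
- by apply: eq_bigr => l _; exact: linearZ.
- by apply: leq_trans (le1 i); exact: leq_addl.
- by move=> l; rewrite -cE => /eqP E; rewrite linearZ /= E scaler0.
Qed.

End CyclePathCoefficients.

(** c i is the least length at which the path from i is killed. It exists because a power of the
    arrow ideal is killed, and it exceeds 1 because the kernel lies in the square of that ideal. *)
Lemma cyclic_nakayama_path_basis (K : fieldType) (A : falgType K) :
  cyclic_nakayama A -> exists (N : nat) (c : nat -> nat) (x : nat -> nat -> A),
    path_basis fullv 1 N c x /\ forall i, (1 < c i)%N.
Proof.
case=> n [pi [pis ker2 [m _ kerm]]].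
have [c cE] : exists c : nat -> nat,
    forall i l, (pi (cpath K n i l) == 0) = (c i <= l)%N.
  apply: (@fun_choice _ _ (fun i d =>
    forall l, (pi (cpath K n i l) == 0) = (d <= l)%N)) => i.
  have ex : exists l, pi (cpath K n i l) == 0.
    exists m; apply/eqP/kerm => j l lm; rewrite ffunE.
    by case: ifP; rewrite ?coef0 // coefXn ltn_eqF.
  case: (ex_minnP ex) => d /eqP d0 dmin; exists d => l.
  apply/idP/idP => [/dmin//|dl].
  have -> : cpath K n i l = cpath K n i d * cpath K n (i + d) (l - d).
    by rewrite cpathM eqxx subnKC.
  by rewrite rmorphM /= d0 mul0r.
have c2 i : (1 < c i)%N.
  rewrite ltnNge -cE; apply/negP => /eqP/ker2/(_ (inZp i) 1%N isT)/eqP.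
  by rewrite ffunE eqxx coefXn oner_eq0.
exists n.+1, c, (fun i l => pi (cpath K n i l)); split=> //.
apply: quotient_path_basis => // i; exact: ltnW.
Qed.

(** * Truncated path algebras *)

(** [ld_step] makes the span of the paths to be killed stable under prepending arrows, hence a
    two-sided ideal; [ld_gt1] places it in the square of the arrow ideal. *)
Record length_data (n : nat) := LengthData {
  ld_len :> 'I_n.+1 -> nat;
  ld_gt1 : forall i, (1 < ld_len i)%N;
  ld_step : forall i, (ld_len i <= (ld_len (ordS i)).+1)%N }.

(** The quotient of KQ by the paths starting at i of length at least c i. *)
Definition truncated_algebra (K : fieldType) (n : nat) (c : length_data n) : Type :=
  {ffun {i : 'I_n.+1 & 'I_(c i)} -> K^o}.

Section TruncatedAlgebra.
Variables (K : fieldType) (n : nat) (c : length_data n).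
Local Notation KQ := (cycle_path_algebra K n).
Local Notation T := (truncated_algebra K c).

HB.instance Definition _ := Vector.copy T {ffun {i : 'I_n.+1 & 'I_(c i)} -> K^o}.

Definition truncate (f : KQ) : T := 
  [ffun p : {i : 'I_n.+1 & 'I_(c i)} => (f (tag p))`_(tagged p : 'I_(c (tag p)))].

Definition untruncate (w : T) : KQ :=
  [ffun i => \sum_(l < c i) (w (Tagged (fun i => 'I_(c i)) l) : K) *: 'X^l].

Lemma ld_iter i l : (c i <= c (iter l (@ordS n.+1) i) + l)%N.
Proof.
elim: l => [|l IH]; first by rewrite addn0.
by rewrite iterS; have := ld_step c (iter l (@ordS n.+1) i); lia.
Qed.

Lemma truncate_linear : linear truncate.
Proof.
by move=> k f g; apply/ffunP => p; rewrite !ffunE coefD coefZ.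
Qed.

HB.instance Definition _ :=
  GRing.isLinear.Build K KQ T _ truncate truncate_linear.

Lemma untruncate_linear : linear untruncate.
Proof.
move=> k v w; apply/ffunP => i; rewrite !ffunE scaler_sumr -big_split /=.
by apply: eq_bigr => l _; rewrite !ffunE scalerDl scalerA.
Qed.

HB.instance Definition _ :=
  GRing.isLinear.Build K T KQ _ untruncate untruncate_linear.

Lemma untruncateK w : truncate (untruncate w) = w.
Proof.
apply/ffunP => -[i l]; rewrite !ffunE /= coef_sum (bigD1 l) //= big1 ?addr0.
  by rewrite coefZ coefXn eqxx mulr1.
by move=> j; rewrite -val_eqE /= => jl; rewrite coefZ coefXn eq_sym (negbTE jl) mulr0.
Qed.

Lemma truncate_eq0P f :
  truncate f = 0 <-> forall i l, (l < c i)%N -> (f i)`_l = 0.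
Proof.
split=> [/ffunP E i l lc|f0]; last by apply/ffunP => -[i l]; rewrite !ffunE /= f0.
by have := E (Tagged (fun i => 'I_(c i)) (Ordinal lc)); rewrite !ffunE.
Qed.

Lemma truncate_mul0l f g : truncate f = 0 -> truncate (f * g) = 0.
Proof.
move/truncate_eq0P => f0; apply/truncate_eq0P => i m mc.
rewrite cpath_coefM big1 // => l _; rewrite f0 ?mul0r //.
by have := ltn_ord l; lia.
Qed.

Lemma truncate_mul0r f g : truncate g = 0 -> truncate (f * g) = 0.
Proof.
move/truncate_eq0P => g0; apply/truncate_eq0P => i m mc.
rewrite cpath_coefM big1 // => l _; rewrite g0 ?mulr0 //.
by have := ltn_ord l; have := ld_iter i l; lia.
Qed.

Definition trunc_mul (v w : T) : T := truncate (untruncate v * untruncate w).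

(** Replacing a factor by its truncation changes the product by an element of the ideal only. The
    ring axioms are then transported along the surjection [truncate]. *)
Lemma truncateM f g : truncate (f * g) = trunc_mul (truncate f) (truncate g).
Proof.
have kill h : truncate (h - untruncate (truncate h)) = 0.
  by rewrite linearB /= untruncateK subrr.
rewrite /trunc_mul; set f' := untruncate _; set g' := untruncate _.
have -> : f * g = f' * g' + ((f - f') * g + f' * (g - g')).
  by rewrite mulrBl mulrBr subrKA addrC subrK.
by rewrite !linearD /= (truncate_mul0l g (kill f)) (truncate_mul0r f' (kill g)) !addr0.
Qed.

Lemma trunc_mulA : associative trunc_mul.
Proof.
move=> u v w; rewrite -[u]untruncateK -[v]untruncateK -[w]untruncateK.
by rewrite -!truncateM mulrA.
Qed.

Lemma trunc_mul1l : left_id (truncate 1) trunc_mul.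
Proof. by move=> u; rewrite -[u]untruncateK -truncateM mul1r. Qed.

Lemma trunc_mul1r : right_id (truncate 1) trunc_mul.
Proof. by move=> u; rewrite -[u]untruncateK -truncateM mulr1. Qed.

Lemma trunc_mulDl : left_distributive trunc_mul +%R.
Proof. by move=> u v w; rewrite /trunc_mul linearD mulrDl linearD. Qed.

Lemma trunc_mulDr : right_distributive trunc_mul +%R.
Proof. by move=> u v w; rewrite /trunc_mul linearD mulrDr linearD. Qed.

Lemma trunc_one_neq0 : truncate 1 != 0.
Proof.
apply/eqP => /truncate_eq0P/(_ ord0 0%N (ltnW (ld_gt1 c _)))/eqP.
by rewrite ffunE coef1 oner_eq0.
Qed.

HB.instance Definition _ := GRing.Zmodule_isNzRing.Build T
  trunc_mulA trunc_mul1l trunc_mul1r trunc_mulDl trunc_mulDr trunc_one_neq0.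

Lemma trunc_scaleAl (k : K) (u v : T) : k *: (u * v) = (k *: u) * v.
Proof.
rewrite -[u * v]/(trunc_mul u v) -[RHS]/(trunc_mul _ _) /trunc_mul.
by rewrite linearZ -scalerAl [RHS]linearZ.
Qed.

HB.instance Definition _ := GRing.Lmodule_isLalgebra.Build K T trunc_scaleAl.

Lemma trunc_scaleAr (k : K) (u v : T) : k *: (u * v) = u * (k *: v).
Proof.
rewrite -[u * v]/(trunc_mul u v) -[RHS]/(trunc_mul _ _) /trunc_mul.
by rewrite linearZ -scalerAr [RHS]linearZ.
Qed.

HB.instance Definition _ := GRing.Lalgebra_isAlgebra.Build K T trunc_scaleAr.
HB.instance Definition _ := Algebra_isFalgebra.Build K T.

Lemma truncate_monoid_morphism : monoid_morphism truncate.
Proof. by split=> // f g; rewrite truncateM. Qed.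

HB.instance Definition _ :=
  GRing.isMonoidMorphism.Build KQ T truncate truncate_monoid_morphism.

Lemma truncated_algebra_nakayama : cyclic_nakayama (truncated_algebra K c).
Proof.
exists n, truncate; split.
- by move=> w; exists (untruncate w); exact: untruncateK.
- move=> f /truncate_eq0P f0 i l l2; apply: f0; exact: leq_trans l2 (ld_gt1 c i).
exists (\sum_i c i)%N.
  rewrite (bigD1 ord0) //=; have := ld_gt1 c ord0; lia.
move=> f f0; apply/truncate_eq0P => i l lc; apply: f0.
by rewrite (bigD1 i) //=; lia.
Qed.

Lemma truncated_algebra_path_basis :
  exists x, path_basis fullv (1 : truncated_algebra K c) n.+1 (fun i => c (inZp i)) x.
Proof.
exists (fun i l => truncate (cpath K n i l)); apply: quotient_path_basis.
- by move=> w; exists (untruncate w); exact: untruncateK.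
- by move=> i; exact: ltnW (ld_gt1 c _).
move=> i l; apply/eqP/idP => [/truncate_eq0P E|lc].
  rewrite leqNgt; apply/negP => /E/eqP.
  by rewrite ffunE eqxx coefXn eqxx oner_eq0.
apply/truncate_eq0P => j m mc; rewrite ffunE.
case: eqP => [jE|_]; last exact: coef0.
rewrite coefXn; have /negbTE-> // : m != l.
by move: mc lc; rewrite jE; clear; lia.
Qed.

End TruncatedAlgebra.

(** * Corner algebras *)

Local Close Scope ring_scope.

(** b increasingly enumerates the N-periodic set P from b 0 on; m is the number
    of elements of P modulo N. *)
Record enumeration (P : pred nat) (N m : nat) (b : nat -> nat) : Prop := Enumeration {
  en_gt0 : (0 < m)%N;
  en_ltS : forall i, (b i < b i.+1)%N;
  en_in : forall i, P (b i);
  en_surj : forall j, (b 0 <= j)%N -> P j -> exists i, j = b i;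
  en_period : forall i, b (i + m)%N = (b i + N)%N }.

(** The enumeration iterates the successor function [nx] of P. This function commutes with
    translation by N, so m is the index at which [b 0 + N] is reached. *)
Lemma enumeration_exists (P : pred nat) N : (0 < N)%N ->
  (forall i, P (i + N)%N = P i) -> (exists i, P i) ->
  exists m b, enumeration P N m b.
Proof.
move=> N0 PN [i0 P0].
have PqN q i : P (i + q * N)%N = P i.
  elim: q => [|q IH]; first by rewrite addn0.
  by rewrite mulSn addnCA addnC PN.
have [nx nxP] : exists nx : nat -> nat, forall j, [/\ (j < nx j)%N, P (nx j)
    & forall k, (j < k)%N -> P k -> (nx j <= k)%N].
  apply: (@fun_choice _ _ (fun j n => [/\ (j < n)%N, P n
    & forall k, (j < k)%N -> P k -> (n <= k)%N])) => j.
  have ex : exists k, (j < k)%N && P k.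
    exists (i0 + j.+1 * N)%N; rewrite PqN P0 andbT.
    by rewrite (leq_trans _ (leq_addl _ _)) // leq_pmulr.
  by case: (ex_minnP ex) => k /andP[jk Pk] kmin; exists k; split=> // l jl Pl; rewrite kmin ?jl.
pose b i := iter i nx i0.
have bS i : b i.+1 = nx (b i) by [].
have bP i : P (b i) by case: i => [//|i]; rewrite bS; case: (nxP (b i)).
have blt i : (b i < b i.+1)%N by rewrite bS; case: (nxP (b i)).
have bsurj j : (b 0 <= j)%N -> P j -> exists i, j = b i.
  move=> bj Pj.
  have [i [bi ib]] : exists i, (b i <= j)%N /\ (j < b i.+1)%N.
    have ex : exists i, (b i > j)%N.
      exists j.+1; elim: (j.+1) => [//|k IH].
      by apply: leq_ltn_trans IH (blt k).
    case: (ex_minnP ex) => -[|i]; first by rewrite ltnNge bj.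
    move=> ji imin; exists i; split=> //; rewrite leqNgt.
    by apply/negP => /imin; rewrite ltnn.
  exists i; apply/eqP; rewrite eqn_leq bi andbT leqNgt; apply/negP => lt.
  have [_ _ nxmin] := nxP (b i); have := nxmin j lt Pj.
  by rewrite -bS leqNgt ib.
have [m mE] : exists m, (b 0 + N)%N = b m.
  by apply: bsurj; [exact: leq_addr | rewrite PN; exact: bP].
exists m, b; split=> //.
  by case: m mE => // /eqP; rewrite -[X in _ == X]addn0 eqn_add2l; case: N N0 {PN PqN}.
elim=> [|i IH]; first by rewrite add0n -mE.
rewrite addSn !bS IH; have [n1 n2 n3] := nxP (b i).
have [n1' n2' n3'] := nxP (b i + N)%N.
apply/eqP; rewrite eqn_leq n3' ?PN ?ltn_add2r //=.
have n4 : nx (b i + N) = nx (b i + N) - N + N by lia.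
rewrite n4 leq_add2r n3 //; first by lia.
by rewrite -PN -n4.
Qed.

Section EnumerationTheory.
Variables (P : pred nat) (N m : nat) (b : nat -> nat).
Hypothesis N0 : 0 < N.
Hypothesis P_mod : forall i j, i = j %[mod N] -> P i = P j.
Hypothesis Eb : enumeration P N m b.

Lemma en_leq i j : (b i <= b j) = (i <= j).
Proof. exact: (leq_mono (homo_ltn ltn_trans (en_ltS Eb))). Qed.

Lemma en_inj i j : b i = b j -> i = j.
Proof. by move=> E; apply/eqP; rewrite eqn_leq -(en_leq i j) -(en_leq j i) E leqnn. Qed.

Lemma en_period_mul q i : b (i + q * m) = b i + q * N.
Proof.
elim: q => [|q IH]; first by rewrite !mul0n !addn0.
by rewrite !mulSn (addnCA i) (addnC m) (en_period Eb) IH -addnA (addnC N).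
Qed.

Lemma en_mod i j : (b i == b j %[mod N]) = (i == j %[mod m]).
Proof.
wlog ij : i j / i <= j.
  by move=> H; case/orP: (leq_total i j) => /H // E; rewrite eq_sym E eq_sym.
apply/idP/idP.
  rewrite eq_sym eqn_mod_dvd ?en_leq // => /dvdnP[q E].
  have : b j = b (i + q * m) by rewrite en_period_mul -E subnKC // en_leq.
  by move/en_inj->; rewrite addnC modnMDl.
rewrite eq_sym eqn_mod_dvd // => /dvdnP[q E].
have -> : j = i + q * m by rewrite -E subnKC.
by rewrite en_period_mul addnC modnMDl.
Qed.

Lemma en_lift j : P j -> exists i, b i = j %[mod N].
Proof.
move=> Pj; have E : b 0 * N + j = j %[mod N] by rewrite modnMDl.
have [||i Ei] := en_surj Eb (j := b 0 * N + j); last by exists i; rewrite -Ei.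
  by apply: leq_trans (leq_addr _ _); rewrite leq_pmulr.
by rewrite (P_mod E).
Qed.

Lemma en_shift r : enumeration P N m (fun i => b (r + i)).
Proof.
split=> [|i|i|j|i]; first exact: (en_gt0 Eb).
- by rewrite addnS; exact: (en_ltS Eb).
- exact: (en_in Eb).
- move=> bj Pj; have b0 : b 0 <= b (r + 0) by rewrite en_leq.
  have [i E] := en_surj Eb (leq_trans b0 bj) Pj.
  by exists (i - r); rewrite subnKC // -en_leq -E -[r]addn0.
by rewrite addnA (en_period Eb).
Qed.

Definition en_ord (i : 'I_m) : 'I_N := Ordinal (ltn_pmod (b i) N0).

Lemma en_ord_inj : injective en_ord.
Proof.
move=> i j /(congr1 val)/= /eqP; rewrite en_mod !modn_small // => /eqP.
exact: val_inj.
Qed.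

Lemma en_ord_in i : P (en_ord i).
Proof. by rewrite (P_mod (j := b i)) ?(en_in Eb) //= modn_mod. Qed.

Lemma en_ord_surj (j : 'I_N) : P j -> exists i, en_ord i = j.
Proof.
move/en_lift=> [i E]; have im : i %% m < m by rewrite ltn_mod (en_gt0 Eb).
exists (Ordinal im); apply: val_inj => /=.
rewrite -[RHS](modn_small (ltn_ord j)) -E; apply/eqP; rewrite en_mod.
by rewrite modn_mod.
Qed.

Lemma enumeration_card : #|[pred j : 'I_N | ~~ P j]| = N - m.
Proof.
have cP : #|[pred j : 'I_N | P j]| = m.
  rewrite -[RHS]card_ord -(card_imset predT en_ord_inj); apply: eq_card => j.
  rewrite inE; apply/idP/imsetP => [/en_ord_surj[i <-]|[i _ ->]]; last exact: en_ord_in.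
  by exists i.
have E := cardC [pred j : 'I_N | P j]; rewrite cP card_ord in E.
by rewrite -[X in X - m]E addKn; apply: eq_card => j; rewrite !inE.
Qed.

End EnumerationTheory.

Local Open Scope ring_scope.

Section Corner.
Variables (K : fieldType) (A : falgType K).
Variables (N : nat) (c : nat -> nat) (x : nat -> nat -> A).
Hypothesis B : path_basis fullv 1 N c x.
Variables (m : nat) (b c' : nat -> nat).
Hypothesis Eb : enumeration (base N c) N m b.
Hypothesis c'E : forall i, b (i + c' i)%N = (b i + c (b i))%N.

Let N0 : (0 < N)%N := pb_gt0 B.
Let e := base_idem N c x.
Let b_leq := en_leq Eb.

Definition corner : {vspace A} := limg (amull e \o amulr e)%VF.

Lemma cornerP a : reflect (e * a * e = a) (a \in corner).
Proof.
have ee : e * e = e := base_idem_idem B.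
apply: (iffP memv_imgP) => [[d _ ->]|<-].
  by rewrite comp_lfunE !lfunE /= !mulrA ee -!mulrA ee.
by exists a; rewrite ?memvf // comp_lfunE !lfunE /= mulrA.
Qed.

(** The path of A from the i-th to the (i+l)-th base vertex: length in the corner counts base
    vertices. *)
Definition corner_path i l : A := x (b i) (b (i + l) - b i)%N.

(** By [c'E], the path from [b i] to [b (i + l)] vanishes iff [b (i + l)] reaches [b (i + c' i)],
    that is, iff l reaches c' i. *)
Lemma corner_path_basis : path_basis corner e m c' corner_path.
Proof.
have m0 := en_gt0 Eb.
have eq0 i l : (corner_path i l == 0) = (c' i <= l)%N.
  rewrite (pb_eq0 B) leq_subRL ?b_leq ?leq_addr // -c'E b_leq.
  by rewrite leq_add2l.
have period i l : corner_path (i + m) l = corner_path i l.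
  rewrite /corner_path -addnA (addnC m) addnA !(en_period Eb) subnDr.
  exact: (pb_period B).
have pmod i j l : i = j %[mod m] -> corner_path i l = corner_path j l.
  have D q k : corner_path (k + q * m) l = corner_path k l.
    elim: q k => [|q IH] k; first by rewrite mul0n addn0.
    by rewrite mulSn addnA IH period.
  by move=> E; rewrite (divn_eq i m) (divn_eq j m) E ![(_ * m + _)%N]addnC !D.
have mulE i l q : corner_path i l * corner_path (i + l) q = corner_path i (l + q).
  have le1 : (b i <= b (i + l))%N by rewrite b_leq leq_addr.
  have le2 : (b (i + l) <= b (i + l + q))%N by rewrite b_leq leq_addr.
  rewrite /corner_path (pathMeq B) ?subnKC // addnA; congr (x _ _).
  by move: le1 le2; clear; lia.
have cin i l : corner_path i l \in corner.
  apply/cornerP; rewrite (base_idem_path B) (en_in Eb) (path_base_idem B).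
  by rewrite subnKC ?b_leq ?leq_addr // (en_in Eb).
split=> //.
- move=> i; have := c'E i; case: (c' i) => // /eqP; rewrite addn0 -[X in X == _]addn0 eqn_add2l.
  by have := pb_len_gt0 B (b i); case: (c _).
- move=> i l j q; case: eqP => [E|/eqP E]; first by rewrite -(pmod _ _ _ E) mulE.
  rewrite (pb_mul B) ifN // subnKC ?b_leq ?leq_addr //.
  by rewrite (en_mod Eb).
- rewrite [RHS](@base_idem_labels _ _ _ _ x _ (@en_ord N m b N0)).
  + apply: eq_bigr => i _; rewrite /corner_path addn0 subnn.
    by apply: (path_mod B); rewrite /= modn_mod.
  + exact: (en_ord_inj Eb).
  + by move=> i; apply: (en_ord_in N0 (@base_mod _ _) Eb).
  + by move=> j; apply: (en_ord_surj N0 (@base_mod _ _) Eb).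
move=> a /cornerP <-.
(* Being a combination of corner paths is stable under sums and multiples, so it suffices to treat e
   p e for the paths p of A. *)
pose R (a : A) := exists k : nat -> nat -> K,
  a = \sum_(i < m) \sum_(l < c' i) k i l *: corner_path i l.
have R0 : R 0.
  by exists (fun _ _ => 0); rewrite big1 // => i _; rewrite big1 // => l _; rewrite scale0r.
have RD u v : R u -> R v -> R (u + v).
  move=> [k ->] [k' ->]; exists (fun i l => k i l + k' i l).
  rewrite -big_split; apply: eq_bigr => i _; rewrite -big_split.
  by apply: eq_bigr => l _; rewrite scalerDl.
have RZ s u : R u -> R (s *: u).
  move=> [k ->]; exists (fun i l => s * k i l).
  rewrite scaler_sumr; apply: eq_bigr => i _; rewrite scaler_sumr.
  by apply: eq_bigr => l _; rewrite scalerA.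
have Rp i l : R (corner_path i l).
  have [cl|lc] := leqP (c' i) l.
    by move: cl; rewrite -eq0 => /eqP->.
  have Ei : (i %% m)%N = i %[mod m] by rewrite modn_mod.
  have im : (i %% m < m)%N by rewrite ltn_mod.
  have lc' : (l < c' (i %% m)%N)%N.
    by rewrite ltnNge -eq0 (pmod _ _ _ Ei) eq0 -ltnNge.
  exists (fun i' l' => ((i' == i %% m) && (l' == l))%:R)%N.
  rewrite (bigD1 (Ordinal im)) //= [X in _ + X]big1 ?addr0 => [|i'].
    rewrite (bigD1 (Ordinal lc')) //= big1 ?addr0 => [|l'].
      by rewrite !eqxx scale1r (pmod _ _ _ Ei).
    by rewrite -val_eqE /= => /negbTE->; rewrite andbF scale0r.
  rewrite -val_eqE /= => /negbTE ii'; rewrite big1 // => l' _.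
  by rewrite ii' scale0r.
have [L LE] : exists L : 'End(A), forall v, L v = e * v * e.
  by exists (amull e \o amulr e)%VF => v; rewrite comp_lfunE !lfunE /= mulrA.
rewrite -LE [a](path_expand B) linear_sum.
apply: (big_ind R) => // i _; rewrite linear_sum.
apply: (big_ind R) => // l _; rewrite linearZ; apply: RZ; rewrite /= LE.
rewrite (base_idem_path B); case: ifP => [Bi|_]; last by rewrite mul0r.
rewrite (path_base_idem B); case: ifP => [Bil|_] //.
have le0 : (b 0%N <= i + b 0%N * N)%N by apply: leq_trans (leq_addl _ _); rewrite leq_pmulr.
have Em (k : nat) : (k + b 0%N * N)%N = k %[mod N] by rewrite addnC modnMDl.
have [|p pE] := en_surj Eb le0; first by rewrite (base_mod c (Em i)).
have [||q qE] := en_surj Eb (j := (i + l + b 0%N * N)%N).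
- by apply: leq_trans le0 _; rewrite leq_add2r leq_addr.
- by rewrite (base_mod c (Em _)).
have pq : (p <= q)%N by rewrite -b_leq -pE -qE leq_add2r leq_addr.
suff -> : x i l = corner_path p (q - p) by [].
rewrite /corner_path subnKC // -pE -qE -(path_mod B _ (Em i)); congr (x _ _).
by clear; lia.
Qed.

End Corner.

Lemma corner_algebra_path_basis (K : fieldType) (A T : falgType K) (e : A)
    (U : {vspace A}) N c y :
  (forall a, e * a * e = a <-> a \in U) -> path_basis U e N c y ->
  corner_algebra e T -> exists z, path_basis fullv (1 : T) N c z.
Proof.
move=> UE By [psi [psi1 psiM psi_inj psi_im]].
have [z zE] : exists z : nat * nat -> T, forall p, psi (z p) = y p.1 p.2.
  apply: (@fun_choice _ _ (fun p t => psi t = y p.1 p.2)) => p.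
  by apply/psi_im/UE; exact: (pb_in By).
exists (fun i l => z (i, l)); split.
- exact: (pb_gt0 By).
- exact: (pb_len_gt0 By).
- by move=> i l; apply: psi_inj; rewrite !zE; exact: (pb_period By).
- move=> i l j m; apply: psi_inj; rewrite psiM !zE /= (pb_mul By).
  by case: ifP => _; rewrite ?zE ?linear0.
- move=> i l; rewrite -(pb_eq0 By) -[y i l]/(y (i, l).1 (i, l).2) -zE.
  by rewrite -(inj_eq psi_inj) linear0.
- apply: psi_inj; rewrite psi1 linear_sum -(pb_one By).
  by apply: eq_bigr => i _; rewrite /= zE.
- by move=> i l; exact: memvf.
move=> t _; have [|k kE] := pb_span By (a := psi t).
  by apply/UE/psi_im; exists t.
exists k; apply: psi_inj; rewrite kE linear_sum; apply: eq_bigr => i _.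
by rewrite linear_sum; apply: eq_bigr => l _; rewrite linearZ /= zE.
Qed.

(** Sending paths to paths is multiplicative because products of paths depend only on N and c. This
    is how the Kupisch series determines the algebra. *)
Lemma path_basis_corner_algebra (K : fieldType) (A T : falgType K) (e : A)
    (U : {vspace A}) N c y z :
  (forall a, e * a * e = a <-> a \in U) -> path_basis U e N c y ->
  path_basis fullv (1 : T) N c z -> corner_algebra e T.
Proof.
move=> UE By Bz.
have lin : linear (fun t : T => \sum_(i < N) \sum_(l < c i) pcoef c z i t l *: y i l).
  move=> k s t; rewrite scaler_sumr -big_split; apply: eq_bigr => i _ /=.
  rewrite scaler_sumr -big_split; apply: eq_bigr => l _ /=.
  by rewrite (pcoefD Bz) (pcoefZ Bz) scalerDl scalerA.
have [psi psiE] := linfun_exists lin.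
have psiz i l : psi (z i l) = y i l.
  have [cl|lc] := leqP (c i) l.
    by rewrite (path_ge Bz cl) (path_ge By cl) linear0.
  have iN : (i %% N < N)%N by rewrite ltn_mod (pb_gt0 By).
  have Ei : (i %% N)%N = i %[mod N] by rewrite modn_mod.
  have lc' : (l < c (i %% N)%N)%N by rewrite (path_len_mod By Ei).
  rewrite psiE (bigD1 (Ordinal iN)) //= [X in _ + X]big1 ?addr0 => [|i'].
    rewrite (bigD1 (Ordinal lc')) //= big1 ?addr0 => [|l'].
      by rewrite (pcoef_path Bz) // Ei !eqxx scale1r (path_mod By _ Ei).
    rewrite -val_eqE /= => /negbTE ll; rewrite (pcoef_path Bz) // ll.
    by rewrite andbF scale0r.
  rewrite -val_eqE /= => /negbTE ii; rewrite big1 // => l' _.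
  by rewrite (pcoef_path Bz) // [(i' %% N)%N]modn_small // ii scale0r.
have psiM a b : psi (a * b) = psi a * psi b.
  suff E : forall b, (psi \o amulr b = amulr (psi b) \o psi)%VF.
    by have /lfunP/(_ a) := E b; rewrite !comp_lfunE !lfunE.
  move=> {a}b; apply: (linear_path_ext Bz) => i l.
  rewrite !comp_lfunE !lfunE /=.
  suff E : (psi \o amull (z i l) = amull (psi (z i l)) \o psi)%VF.
    by have /lfunP/(_ b) := E; rewrite !comp_lfunE !lfunE.
  apply: (linear_path_ext Bz) => j m; rewrite !comp_lfunE !lfunE /= !psiz.
  rewrite (pb_mul Bz) (pb_mul By); case: ifP => _; last exact: linear0.
  exact: psiz.
exists psi; split=> //.
- rewrite -(pb_one Bz) -(pb_one By) linear_sum.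
  by apply: eq_bigr => i _; exact: psiz.
- move=> s t E; apply/eqP; rewrite -subr_eq0; apply/eqP.
  have : psi (s - t) = 0 by rewrite linearB /= E subrr.
  rewrite psiE => /(path_free By (k := fun i l => pcoef c z i (s - t) l)) E0.
  rewrite [LHS](path_expand Bz) big1 // => i _; rewrite big1 // => l _.
  by rewrite E0 ?scale0r.
move=> a; split=> [[t <-]|/UE aU].
  apply/UE; rewrite psiE; apply: memv_suml => i _; apply: memv_suml => l _.
  by rewrite memvZ // (pb_in By).
have [k ->] := pb_span By aU.
exists (\sum_(i < N) \sum_(l < c i) k i l *: z i l).
rewrite linear_sum; apply: eq_bigr => i _; rewrite linear_sum.
by apply: eq_bigr => l _; rewrite linearZ /= psiz.
Qed.

Local Close Scope ring_scope.

(** * Combinatorics of the Kupisch function *)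

Lemma size_flatten_nseq (T : Type) k (s : seq T) :
  size (flatten (nseq k s)) = k * size s.
Proof. by elim: k => //= k IH; rewrite size_cat IH mulSn. Qed.

Lemma nth_flatten_nseq (T : Type) (x0 : T) k s i : i < k * size s ->
  nth x0 (flatten (nseq k s)) i = nth x0 s (i %% size s).
Proof.
elim: k i => //= k IH i; rewrite mulSn nth_cat => ik.
have [lt|ge] := ltnP i (size s); first by rewrite modn_small.
rewrite IH; last by rewrite ltn_subLR.
by rewrite -[in RHS](subnK ge) modnDr.
Qed.

Lemma all_flatten_nseq (T : Type) (p : pred T) k s :
  all p s -> all p (flatten (nseq k s)).
Proof. by move=> ps; elim: k => //= k IH; rewrite all_cat ps. Qed.

Lemma eqmod_lift a d N : a = d %[mod N] -> exists s t, a + s * N = d + t * N.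
Proof.
move=> E; exists (d %/ N), (a %/ N).
have := divn_eq a N; have := divn_eq d N; rewrite E.
move: (a %/ N * N) (d %/ N * N) (d %% N) => p q r; clear; lia.
Qed.

Section Combinatorics.
Variables (k N : nat) (c b : nat -> nat) (P : pred nat).
Hypothesis k0 : 0 < k.
Hypothesis N3 : N = 3 * k.
Hypothesis c_mod : forall i j, i = j %[mod N] -> c i = c j.
Hypothesis c_step : forall i, c i <= (c i.+1).+1.
Hypothesis PE : forall j, P j -> exists i, i + c i = j %[mod N].
Hypothesis Eb : enumeration P N (k * 2) b.
(** The offsets are the lengths of Theta: 2 at the even vertices, and 3 at the odd ones, where 4 = 1
    + 3. *)
Hypothesis b_even : forall j, b (j.*2 + 2) = b j.*2 + c (b j.*2).
Hypothesis b_odd : forall j, b (j.*2 + 4) = b (j.*2 + 1) + c (b (j.*2 + 1)).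

Let end_mono i j : i <= j -> i + c i <= j + c j.
Proof.
apply: (homo_leq (f := fun i => i + c i) leqnn leq_trans) => {}i.
by have := c_step i; lia.
Qed.

Let c_per i t : c (i + t * N) = c i.
Proof. by apply: c_mod; rewrite addnC modnMDl. Qed.

(** The base maps onto its even-numbered vertices, and monotonicity locates the
    preimage y of an odd-numbered one. *)
Lemma odd_preimage j : exists y,
  [/\ b j.*2 < y, y < b (j.*2 + 1) & y + c y = b (j.*2 + 3)].
Proof.
have [y0 /eqmod_lift[s [t E]]] := PE (en_in Eb (j.*2 + 3)).
(* The preimage is known only modulo N; shifting both sides gives an equation of naturals in block
   i, which is shifted back to block j at the end. *)
pose y := y0 + s * N; pose i := j + t * k.
have bt p : b (j.*2 + p) + t * N = b (i.*2 + p).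
  rewrite -(en_period_mul Eb); congr b; rewrite /i doubleD; lia.
have yE : y + c y = b (i.*2 + 3) by rewrite -bt /y c_per -E; lia.
have lt p q : p < q -> b (i.*2 + p) < b (i.*2 + q).
  by move=> pq; rewrite ltnNge (en_leq Eb) -ltnNge ltn_add2l.
have ly : b i.*2 < y.
  rewrite ltnNge; apply/negP => /end_mono; rewrite yE -b_even leqNgt.
  by rewrite (lt 2 3).
have yl : y < b (i.*2 + 1).
  rewrite ltnNge; apply/negP => /end_mono; rewrite yE -b_odd leqNgt.
  by rewrite (lt 3 4).
have b0 := bt 0; rewrite !addn0 in b0.
have b1 := bt 1; have b3 := bt 3.
exists (y - t * N).
have tN : t * N <= y by lia.
have cy : c (y - t * N) = c y by rewrite -(c_per _ t) subnK.
by split; [lia|lia|rewrite cy; lia].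
Qed.

(** By [odd_preimage] a vertex lies strictly between b (2j) and b (2j+1), so each of the k blocks
    takes up at least 3 vertices. As N = 3k, each takes up exactly 3. *)
Lemma base_positions j : b j.*2 = b 0 + 3 * j /\ b (j.*2 + 1) = b j.*2 + 2.
Proof.
have lt i : b i < b i.+1 := en_ltS Eb i.
have ge2 i : b i.*2 + 2 <= b (i.*2 + 1).
  by have [y [y1 y2 _]] := odd_preimage i; lia.
have ge3 i : b i.*2 + 3 <= b i.+1.*2.
  have -> : i.+1.*2 = (i.*2 + 1).+1 by lia.
  by have := ge2 i; have := lt (i.*2 + 1); lia.
have ge i s : b i.*2 + 3 * s <= b (i + s).*2.
  elim: s => [|s IH]; first by rewrite muln0 !addn0.
  by have := ge3 (i + s); rewrite (addnS i); lia.
have eq3 i : b i.+1.*2 = b i.*2 + 3.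
  (* The other k - 1 blocks of one turn take up at least 3(k - 1) vertices, which leaves at most 3
     for block i. *)
  have := ge i.+1 k.-1; have -> : i.+1 + k.-1 = i + k by lia.
  have -> : (i + k).*2 = i.*2 + k * 2 by lia.
  by rewrite (en_period Eb) N3; have := ge3 i; lia.
have e0 : b j.*2 = b 0 + 3 * j.
  by elim: j => [|j IH]; [rewrite muln0 addn0|rewrite eq3 IH; lia].
split=> //; have := ge2 j; have := eq3 j; have := lt (j.*2 + 1).
have -> : j.+1.*2 = (j.*2 + 1).+1 by lia.
by lia.
Qed.

(** Block j consists of b (2j), the preimage y and b (2j+1). Their values under f are b (2j+2), b
    (2j+3) and b (2j+4), at distances 3, 4 and 4. *)
Lemma base_lengths i : c (b 0 + i) = 3 + (i %% 3 != 0).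
Proof.
have [j [r [r3 ->]]] : exists j r, r < 3 /\ i = 3 * j + r.
  by exists (i %/ 3), (i %% 3); rewrite ltn_mod; split=> //; have := divn_eq i 3; lia.
have [e0 e1] := base_positions j.
have [e2 e3] := base_positions j.+1.
have [e4 _] := base_positions j.+2.
have [y [y1 y2 yE]] := odd_preimage j.
have := b_even j; have := b_odd j.
have -> : j.*2 + 2 = j.+1.*2 by lia.
have -> : j.*2 + 4 = j.+2.*2 by lia.
have E3 : j.*2 + 3 = j.+1.*2 + 1 by lia.
rewrite E3 in yE => bo be.
have -> : (3 * j + r) %% 3 = r by rewrite mulnC modnMDl modn_small.
case: r r3 => [|[|[|//]]] _.
- have -> : b 0 + (3 * j + 0) = b j.*2 by lia.
  by move: be; lia.
- have -> : b 0 + (3 * j + 1) = y by lia.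
  by lia.
have -> : b 0 + (3 * j + 2) = b (j.*2 + 1) by lia.
by move: bo; lia.
Qed.

End Combinatorics.

(** * The defect invariant reverse *)

Local Open Scope ring_scope.

Lemma sum_shift (V : nmodType) (F : nat -> V) N r :
  (forall i, F (i + N)%N = F i) -> \sum_(i < N) F (r + i)%N = \sum_(i < N) F i.
Proof.
case: N => [|N] FN; first by rewrite !big_ord0.
elim: r => [|r IH]; first by apply: eq_bigr => i _; rewrite add0n.
rewrite -IH big_ord_recr big_ord_recl /= addn0 addrC.
rewrite addSn -addnS FN; congr (_ + _); apply: eq_bigr => i _.
by rewrite addSn -addnS.
Qed.

Section Shift.
Variables (K : fieldType) (A : falgType K) (U : {vspace A}) (e : A).
Variables (N : nat) (c : nat -> nat) (x : nat -> nat -> A).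
Hypothesis B : path_basis U e N c x.

Lemma path_basis_shift r :
  path_basis U e N (fun i => c (r + i)%N) (fun i l => x (r + i)%N l).
Proof.
split.
- exact: (pb_gt0 B).
- by move=> i; exact: (pb_len_gt0 B).
- by move=> i l; rewrite addnA; exact: (pb_period B).
- move=> i l j m; rewrite (pb_mul B) -addnA eqn_modDl.
  by [].
- by move=> i l; exact: (pb_eq0 B).
- rewrite (@sum_shift _ (fun i => x i 0%N)) ?(pb_one B) // => i.
  exact: (pb_period B).
- by move=> i l; exact: (pb_in B).
move=> a /(pb_span B)[k ->]; exists (fun i l => k ((r + i) %% N)%N l).
pose F i := \sum_(l < c i) k (i %% N)%N l *: x i l.
rewrite -[RHS]/(\sum_(i < N) F (r + i)%N) sum_shift => [|i].
  by apply: eq_bigr => i _; rewrite /F modn_small.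
rewrite /F (path_len_mod B (modnDr i N)) modnDr.
by apply: eq_bigr => l _; rewrite (pb_period B).
Qed.

End Shift.

Section KupischBlock.
Variables (K : fieldType) (A : falgType K).
Variables (N : nat) (c : nat -> nat) (x : nat -> nat -> A).
Hypothesis B : path_basis fullv 1 N c x.
Variables (k : nat) (s : seq nat).

Definition block_length i := nth 0%N s (i %% size s).

Lemma block_length_gt1 : (0 < size s)%N -> all (ltn 1) s -> forall i, (1 < block_length i)%N.
Proof. by move=> s0 s1 i; apply: (allP s1); rewrite mem_nth ?ltn_mod. Qed.

Lemma kupisch_block_path_basis : all (ltn 1) s ->
  kupisch_series A (flatten (nseq k s)) ->
  N = (k * size s)%N /\ exists r, (forall i, c (r + i)%N = block_length i) /\
    path_basis fullv 1 N block_length (fun i l => x (r + i)%N l).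
Proof.
move=> s1 /(kupisch_extract B (all_flatten_nseq _ s1))[].
rewrite size_flatten_nseq => NE [r rE]; split=> //; exists r.
have cE i : c (r + i)%N = block_length i.
  have Ei : (r + i = r + i %% N %[mod N])%N by rewrite modnDmr.
  have lt : (i %% N < N)%N by rewrite ltn_mod (pb_gt0 B).
  rewrite (path_len_mod B Ei) -(rE _ lt) nth_flatten_nseq ?NE //.
  by rewrite /block_length modn_dvdm // -NE dvdn_mull.
split=> //; have -> : block_length = fun i => c (r + i)%N.
  by apply: functional_extensionality => i; rewrite cE.
exact: path_basis_shift.
Qed.

Lemma kupisch_block_exists : N = (k * size s)%N -> all (ltn 1) s ->
  (forall i, c i = block_length i) -> kupisch_series A (flatten (nseq k s)).
Proof.
move=> NE s1 cE; have s0 : (0 < size s)%N.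
  by have := pb_gt0 B; rewrite NE muln_gt0 => /andP[].
apply: (kupisch_exists B); rewrite ?size_flatten_nseq // => i.
  by rewrite cE block_length_gt1.
by rewrite NE cE => iN; rewrite nth_flatten_nseq.
Qed.

End KupischBlock.

Lemma block23E i : block_length [:: 2; 3]%N i = (2 + odd i)%N.
Proof. by rewrite /block_length /= modn2; case: (odd i). Qed.

Lemma block344E i : block_length [:: 3; 4; 4]%N i = (3 + (i %% 3 != 0))%N.
Proof.
rewrite /block_length /=; have := ltn_pmod i (isT : 0 < 3)%N.
by case: (i %% 3)%N => [|[|[|]]].
Qed.

(** * The lengths (2,3)^k and (3,4,4)^k *)

Section Theta.
Variables (K : fieldType) (A : falgType K) (k : nat) (x : nat -> nat -> A).
Hypothesis k0 : (0 < k)%N.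
Hypothesis B : path_basis fullv 1 (k * 2) (block_length [:: 2; 3]%N) x.

Lemma base23E j : base (k * 2) (block_length [:: 2; 3]%N) j = ~~ odd j.
Proof.
have ok : odd (k * 2) = false by rewrite oddM andbF.
apply/(baseP B)/idP => [[i E]|oj].
  rewrite -(odd_mod j ok) -E odd_mod // block23E !oddD.
  by case: (odd i).
(* The vertex j - 2 modulo 2k, which is even and so has length 2. *)
exists (j + (k * 2 - 2))%N; rewrite block23E.
have -> : odd (j + (k * 2 - 2)) = false.
  by rewrite oddD oddB ?ok ?(negbTE oj) //; move: k0; clear; lia.
have -> : (j + (k * 2 - 2) + (2 + false) = j + k * 2)%N by move: k0; clear; lia.
by rewrite modnDr.
Qed.

Lemma enumeration23 :
  enumeration (base (k * 2) (block_length [:: 2; 3]%N)) (k * 2) k (fun i => i * 2)%N.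
Proof.
split=> // [i|j _|i].
- by rewrite base23E oddM andbF.
- rewrite base23E => oj; exists j./2.
  by rewrite muln2 even_halfK.
by rewrite mulnDl.
Qed.

Lemma defect23 : #|[pred j : 'I_(k * 2) | ~~ base (k * 2) (block_length [:: 2; 3]%N) j]| = k.
Proof.
rewrite (enumeration_card (pb_gt0 B) (@base_mod _ _) enumeration23).
by clear; lia.
Qed.

End Theta.

Section Lambda.
Variables (K : fieldType) (A : falgType K) (k : nat) (x : nat -> nat -> A).
Hypothesis k0 : (0 < k)%N.
Hypothesis B : path_basis fullv 1 (k * 3) (block_length [:: 3; 4; 4]%N) x.

(** For i of residue 0, 1, 2 modulo 3 the number i + c i has residue 0, 2, 0, so exactly the residue
    1 is missed. *)
Lemma base344E j : base (k * 3) (block_length [:: 3; 4; 4]%N) j = (j %% 3 != 1)%N.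
Proof.
have d3 : (3 %| k * 3)%N by rewrite dvdn_mull.
apply/(baseP B)/idP => [[i E]|j1].
  rewrite -(modn_dvdm j d3) -E modn_dvdm // block344E; clear; lia.
(* The preimage is j - 3 if j has residue 0, and j - 4, a vertex of length 4, if j has residue 2;
   adding 3k keeps the subtraction in range. *)
exists (j + k * 3 - 3 - (j %% 3 == 2))%N; rewrite block344E.
rewrite -[RHS]modnDr; congr (_ %% _)%N; move: k0 j1; clear; lia.
Qed.

(** The sequence 0, 2, 3, 5, 6, 8, ... of the numbers not congruent to 1 modulo 3. *)
Definition base344 i := (3 * i./2 + 2 * odd i)%N.

Lemma enumeration344 :
  enumeration (base (k * 3) (block_length [:: 3; 4; 4]%N)) (k * 3) (k * 2) base344.
Proof.
rewrite /base344; split=> [|i|i|j _|i].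
- by rewrite muln_gt0 k0.
- move: (odd_double_half i); rewrite /= uphalf_half; lia.
- rewrite base344E; case: (odd i); clear; lia.
- rewrite base344E => j1; exists ((j %/ 3).*2 + (j %% 3 == 2))%N.
  rewrite oddD odd_double halfD odd_double doubleK /=.
  by case: eqP; move: j1; clear; lia.
rewrite oddD oddM andbF addbF halfD oddM andbF /= muln2 doubleK.
by clear; lia.
Qed.

Lemma defect344 :
  #|[pred j : 'I_(k * 3) | ~~ base (k * 3) (block_length [:: 3; 4; 4]%N) j]| = k.
Proof.
rewrite (enumeration_card (pb_gt0 B) (@base_mod _ _) enumeration344).
by clear; lia.
Qed.

(** This is the relation required of c' for the corner: two steps from an even index cover distance
    3, three steps from an odd index cover distance 4. *)
Lemma base344_step i : base344 (i + block_length [:: 2; 3]%N i) =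
  (base344 i + block_length [:: 3; 4; 4]%N (base344 i))%N.
Proof.
have := odd_double_half i; rewrite block23E block344E /base344.
move: (i./2) => h; case: (odd i) => /= Ei.
  have -> : (i + 3 = h.+2.*2)%N by move: Ei; clear; lia.
  rewrite odd_double doubleK; clear; lia.
have -> : (i + 2 = h.+1.*2)%N by move: Ei; clear; lia.
rewrite odd_double doubleK; clear; lia.
Qed.

End Lambda.

Section Reverse.
Variables (K : fieldType) (Theta : falgType K) (k : nat) (z : nat -> nat -> Theta).
Hypothesis k0 : (0 < k)%N.
Hypothesis Bz : path_basis fullv 1 (k * 2) (block_length [:: 2; 3]%N) z.

(** The corner of Lambda has a path basis with the lengths of Theta, so it is isomorphic to Theta.
    The defects are 3k - 2k and 2k - k. *)
Lemma reverse344 (Lambda : falgType K) (x : nat -> nat -> Lambda) :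
  path_basis fullv 1 (k * 3) (block_length [:: 3; 4; 4]%N) x ->
  cyclic_nakayama Lambda -> defect_invariant_reverse Theta Lambda.
Proof.
move=> Bx Lnak; split=> //.
  apply/(syzygy_corner Bx (@block_length_gt1 [:: 3; 4; 4]%N isT isT)).
  have By := corner_path_basis Bx (enumeration344 k0 Bx) base344_step.
  apply: (path_basis_corner_algebra _ By Bz) => a.
  by split=> [E|/(cornerP Bx)//]; apply/(cornerP Bx).
exists k; first by rewrite -(defect344 k0 Bx); exact: card_defect Bx.
by rewrite -(defect23 k0 Bz); exact: card_defect Bz.
Qed.

Lemma reverse_kupisch (Lambda : falgType K) :
  kupisch_series Theta (flatten (nseq k [:: 2; 3]%N)) ->
  defect_invariant_reverse Theta Lambda ->
  kupisch_series Lambda (flatten (nseq k [:: 3; 4; 4]%N)).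
Proof.
move=> Tkup [/cyclic_nakayama_path_basis[N [c [x [B c2]]]] /(syzygy_corner B c2) Tc].
move=> [d /(defect_card B) dL /(defect_card Bz)].
rewrite (defect23 k0 Bz) => dk; rewrite dk in dL.
have N0 := pb_gt0 B.
have [m [b Eb]] : exists m b, enumeration (base N c) N m b.
  apply: enumeration_exists N0 _ _ => [i|].
    by apply: base_mod; rewrite modnDr.
  by exists (0 + c 0)%N; apply/(baseP B); exists 0%N.
have [c' c'E] : exists c' : nat -> nat, forall i, b (i + c' i)%N = (b i + c (b i))%N.
  apply: (@fun_choice _ _ (fun i l => b (i + l)%N = (b i + c (b i))%N)) => i.
  have le0 : (b 0%N <= b i + c (b i))%N.
    by apply: leq_trans (leq_addr _ _); rewrite (en_leq Eb).
  have [|j jE] := en_surj Eb le0; first by apply/(baseP B); exists (b i).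
  by exists (j - i)%N; rewrite subnKC // -(en_leq Eb) -jE leq_addr.
have By := corner_path_basis B Eb c'E.
have [y Bt] : exists y, path_basis fullv (1 : Theta) m c' y.
  apply: (corner_algebra_path_basis _ By Tc) => a.
  by split=> [E|/(cornerP B)//]; apply/(cornerP B).
(* The corner basis and the given Kupisch series describe the same algebra, so m = 2k and c'
   alternates between 2 and 3 up to a rotation r. *)
have [mE [r [rE _]]] := kupisch_block_path_basis Bt (s := [:: 2; 3]%N) isT Tkup.
rewrite (enumeration_card N0 (@base_mod _ _) Eb) mE /= in dL.
(* Equal defects read k = N - 2k with truncated subtraction; k > 0 excludes the truncated case. *)
have N3 : N = (3 * k)%N by move: dL k0; clear; lia.
(* Starting the enumeration at r absorbs the rotation. *)
have Eb' := en_shift Eb r; rewrite mE /= in Eb'.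
have lenE i : c (b (r + 0)%N + i)%N = (3 + (i %% 3 != 0))%N.
  apply: (base_lengths (b := fun i => b (r + i)%N) k0 N3 _ (path_len_step B) _ Eb').
  - by move=> i1 j E; exact: (path_len_mod B E).
  - by move=> j /(baseP B).
  - by move=> j; rewrite -c'E rE block23E odd_double addn0 addnA.
  by move=> j; rewrite -c'E rE block23E oddD odd_double -!addnA.
have Bs := path_basis_shift B (b (r + 0)%N).
apply: (kupisch_block_exists Bs) => //; first by rewrite N3 mulnC.
by move=> i; rewrite block344E lenE.
Qed.

End Reverse.

(** The truncated path algebra applies: the lengths are well defined modulo 3k, and lengths in {3,
    4} never drop by more than 1. *)
Lemma kupisch344_exists (K : fieldType) (k : nat) : (0 < k)%N ->
  exists2 Lambda : falgType K, cyclic_nakayama Lambda &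
    exists x, path_basis fullv (1 : Lambda) (k * 3) (block_length [:: 3; 4; 4]%N) x.
Proof.
move=> k0; have [n nE] : exists n, (k * 3)%N = n.+1.
  by exists (k * 3).-1; rewrite prednK // muln_gt0 k0.
pose len (i : 'I_n.+1) := block_length [:: 3; 4; 4]%N i.
have len1 i : (1 < len i)%N by exact: block_length_gt1.
have lenS i : (len i <= (len (ordS i)).+1)%N.
  by rewrite /len !block344E; clear; case: (_ != _); case: (_ != _).
exists (truncated_algebra K (LengthData len1 lenS)).
  exact: truncated_algebra_nakayama.
have [x B] := truncated_algebra_path_basis K (LengthData len1 lenS).
exists x; rewrite nE.
have <- // : (fun i => len (inZp i)) = block_length [:: 3; 4; 4]%N.
apply: functional_extensionality => i; rewrite /len !block344E /= -nE.
by rewrite modn_dvdm // dvdn_mull.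
Qed.

Local Close Scope ring_scope.

Theorem proposition4p6p4 (K : fieldType) (k : nat) (hk : (1 <= k)%N)
  (Theta : falgType K) (hTheta : cyclic_nakayama Theta)
  (hkup : kupisch_series Theta (flatten (nseq k [:: 2; 3]))) :
  (exists Lambda : falgType K, defect_invariant_reverse Theta Lambda) /\
  (forall Lambda : falgType K,
     defect_invariant_reverse Theta Lambda <->
     cyclic_nakayama Lambda /\
     kupisch_series Lambda (flatten (nseq k [:: 3; 4; 4]))).
Proof.
have [N [c [x [B _]]]] := cyclic_nakayama_path_basis hTheta.
have [NE [r [_ Bz]]] := kupisch_block_path_basis B (s := [:: 2; 3]) isT hkup.
rewrite NE /= in Bz; split.
  have [Lambda Lnak [y By]] := kupisch344_exists K hk.
  by exists Lambda; exact: (reverse344 hk Bz By).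
move=> Lambda; split=> [Lrev|[Lnak Lkup]].
  by split; [case: Lrev|exact: (reverse_kupisch hk Bz hkup Lrev)].
have [M [d [y [By _]]]] := cyclic_nakayama_path_basis Lnak.
have [ME [s [_ Bs]]] := kupisch_block_path_basis By (s := [:: 3; 4; 4]) isT Lkup.
rewrite ME /= in Bs; exact: (reverse344 hk Bz Bs).
Qed.
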